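(* Let $\alpha\in(0,1)$ and let $$x=\frac{{}_2F_1\left(\frac12,\frac12;1;\alpha\right)}{{}_2F_1\left(\frac12,\frac12;1;1-\alpha\right)}.$$ Let $a\in\{2,4,6,\dots\}$ and $b\in\mathbb{Z}$ with $\gcd(a,b)=1$. Then $$F_{(a,b)}(x)=\frac{\pi}{ax}\sum_{j=0}^{a-1}\cos\left(\frac{\pi(2j+1)b}{a}\right)\log\left(\operatorname{dn}\left(\frac{(2j+1)K}{a}\right)\right).$$
   Context: For integers $a,b$ and $x>0$, $$F_{(a,b)}(x):=\sum_{n=-\infty}^{\infty}\sum_{m=-\infty}^{\infty}\frac{(-1)^{m+n}}{(xm)^2+(an+b)^2},$$ interpreted (the series is not absolutely convergent) as $\lim_{N\to\infty}\sum_{-N<n<N}\left(\sum_{m\in\mathbb{Z}}\frac{(-1)^{m+n}}{(xm)^2+(an+b)^2}\right)$, where for each fixed $n$ the inner sum over $m$ converges absolutely. ${}_2F_1$ is the Gauss hypergeometric function. $\operatorname{dn}(u)$ is the Jacobian elliptic function with parameter $\alpha=k^2$ ($k$ the elliptic modulus), and $K=\frac{\pi}{2}\,{}_2F_1\left(\frac12,\frac12;1;\alpha\right)$ is the complete elliptic integral of the first kind with the same modulus $k$. For real $u$, $\operatorname{dn}(u)$ is a positive real number and $\log$ is the real logarithm. *)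

(* Defs.v *)
From Stdlib Require Import Reals ZArith List Lra Lia.
From Coquelicot Require Import Coquelicot.
Open Scope R_scope.

Fixpoint pochhammer (a : R) (n : nat) : R :=
  match n with
  | O => 1
  | S p => pochhammer a p * (a + INR p)
  end.

(* Sum of the Gauss series; meaningful for |z| < 1 and c not in {0, -1, -2, ...}. *)
Definition hyp2F1 (a b c z : R) : R :=
  PSeries (fun n => pochhammer a n * pochhammer b n
                    / (pochhammer c n * INR (fact n))) z.

(* For elliptic functions, alpha is the parameter k^2, not the modulus k. *)
Definition ellipticK (alpha : R) : R := PI / 2 * hyp2F1 (1/2) (1/2) 1 alpha.

Definition ellipticF (alpha phi : R) : R :=
  RInt (fun t => / sqrt (1 - alpha * (sin t) ^ 2)) 0 phi.

(* Jacobi amplitude: the unique phi with ellipticF alpha phi = u; existence and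
   uniqueness for 0 <= alpha < 1 are lemma [ellipticF_am] below. *)
Definition jacobi_am (alpha u : R) : R := iota (fun phi : R => ellipticF alpha phi = u).

Definition jacobi_dn (alpha u : R) : R :=
  sqrt (1 - alpha * (sin (jacobi_am alpha u)) ^ 2).

(* Sum of f n over the integers lo <= n < hi. *)
Definition sumZ (lo hi : Z) (f : Z -> R) : R :=
  fold_right Rplus 0
    (map (fun k => f (lo + Z.of_nat k)%Z) (seq 0 (Z.to_nat (hi - lo)))).

(* Used only for absolutely convergent families over Z, for which splitting
   into nonnegative and negative indices is harmless. *)
Definition SeriesZ (f : Z -> R) : R :=
  Series (fun k => f (Z.of_nat k)) + Series (fun k => f (- Z.of_nat (S k))%Z).

Definition abs_summableZ (f : Z -> R) : Prop :=
  ex_series (fun k => Rabs (f (Z.of_nat k))) /\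
  ex_series (fun k => Rabs (f (- Z.of_nat (S k))%Z)).

(* For x > 0 the denominator vanishes only if m = 0 and a n + b = 0, which is excluded
   when gcd(a, b) = 1 and a >= 2. *)
Definition F_term (a b : Z) (x : R) (n m : Z) : R :=
  powerRZ (-1) (m + n) / ((x * IZR m) ^ 2 + (IZR (a * n + b)) ^ 2).

Definition F_partial (a b : Z) (x : R) (N : nat) : R :=
  sumZ (1 - Z.of_nat N) (Z.of_nat N) (fun n => SeriesZ (F_term a b x n)).

Definition F (a b : Z) (x : R) : R := real (Lim_seq (F_partial a b x)).

(* [Series] and [Lim_seq] are total, so that the value [F a b x] is the intended
   one has to be asserted separately. *)
Definition F_converges (a b : Z) (x : R) : Prop :=
  (forall n : Z, abs_summableZ (F_term a b x n)) /\
  ex_finite_lim_seq (F_partial a b x).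

Local Definition g (alpha t : R) : R := / sqrt (1 - alpha * (sin t) ^ 2).

Local Lemma radicand_bounds (alpha t : R) :
  0 <= alpha < 1 -> 0 < 1 - alpha * (sin t) ^ 2 <= 1.
Proof.
intros Halpha.
assert (0 <= sin t ^ 2 <= 1).
{ pose proof (sin2_cos2 t) as H; pose proof (Rle_0_sqr (sin t)).
  pose proof (Rle_0_sqr (cos t)); unfold Rsqr in *; simpl; lra. }
split; nra.
Qed.

Local Lemma g_ge1 (alpha t : R) :
  0 <= alpha < 1 -> 1 <= g alpha t.
Proof.
intros Halpha.
destruct (radicand_bounds alpha t Halpha) as [H0 H1].
unfold g; replace 1 with (/ sqrt 1) at 1 by (rewrite sqrt_1; apply Rinv_1).
apply Rinv_le_contravar; [exact (sqrt_lt_R0 _ H0) | exact (sqrt_le_1_alt _ _ H1)].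
Qed.

Local Lemma g_continuous (alpha t : R) :
  0 <= alpha < 1 -> continuous (g alpha) t.
Proof.
intros Halpha.
apply (ex_derive_continuous (K := R_AbsRing) (V := R_NormedModule)).
unfold g; auto_derive.
pose proof (radicand_bounds alpha t Halpha) as [H0 _]; simpl in H0.
repeat split; trivial; apply Rgt_not_eq, sqrt_lt_R0; exact H0.
Qed.

Local Lemma ellipticF_derive (alpha t : R) :
  0 <= alpha < 1 -> is_derive (ellipticF alpha) t (g alpha t).
Proof.
intros Halpha.
apply (is_derive_RInt (V := R_NormedModule) (g alpha) (ellipticF alpha) 0 t).
- apply filter_forall; intros y.
  apply (RInt_correct (V := R_CompleteNormedModule) (g alpha)).
  apply (ex_RInt_continuous (V := R_CompleteNormedModule)).
  intros z _; now apply g_continuous.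
- now apply g_continuous.
Qed.

Local Lemma ellipticF_continuity (alpha : R) :
  0 <= alpha < 1 -> continuity (ellipticF alpha).
Proof.
intros Halpha t; apply continuity_pt_filterlim.
apply (ex_derive_continuous (K := R_AbsRing) (V := R_NormedModule)).
eexists; now apply ellipticF_derive.
Qed.

Local Lemma ellipticF_expand (alpha p q : R) :
  0 <= alpha < 1 -> p <= q -> q - p <= ellipticF alpha q - ellipticF alpha p.
Proof.
intros Halpha Hpq.
destruct (MVT_gen (ellipticF alpha) p q (g alpha)) as [c [_ ->]].
- intros; now apply ellipticF_derive.
- intros; now apply ellipticF_continuity.
- pose proof (g_ge1 alpha c Halpha); nra.
Qed.

Lemma ellipticF_bijective (alpha u : R) :
  0 <= alpha < 1 -> exists! phi : R, ellipticF alpha phi = u.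
Proof.
intros Halpha.
assert (H0 : ellipticF alpha 0 = 0) by apply (RInt_point (V := R_CompleteNormedModule)).
pose proof (Rle_abs u); pose proof (Rle_abs (- u)) as Hn; rewrite Rabs_Ropp in Hn.
pose proof (Rabs_pos u).
pose proof (ellipticF_expand alpha 0 (Rabs u) Halpha) as Hr.
pose proof (ellipticF_expand alpha (- Rabs u) 0 Halpha) as Hl.
destruct (IVT_gen (ellipticF alpha) (- Rabs u) (Rabs u) u) as [phi [_ Hphi]].
- now apply ellipticF_continuity.
- rewrite Rmin_left, Rmax_right; lra.
- exists phi; split; [exact Hphi|].
  intros psi Hpsi.
  destruct (Rle_dec phi psi) as [Hle|Hle].
  + pose proof (ellipticF_expand alpha phi psi Halpha Hle); lra.
  + pose proof (ellipticF_expand alpha psi phi Halpha); lra.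
Qed.

Lemma ellipticF_am (alpha u : R) :
  0 <= alpha < 1 -> ellipticF alpha (jacobi_am alpha u) = u.
Proof.
intros Halpha.
exact (iota_correct (V := R_CompleteNormedModule)
         (fun phi : R => ellipticF alpha phi = u) (ellipticF_bijective alpha u Halpha)).
Qed.

(* Main.v *)
(* The alternating cosecant expansion turns the inner sum over m into
   (-1)^n PI / (x k sinh (k c)) with k = a n + b and c = PI / x, and a finite Fourier transform
   over the odd multiples of PI / a shows that the right-hand side is the same sum, once
     ln (dn (v K / PI)) = sum_(k odd in Z) (cos (k v) - 1) / (k sinh (k c)),   c = PI K' / K.
   To prove this expansion, fix c, let g(v) be the right-hand side and f = - g'. Since
   1 / (sinh u sinh v) = (coth u + coth v) / sinh (u + v), the convolution of the coefficients
   1 / sinh (j c), j odd, of f with C0 at m = 0 and m / sinh (m c) elsewhere can be summed, and for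
   a suitable C0 it gives n^2 / (2 sinh (n c)). So Y = C0 + sum_m m cos (m v) / sinh (m c)
   satisfies Y' = 2 g' Y, hence Y is proportional to exp (2 g). With the analogous series with
   signs (-1)^m, this gives for exp g the differential equation of dn with complementary modulus
   exp (g PI). The same computation along the imaginary axis (cosh for cos), where g blows up
   at c, gives the complementary quarter period, so that c = PI K' / K for the modulus attached
   to c; strict monotonicity of K' / K then identifies this modulus with the given one. *)
From Stdlib Require Import Reals ZArith Lra Lia List.
From Coquelicot Require Import Coquelicot.
Require Import Defs.
Open Scope R_scope.

(** * Absolutely convergent series over Z *)

(** Deriving the Fourier series of log dn from the integral that defines dn would call for its
    complex periods. The argument therefore starts from the series: c is the datum, the modulus is
    read off from the value at v = PI, and only afterwards is the series recognized as log dn. All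
    variables stay real: the imaginary axis is a second instance (cosh, sinh) of the structure that
    also covers (cos, sin) and its twists by (-1)^m. Up to a factor, Y is dn^2, so C0 carries its
    mean value. It is determined by asking that the convolution be exact for odd n; for even n it
    does not enter. The imaginary quarter period lies on the boundary of the domain of convergence,
    so it can only be reached as a limit from inside. On the side of F, a being even and coprime to
    b makes every a n + b odd, hence a frequency of log dn. The sign (-1)^n is the value of cos at a
    n times any odd multiple of PI / a. *)

Lemma abs_summableZ_le (f h : Z -> R) :
  (forall k, Rabs (f k) <= h k) -> abs_summableZ h -> abs_summableZ f.
Proof.
intros H [H1 H2]; split.
- apply (@ex_series_le R_AbsRing R_CompleteNormedModule) with (2 := H1).
  intros n; unfold norm; simpl; unfold abs; simpl; rewrite Rabs_Rabsolu.
  eapply Rle_trans; [apply H | apply Rle_abs].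
- apply (@ex_series_le R_AbsRing R_CompleteNormedModule) with (2 := H2).
  intros n; unfold norm; simpl; unfold abs; simpl; rewrite Rabs_Rabsolu.
  eapply Rle_trans; [apply H | apply Rle_abs].
Qed.

Lemma abs_summableZ_ext (f h : Z -> R) :
  (forall k, f k = h k) -> abs_summableZ f -> abs_summableZ h.
Proof.
intros H [H1 H2]; split; eapply ex_series_ext; [| exact H1 | | exact H2];
  intros n; simpl; now rewrite H.
Qed.

Lemma abs_summableZ_scal (r : R) (f : Z -> R) :
  abs_summableZ f -> abs_summableZ (fun k => r * f k).
Proof.
intros [H1 H2]; split.
- apply ex_series_ext with (fun k => Rabs r * Rabs (f (Z.of_nat k))).
  { intros n; now rewrite Rabs_mult. }
  now apply (ex_series_scal_l (Rabs r)) in H1.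
- apply ex_series_ext with (fun k => Rabs r * Rabs (f (- Z.of_nat (S k))%Z)).
  { intros n; now rewrite Rabs_mult. }
  now apply (ex_series_scal_l (Rabs r)) in H2.
Qed.

Lemma abs_summableZ_abs (f : Z -> R) :
  abs_summableZ f -> abs_summableZ (fun k => Rabs (f k)).
Proof.
intros [H1 H2]; split; eapply ex_series_ext; [| exact H1 | | exact H2];
  intros n; simpl; now rewrite Rabs_Rabsolu.
Qed.

Lemma abs_summableZ_plus (f h : Z -> R) :
  abs_summableZ f -> abs_summableZ h -> abs_summableZ (fun k => f k + h k).
Proof.
intros Hf Hh.
apply abs_summableZ_le with (fun k => Rabs (f k) + Rabs (h k)).
{ intros k; apply Rabs_triang. }
destruct Hf as [F1 F2], Hh as [H1 H2]; split.
- apply ex_series_ext with (fun k => Rabs (f (Z.of_nat k)) + Rabs (h (Z.of_nat k))).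
  { intros n; symmetry; apply Rabs_pos_eq.
    pose proof (Rabs_pos (f (Z.of_nat n))); pose proof (Rabs_pos (h (Z.of_nat n))); lra. }
  now apply (@ex_series_plus R_AbsRing R_NormedModule).
- apply ex_series_ext with
    (fun k => Rabs (f (- Z.of_nat (S k))%Z) + Rabs (h (- Z.of_nat (S k))%Z)).
  { intros n; symmetry; apply Rabs_pos_eq.
    pose proof (Rabs_pos (f (- Z.of_nat (S n))%Z));
    pose proof (Rabs_pos (h (- Z.of_nat (S n))%Z)); lra. }
  now apply (@ex_series_plus R_AbsRing R_NormedModule).
Qed.

Lemma abs_summableZ_ex (f : Z -> R) :
  abs_summableZ f ->
  ex_series (fun k => f (Z.of_nat k)) /\ ex_series (fun k => f (- Z.of_nat (S k))%Z).
Proof. intros [H1 H2]; split; now apply ex_series_Rabs. Qed.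

Lemma SeriesZ_ext (f h : Z -> R) : (forall k, f k = h k) -> SeriesZ f = SeriesZ h.
Proof. intros H; unfold SeriesZ; f_equal; apply Series_ext; intros; apply H. Qed.

Lemma SeriesZ_scal (r : R) (f : Z -> R) : SeriesZ (fun k => r * f k) = r * SeriesZ f.
Proof.
unfold SeriesZ; rewrite Rmult_plus_distr_l; f_equal.
- apply (Series_scal_l r (fun k => f (Z.of_nat k))).
- apply (Series_scal_l r (fun k => f (- Z.of_nat (S k))%Z)).
Qed.

Lemma SeriesZ_plus (f h : Z -> R) :
  abs_summableZ f -> abs_summableZ h ->
  SeriesZ (fun k => f k + h k) = SeriesZ f + SeriesZ h.
Proof.
intros Hf Hh; apply abs_summableZ_ex in Hf, Hh.
destruct Hf as [F1 F2], Hh as [H1 H2]; unfold SeriesZ.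
rewrite (Series_plus (fun k => f (Z.of_nat k))); auto.
rewrite (Series_plus (fun k => f (- Z.of_nat (S k))%Z)); auto; ring.
Qed.

Lemma SeriesZ_0 : SeriesZ (fun _ => 0) = 0.
Proof.
rewrite <- (SeriesZ_ext (fun k => 0 * 0)) by (intros; ring).
rewrite SeriesZ_scal; ring.
Qed.

Lemma SeriesZ_le (f h : Z -> R) :
  (forall k, f k <= h k) -> abs_summableZ f -> abs_summableZ h ->
  SeriesZ f <= SeriesZ h.
Proof.
intros H Hf Hh.
assert (E : SeriesZ h = SeriesZ f + SeriesZ (fun k => h k + -1 * f k)).
{ rewrite SeriesZ_plus; auto; [|now apply abs_summableZ_scal].
  rewrite SeriesZ_scal; ring. }
rewrite E.
enough (0 <= SeriesZ (fun k => h k + -1 * f k)) by lra.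
assert (S : abs_summableZ (fun k => h k + -1 * f k)).
{ apply abs_summableZ_plus; auto; now apply abs_summableZ_scal. }
apply abs_summableZ_ex in S; destruct S as [S1 S2].
rewrite <- SeriesZ_0; unfold SeriesZ; apply Rplus_le_compat;
  (apply Series_le; [intros n | assumption]).
- specialize (H (Z.of_nat n)); lra.
- specialize (H (- Z.of_nat (S n))%Z); lra.
Qed.

Lemma SeriesZ_Rabs (f : Z -> R) :
  abs_summableZ f -> Rabs (SeriesZ f) <= SeriesZ (fun k => Rabs (f k)).
Proof.
intros H; pose proof (abs_summableZ_abs f H) as HA.
apply Rabs_le; split.
- replace (- SeriesZ (fun k => Rabs (f k))) with (SeriesZ (fun k => -1 * Rabs (f k)))
    by (rewrite SeriesZ_scal; ring).
  apply SeriesZ_le; auto using abs_summableZ_scal.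
  intros k; pose proof (Rle_abs (- f k)); rewrite Rabs_Ropp in *; lra.
- apply SeriesZ_le; auto; intros; apply Rle_abs.
Qed.

Lemma abs_summableZ_opp (f : Z -> R) :
  abs_summableZ f -> abs_summableZ (fun k => f (- k)%Z).
Proof.
intros [H1 H2]; split.
- apply (@ex_series_incr_1 R_AbsRing R_NormedModule); exact H2.
- apply (@ex_series_incr_1 R_AbsRing R_NormedModule) in H1.
  eapply ex_series_ext with (2 := H1); intros n; cbv beta.
  do 2 f_equal; lia.
Qed.

Lemma SeriesZ_opp (f : Z -> R) :
  abs_summableZ f -> SeriesZ (fun k => f (- k)%Z) = SeriesZ f.
Proof.
intros H; pose proof (abs_summableZ_opp f H) as H'.
apply abs_summableZ_ex in H, H'; unfold SeriesZ.
rewrite (Series_incr_1 _ (proj1 H)), (Series_incr_1 _ (proj1 H')).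
rewrite (Series_ext (fun k => f (- - Z.of_nat (S k))%Z) (fun k => f (Z.of_nat (S k)))).
- simpl; ring.
- intros n; f_equal; lia.
Qed.

Lemma abs_summableZ_succ (f : Z -> R) :
  abs_summableZ f -> abs_summableZ (fun k => f (k + 1)%Z).
Proof.
intros [H1 H2]; split.
- apply (@ex_series_incr_1 R_AbsRing R_NormedModule) in H1.
  eapply ex_series_ext with (2 := H1); intros n; cbv beta; do 2 f_equal; lia.
- apply (@ex_series_incr_1 R_AbsRing R_NormedModule).
  eapply ex_series_ext with (2 := H2); intros n; cbv beta; do 2 f_equal; lia.
Qed.

Lemma SeriesZ_succ (f : Z -> R) :
  abs_summableZ f -> SeriesZ (fun k => f (k + 1)%Z) = SeriesZ f.
Proof.
intros H; pose proof (abs_summableZ_succ f H) as H'.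
apply abs_summableZ_ex in H, H'; unfold SeriesZ.
rewrite (Series_incr_1 _ (proj1 H)), (Series_incr_1 _ (proj2 H')).
rewrite (Series_ext (fun k => f (Z.of_nat k + 1)%Z) (fun k => f (Z.of_nat (S k)))).
2: intros n; f_equal; lia.
rewrite (Series_ext (fun k => f (- Z.of_nat (S (S k)) + 1)%Z) (fun k => f (- Z.of_nat (S k))%Z)).
2: intros n; f_equal; lia.
simpl; ring.
Qed.

Lemma SeriesZ_shift_nat (f : Z -> R) (n : nat) :
  abs_summableZ f ->
  abs_summableZ (fun k => f (k + Z.of_nat n)%Z) /\
  SeriesZ (fun k => f (k + Z.of_nat n)%Z) = SeriesZ f.
Proof.
intros H; induction n as [|n [IH1 IH2]].
- split; [apply abs_summableZ_ext with f | apply SeriesZ_ext]; auto;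
    intros k; f_equal; lia.
- split.
  + apply abs_summableZ_ext with (2 := abs_summableZ_succ _ IH1); intros k; f_equal; lia.
  + rewrite <- IH2, <- (SeriesZ_succ _ IH1); apply SeriesZ_ext; intros k; f_equal; lia.
Qed.

Lemma SeriesZ_shift_opp_nat (f : Z -> R) (n : nat) :
  abs_summableZ f ->
  abs_summableZ (fun k => f (k - Z.of_nat n)%Z) /\
  SeriesZ (fun k => f (k - Z.of_nat n)%Z) = SeriesZ f.
Proof.
intros H; pose proof (abs_summableZ_opp f H) as HO.
destruct (SeriesZ_shift_nat _ n HO) as [H1 H2]; split.
- apply abs_summableZ_ext with (2 := abs_summableZ_opp _ H1); intros k; f_equal; lia.
- rewrite <- (SeriesZ_opp f H), <- H2, <- (SeriesZ_opp _ H1).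
  apply SeriesZ_ext; intros k; f_equal; lia.
Qed.

Lemma SeriesZ_shift (f : Z -> R) (p : Z) :
  abs_summableZ f ->
  abs_summableZ (fun k => f (k + p)%Z) /\ SeriesZ (fun k => f (k + p)%Z) = SeriesZ f.
Proof.
intros H; destruct (Z_le_dec 0 p) as [Hp|Hp].
- pose proof (SeriesZ_shift_nat f (Z.to_nat p) H) as S.
  rewrite Z2Nat.id in S by lia; exact S.
- destruct (SeriesZ_shift_opp_nat f (Z.to_nat (- p)) H) as [S1 S2].
  rewrite Z2Nat.id in S1, S2 by lia; split.
  + apply abs_summableZ_ext with (2 := S1); intros; f_equal; lia.
  + rewrite <- S2; apply SeriesZ_ext; intros; f_equal; lia.
Qed.

Lemma SeriesZ_odd (f : Z -> R) :
  abs_summableZ f -> (forall k, f (- k)%Z = - f k) -> SeriesZ f = 0.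
Proof.
intros H Ho; pose proof (SeriesZ_opp f H) as E.
rewrite (SeriesZ_ext _ (fun k => -1 * f k)), SeriesZ_scal in E; [lra|].
intros k; rewrite Ho; ring.
Qed.

(** * Finite sums over integer intervals and symmetric partial sums *)

Lemma sumZ_nil (lo hi : Z) (f : Z -> R) : (hi <= lo)%Z -> sumZ lo hi f = 0.
Proof. intros H; unfold sumZ; replace (Z.to_nat (hi - lo)) with O by lia; reflexivity. Qed.

Lemma sumZ_succ_r (lo hi : Z) (f : Z -> R) :
  (lo <= hi)%Z -> sumZ lo (hi + 1) f = sumZ lo hi f + f hi.
Proof.
intros H; unfold sumZ.
replace (Z.to_nat (hi + 1 - lo)) with (S (Z.to_nat (hi - lo))) by lia.
rewrite seq_S, map_app, fold_right_app; simpl.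
replace (lo + Z.of_nat (Z.to_nat (hi - lo)))%Z with hi by lia.
generalize (seq 0 (Z.to_nat (hi - lo))) as l; intros l.
induction l as [|i l IH]; simpl; [|rewrite IH]; ring.
Qed.

Lemma sumZ_ind (P : Z -> Prop) (lo : Z) :
  P lo -> (forall hi, (lo <= hi)%Z -> P hi -> P (hi + 1)%Z) ->
  forall hi, (lo <= hi)%Z -> P hi.
Proof.
intros H0 HS hi H; replace hi with (lo + Z.of_nat (Z.to_nat (hi - lo)))%Z by lia.
induction (Z.to_nat (hi - lo)) as [|n IH].
- replace (lo + Z.of_nat 0)%Z with lo by lia; exact H0.
- replace (lo + Z.of_nat (S n))%Z with (lo + Z.of_nat n + 1)%Z by lia; apply HS; auto; lia.
Qed.

Lemma sumZ_ext (lo hi : Z) (f h : Z -> R) :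
  (forall k, (lo <= k < hi)%Z -> f k = h k) -> sumZ lo hi f = sumZ lo hi h.
Proof.
destruct (Z_le_dec lo hi) as [Hle|Hle].
2: intros _; rewrite !sumZ_nil by lia; reflexivity.
revert hi Hle; apply (sumZ_ind (fun hi => (forall k, (lo <= k < hi)%Z -> f k = h k) ->
  sumZ lo hi f = sumZ lo hi h)).
- intros _; rewrite !sumZ_nil by lia; reflexivity.
- intros hi Hle IH H; rewrite !sumZ_succ_r by lia; rewrite IH, H; auto; try lia.
  intros; apply H; lia.
Qed.

Lemma sumZ_succ_l (lo hi : Z) (f : Z -> R) :
  (lo <= hi)%Z -> sumZ (lo - 1) hi f = f (lo - 1)%Z + sumZ lo hi f.
Proof.
revert hi; apply (sumZ_ind (fun hi => sumZ (lo - 1) hi f = f (lo - 1)%Z + sumZ lo hi f)).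
- rewrite (sumZ_nil lo lo) by lia; replace lo with (lo - 1 + 1)%Z at 2 by lia.
  rewrite sumZ_succ_r by lia; rewrite sumZ_nil by lia; ring.
- intros hi H IH; rewrite !sumZ_succ_r by lia; rewrite IH; ring.
Qed.

Lemma sumZ_scal (lo hi : Z) (r : R) (f : Z -> R) :
  sumZ lo hi (fun k => r * f k) = r * sumZ lo hi f.
Proof.
unfold sumZ; induction (seq 0 (Z.to_nat (hi - lo))) as [|i l IH]; simpl; [|rewrite IH]; ring.
Qed.

Lemma sumZ_plus (lo hi : Z) (f h : Z -> R) :
  sumZ lo hi (fun k => f k + h k) = sumZ lo hi f + sumZ lo hi h.
Proof.
unfold sumZ; induction (seq 0 (Z.to_nat (hi - lo))) as [|i l IH]; simpl; [|rewrite IH]; ring.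
Qed.

Lemma sumZ_le (lo hi : Z) (f h : Z -> R) :
  (forall k, f k <= h k) -> sumZ lo hi f <= sumZ lo hi h.
Proof.
intros H; unfold sumZ; induction (seq 0 (Z.to_nat (hi - lo))) as [|i l IH]; simpl; [lra|].
specialize (H (lo + Z.of_nat i)%Z); lra.
Qed.

Lemma sumZ_Rabs (lo hi : Z) (f : Z -> R) :
  Rabs (sumZ lo hi f) <= sumZ lo hi (fun k => Rabs (f k)).
Proof.
unfold sumZ; induction (seq 0 (Z.to_nat (hi - lo))) as [|i l IH]; simpl.
- rewrite Rabs_R0; lra.
- eapply Rle_trans; [apply Rabs_triang|]; lra.
Qed.

Lemma SeriesZ_sumZ (lo hi : Z) (u : Z -> Z -> R) :
  (forall i, abs_summableZ (u i)) ->
  abs_summableZ (fun j => sumZ lo hi (fun i => u i j)) /\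
  SeriesZ (fun j => sumZ lo hi (fun i => u i j)) = sumZ lo hi (fun i => SeriesZ (u i)).
Proof.
intros H; unfold sumZ; induction (seq 0 (Z.to_nat (hi - lo))) as [|i l [IH1 IH2]]; simpl.
- split; [|apply SeriesZ_0].
  apply abs_summableZ_ext with (fun j => 0 * u 0%Z j); [intros; ring|].
  now apply abs_summableZ_scal.
- split; [now apply abs_summableZ_plus|].
  rewrite (SeriesZ_plus (u (lo + Z.of_nat i)%Z)), IH2; auto.
Qed.

Notation symsum f N := (sumZ (1 - Z.of_nat N) (Z.of_nat N) f).

Lemma symsum_S (f : Z -> R) (N : nat) :
  (1 <= N)%nat ->
  symsum f (S N) = symsum f N + f (Z.of_nat N) + f (- Z.of_nat N)%Z.
Proof.
intros H; replace (1 - Z.of_nat (S N))%Z with (1 - Z.of_nat N - 1)%Z by lia.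
rewrite sumZ_succ_l by lia; rewrite Nat2Z.inj_succ; unfold Z.succ.
rewrite sumZ_succ_r by lia; replace (1 - Z.of_nat N - 1)%Z with (- Z.of_nat N)%Z by lia; ring.
Qed.

Lemma symsum_sum_n (f : Z -> R) (N : nat) :
  symsum f (S (S N)) =
  sum_n (fun k => f (Z.of_nat k)) (S N) + sum_n (fun k => f (- Z.of_nat (S k))%Z) N.
Proof.
induction N as [|N IH].
- rewrite symsum_S by lia; rewrite sum_Sn, !sum_O; unfold plus; simpl.
  unfold sumZ; simpl; ring.
- rewrite symsum_S by lia; rewrite IH, !sum_Sn.
  unfold plus; cbn -[Z.of_nat sum_n sumZ]; ring.
Qed.

Lemma symsum_lim (f : Z -> R) :
  abs_summableZ f -> is_lim_seq (fun N => symsum f N) (SeriesZ f).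
Proof.
intros H; apply abs_summableZ_ex in H; destruct H as [H1 H2].
apply Series_correct in H1, H2; unfold is_series in H1, H2.
(* [symsum_sum_n] starts at index 2, where the negative half has its first term. *)
apply is_lim_seq_incr_1, is_lim_seq_incr_1.
eapply is_lim_seq_ext; [intros n; symmetry; apply symsum_sum_n|].
apply (is_lim_seq_plus' (fun n => sum_n (fun k => f (Z.of_nat k)) (S n))).
- apply (is_lim_seq_incr_1 (sum_n (fun k => f (Z.of_nat k)))); exact H1.
- exact H2.
Qed.

Lemma symsum_finite (f : Z -> R) (N M : nat) :
  (1 <= N <= M)%nat -> (forall k, (Z.of_nat N <= Z.abs k < Z.of_nat M)%Z -> f k = 0) ->
  symsum f M = symsum f N.
Proof.
intros [HN HM]; induction HM as [|M HM IH]; intros H0; [reflexivity|].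
rewrite symsum_S, IH, !H0 by (try intros; try apply H0; lia); ring.
Qed.

Lemma SeriesZ_finite (f : Z -> R) (N : nat) :
  (1 <= N)%nat -> (forall k, (Z.of_nat N <= Z.abs k)%Z -> f k = 0) ->
  abs_summableZ f /\ SeriesZ f = symsum f N.
Proof.
intros HN H0.
assert (S : abs_summableZ f).
{ split.
  - apply ex_series_incr_n with N; apply ex_series_ext with (fun _ => 0).
    + intros n; rewrite H0 by lia; now rewrite Rabs_R0.
    + exists 0; apply filterlim_ext with (fun _ : nat => 0).
      * intros n; rewrite sum_n_const; ring.
      * apply filterlim_const.
  - apply ex_series_incr_n with N; apply ex_series_ext with (fun _ => 0).
    + intros n; rewrite H0 by lia; now rewrite Rabs_R0.
    + exists 0; apply filterlim_ext with (fun _ : nat => 0).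
      * intros n; rewrite sum_n_const; ring.
      * apply filterlim_const. }
split; [exact S|].
pose proof (is_lim_seq_unique _ _ (symsum_lim f S)) as E.
apply (f_equal real) in E; simpl in E; rewrite <- E.
rewrite (is_lim_seq_unique _ (symsum f N)); [reflexivity|].
apply is_lim_seq_ext_loc with (fun _ => symsum f N); [|apply is_lim_seq_const].
exists N; intros n Hn; symmetry; apply symsum_finite; [lia|]; intros; apply H0; lia.
Qed.

Lemma SeriesZ_ge_symsum (f : Z -> R) (N : nat) :
  (forall k, 0 <= f k) -> abs_summableZ f -> symsum f N <= SeriesZ f.
Proof.
intros Hp H; destruct N as [|N].
- rewrite sumZ_nil by (simpl; lia); rewrite <- SeriesZ_0 at 1; apply SeriesZ_le; auto.
  apply abs_summableZ_ext with (fun k => 0 * f k); [intros; ring|now apply abs_summableZ_scal].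
- destruct (SeriesZ_finite (fun k => if Z_le_dec (Z.of_nat (S N)) (Z.abs k) then 0 else f k)
      (S N)) as [H1 H2].
  + lia.
  + intros k Hk; destruct Z_le_dec; [reflexivity|lia].
  + rewrite (sumZ_ext _ _ f (fun k => if Z_le_dec (Z.of_nat (S N)) (Z.abs k) then 0 else f k)).
    * rewrite <- H2; apply SeriesZ_le; auto; intros k; specialize (Hp k).
      destruct Z_le_dec; lra.
    * intros k Hk; destruct Z_le_dec; [lia|reflexivity].
Qed.

Lemma SeriesZ_ge_term (f : Z -> R) (p : Z) :
  (forall k, 0 <= f k) -> abs_summableZ f -> f p <= SeriesZ f.
Proof.
intros Hp H; destruct (SeriesZ_shift f p H) as [H1 H2]; rewrite <- H2.
pose proof (SeriesZ_ge_symsum _ 1 (fun k => Hp (k + p)%Z) H1) as L.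
unfold sumZ in L; simpl in L; lra.
Qed.

(** Subtracting from a family its copy [cut] to |k| < N leaves the tail, and the two tails compare
    term by term. *)
Lemma SeriesZ_tail (f A : Z -> R) (N : nat) :
  (1 <= N)%nat -> (forall k, Rabs (f k) <= A k) -> abs_summableZ A ->
  Rabs (SeriesZ f - symsum f N) <= SeriesZ A - symsum A N.
Proof.
intros HN Hf HA.
assert (Hs : abs_summableZ f) by (apply abs_summableZ_le with A; auto).
set (cut := fun (h : Z -> R) k => if Z_le_dec (Z.of_nat N) (Z.abs k) then 0 else h k).
assert (C : forall h, abs_summableZ h ->
  abs_summableZ (fun k => h k + -1 * cut h k) /\
  SeriesZ (fun k => h k + -1 * cut h k) = SeriesZ h - symsum h N).
{ intros h Hh; destruct (SeriesZ_finite (cut h) N HN) as [H1 H2].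
  { intros k Hk; unfold cut; destruct Z_le_dec; [reflexivity|lia]. }
  split; [apply abs_summableZ_plus; auto using abs_summableZ_scal|].
  rewrite SeriesZ_plus, SeriesZ_scal, H2 by auto using abs_summableZ_scal.
  rewrite (sumZ_ext _ _ (cut h) h); [ring|].
  intros k Hk; unfold cut; destruct Z_le_dec; [lia|reflexivity]. }
destruct (C f Hs) as [F1 F2], (C A HA) as [A1 A2]; rewrite <- F2, <- A2.
eapply Rle_trans; [now apply SeriesZ_Rabs|].
apply SeriesZ_le; auto using abs_summableZ_abs.
intros k; unfold cut; destruct Z_le_dec.
- rewrite Rmult_0_r, !Rplus_0_r; auto.
- replace (f k + -1 * f k) with 0 by ring; rewrite Rabs_R0; lra.
Qed.

(** A product majorant replaces a general Fubini theorem. A finite sum over i commutes with the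
    series over j, and the error of this truncation is at most the tail of [A] times the sum of [B].
    The symmetric partial sums of one iterated series therefore converge to both sides. *)
Lemma SeriesZ_swap (u : Z -> Z -> R) (A B : Z -> R) :
  (forall i j, Rabs (u i j) <= A i * B j) -> abs_summableZ A -> abs_summableZ B ->
  SeriesZ (fun i => SeriesZ (u i)) = SeriesZ (fun j => SeriesZ (fun i => u i j)).
Proof.
intros H HA HB.
assert (Hr : forall i, abs_summableZ (u i)).
{ intros i; apply abs_summableZ_le with (fun j => A i * B j); auto using abs_summableZ_scal. }
assert (Hc : forall j, abs_summableZ (fun i => u i j)).
{ intros j; apply abs_summableZ_le with (fun i => B j * A i); auto using abs_summableZ_scal.
  intros i; rewrite Rmult_comm; auto. }
set (SB := SeriesZ B).
assert (Hrow : abs_summableZ (fun i => SeriesZ (u i))).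
{ apply abs_summableZ_le with (fun i => SB * A i); auto using abs_summableZ_scal.
  intros i; eapply Rle_trans; [now apply SeriesZ_Rabs|].
  unfold SB; rewrite Rmult_comm, <- SeriesZ_scal.
  apply SeriesZ_le; auto using abs_summableZ_scal, abs_summableZ_abs. }
assert (Hcol : abs_summableZ (fun j => SeriesZ (fun i => u i j))).
{ apply abs_summableZ_le with (fun j => SeriesZ A * B j); auto using abs_summableZ_scal.
  intros j; eapply Rle_trans; [now apply SeriesZ_Rabs|].
  rewrite Rmult_comm, <- SeriesZ_scal.
  apply SeriesZ_le; auto using abs_summableZ_scal, abs_summableZ_abs.
  intros i; rewrite Rmult_comm; auto. }
assert (L1 := symsum_lim _ Hrow).
assert (L2 : is_lim_seq (fun N => symsum (fun i => SeriesZ (u i)) N)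
               (SeriesZ (fun j => SeriesZ (fun i => u i j)))).
{ apply is_lim_seq_incr_1.
  apply is_lim_seq_ext with (fun n => SeriesZ (fun j => SeriesZ (fun i => u i j)) +
     (symsum (fun i => SeriesZ (u i)) (S n) - SeriesZ (fun j => SeriesZ (fun i => u i j)))).
  { intros; ring. }
  rewrite <- (Rplus_0_r (SeriesZ (fun j => SeriesZ (fun i => u i j)))) at 1.
  apply is_lim_seq_plus'; [apply is_lim_seq_const|].
  apply is_lim_seq_abs_0.
  apply is_lim_seq_le_le with (fun _ => 0) (fun n => (SeriesZ A - symsum A (S n)) * SB).
  - intros n; split; [apply Rabs_pos|].
    destruct (SeriesZ_sumZ (1 - Z.of_nat (S n)) (Z.of_nat (S n)) u Hr) as [K1 K2].
    rewrite <- K2.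
    replace (SeriesZ (fun j => symsum (fun i => u i j) (S n)) -
       SeriesZ (fun j => SeriesZ (fun i => u i j))) with
      (SeriesZ (fun j => symsum (fun i => u i j) (S n) + -1 * SeriesZ (fun i => u i j))).
    2:{ rewrite SeriesZ_plus, SeriesZ_scal by auto using abs_summableZ_scal; ring. }
    eapply Rle_trans; [apply SeriesZ_Rabs|].
    { auto using abs_summableZ_plus, abs_summableZ_scal. }
    unfold SB; rewrite <- SeriesZ_scal; apply SeriesZ_le.
    + intros j; rewrite <- Rabs_Ropp.
      replace (- (symsum (fun i => u i j) (S n) + -1 * SeriesZ (fun i => u i j)))
        with (SeriesZ (fun i => u i j) - symsum (fun i => u i j) (S n)) by ring.
      eapply Rle_trans.
      * apply (SeriesZ_tail (fun i => u i j) (fun i => B j * A i)); [lia| |].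
        -- intros i; rewrite Rmult_comm; auto.
        -- now apply abs_summableZ_scal.
      * rewrite SeriesZ_scal, sumZ_scal; right; ring.
    + auto using abs_summableZ_abs, abs_summableZ_plus, abs_summableZ_scal.
    + auto using abs_summableZ_scal.
  - apply is_lim_seq_const.
  - replace 0 with ((SeriesZ A - SeriesZ A) * SB) by ring.
    apply is_lim_seq_mult'; [|apply is_lim_seq_const].
    apply is_lim_seq_minus'; [apply is_lim_seq_const|].
    apply is_lim_seq_incr_1 with (u := fun n => symsum A n); now apply symsum_lim. }
apply is_lim_seq_unique in L1, L2; rewrite L1 in L2; now injection L2.
Qed.

(** * Convolution of hyperbolic cosecants *)

Lemma exp_absZ_summable (d : R) :
  0 < d -> abs_summableZ (fun k => exp (- d * IZR (Z.abs k))).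
Proof.
intros Hd.
assert (Hg : ex_series (fun n => exp (- d) ^ n)).
{ apply ex_series_geom; rewrite Rabs_pos_eq by apply Rlt_le, exp_pos.
  rewrite <- exp_0; apply exp_increasing; lra. }
assert (E : forall n, exp (- d) ^ n = exp (- d * IZR (Z.of_nat n))).
{ intros n; rewrite <- INR_IZR_INZ; induction n as [|n IH].
  - simpl; rewrite Rmult_0_r, exp_0; reflexivity.
  - rewrite S_INR; simpl; rewrite IH, <- exp_plus; f_equal; ring. }
split.
- eapply ex_series_ext with (2 := Hg); intros n; cbv beta.
  rewrite Rabs_pos_eq by apply Rlt_le, exp_pos; rewrite E; do 3 f_equal; lia.
- apply (@ex_series_incr_1 R_AbsRing R_NormedModule) in Hg.
  eapply ex_series_ext with (2 := Hg); intros n; cbv beta.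
  rewrite Rabs_pos_eq by apply Rlt_le, exp_pos; rewrite E; do 3 f_equal; lia.
Qed.

(** Exponential decay at every rate below [c], with no claim at the rate [c] itself: this makes the
    notion stable under multiplication by k, which each termwise derivative requires. *)
Definition subexp (c : R) (b : Z -> R) : Prop :=
  forall d, 0 < d < c -> exists M, 0 <= M /\ forall k, Rabs (b k) <= M * exp (- d * IZR (Z.abs k)).

Lemma subexp_summable (c : R) (b : Z -> R) : 0 < c -> subexp c b -> abs_summableZ b.
Proof.
intros Hc H; destruct (H (c / 2)) as [M [_ HM]]; [lra|].
eapply abs_summableZ_le; [exact HM|].
apply abs_summableZ_scal, exp_absZ_summable; lra.
Qed.

Lemma subexp_le (c : R) (b b' : Z -> R) :
  subexp c b -> (forall k, Rabs (b' k) <= Rabs (b k)) -> subexp c b'.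
Proof.
intros H Hb d Hd; destruct (H d Hd) as [M [HM0 HM]]; exists M; split; auto.
intros k; eapply Rle_trans; eauto.
Qed.

Lemma subexp_mul_index (c : R) (b : Z -> R) :
  subexp c b -> subexp c (fun k => IZR k * b k).
Proof.
intros H d Hd; destruct (H ((c + d) / 2)) as [M [HM0 HM]]; [lra|].
(* Half of the gap between d and c is spent on absorbing the factor |k|, through e |k| <= exp (e
   |k|). *)
set (e := (c - d) / 2); assert (He : 0 < e) by (unfold e; lra).
exists (M / e); split.
{ apply Rdiv_le_0_compat; lra. }
intros k; rewrite Rabs_mult, <- abs_IZR.
assert (K : 0 <= IZR (Z.abs k)) by (apply IZR_le; lia).
assert (Hk : IZR (Z.abs k) <= exp (e * IZR (Z.abs k)) / e).
{ apply Rmult_le_reg_r with e; auto; unfold Rdiv; rewrite Rmult_assoc, Rinv_l, Rmult_1_r by lra.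
  pose proof (exp_ineq1_le (e * IZR (Z.abs k))); lra. }
apply Rle_trans with (exp (e * IZR (Z.abs k)) / e * (M * exp (- ((c + d) / 2) * IZR (Z.abs k)))).
{ apply Rmult_le_compat; auto using Rabs_pos. }
right.
replace (exp (- d * IZR (Z.abs k))) with
  (exp (e * IZR (Z.abs k)) * exp (- ((c + d) / 2) * IZR (Z.abs k))).
{ field; lra. }
rewrite <- exp_plus; f_equal; unfold e; field.
Qed.

Lemma sinh_opp (x : R) : sinh (- x) = - sinh x.
Proof. unfold sinh; rewrite Ropp_involutive; field. Qed.

Lemma cosh_opp (x : R) : cosh (- x) = cosh x.
Proof. unfold cosh; rewrite Ropp_involutive; field. Qed.

Lemma sinh_add (x y : R) : sinh (x + y) = sinh x * cosh y + cosh x * sinh y.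
Proof. unfold cosh, sinh; rewrite Ropp_plus_distr, !exp_plus; field. Qed.

Lemma sinh_pos (x : R) : 0 < x -> 0 < sinh x.
Proof. intros H; unfold sinh; pose proof (exp_increasing (- x) x); lra. Qed.

Lemma sinh_neq0 (x : R) : x <> 0 -> sinh x <> 0.
Proof.
intros H; destruct (Rtotal_order x 0) as [L|[L|L]]; [|lra|].
- pose proof (sinh_pos (- x)); rewrite sinh_opp in *; lra.
- pose proof (sinh_pos x L); lra.
Qed.

Lemma IZR_mul_neq0 (k : Z) (c : R) : 0 < c -> (k <> 0)%Z -> IZR k * c <> 0.
Proof. intros Hc Hk; apply Rmult_integral_contrapositive; split; [now apply eq_IZR_contrapositive|lra]. Qed.

Definition odd_ind (k : Z) : R := if Z.odd k then 1 else 0.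

Definition parity_sign (k : Z) : R := if Z.odd k then -1 else 1.

Lemma parity_sign_add (j k : Z) : parity_sign (j + k) = parity_sign j * parity_sign k.
Proof. unfold parity_sign; rewrite Z.odd_add; destruct (Z.odd j), (Z.odd k); simpl; ring. Qed.

Lemma parity_sign_opp (k : Z) : parity_sign (- k) = parity_sign k.
Proof. unfold parity_sign; now rewrite Z.odd_opp. Qed.

Lemma odd_ind_opp (k : Z) : odd_ind (- k) = odd_ind k.
Proof. unfold odd_ind; now rewrite Z.odd_opp. Qed.

Lemma odd_ind_cases (k : Z) :
  odd_ind k = 1 /\ parity_sign k = -1 \/ odd_ind k = 0 /\ parity_sign k = 1.
Proof. unfold odd_ind, parity_sign; destruct Z.odd; auto. Qed.

Lemma csch_subexp (c : R) : 0 < c -> subexp c (fun k => / sinh (IZR k * c)).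
Proof.
intros Hc d Hd.
(* For k >= 1, sinh (k c) = exp (k c) (1 - exp (- 2 k c)) / 2 >= exp (k c) q / 2, with [q]
   independent of k. *)
set (q := 1 - exp (- (2 * c))).
assert (Hq : 0 < q).
{ unfold q; pose proof (exp_increasing (- (2 * c)) 0); rewrite exp_0 in *; lra. }
exists (2 / q); split; [apply Rdiv_le_0_compat; lra|].
assert (P : forall k, (0 < k)%Z -> / sinh (IZR k * c) <= 2 / q * exp (- d * IZR k)).
{ intros k Hk; assert (K : 1 <= IZR k) by (apply IZR_le; lia).
  apply Rle_trans with (/ (exp (d * IZR k) * q / 2)).
  - apply Rinv_le_contravar.
    + apply Rmult_lt_0_compat; [apply Rmult_lt_0_compat; auto using exp_pos|lra].
    + unfold sinh.
      assert (exp (- (IZR k * c)) <= exp (IZR k * c) * exp (- (2 * c))).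
      { rewrite <- exp_plus; destruct (Req_dec (IZR k) 1) as [->|N].
        - right; f_equal; ring.
        - left; apply exp_increasing; nra. }
      assert (exp (d * IZR k) <= exp (IZR k * c)) by (left; apply exp_increasing; nra).
      unfold q in *; nra.
  - right; rewrite Ropp_mult_distr_l_reverse, exp_Ropp.
    pose proof (exp_pos (d * IZR k)); field; lra. }
intros k; destruct (Z_lt_dec 0 k) as [K|K].
- rewrite Z.abs_eq by lia; rewrite Rabs_pos_eq; auto.
  apply Rlt_le, Rinv_0_lt_compat, sinh_pos, Rmult_lt_0_compat; auto; now apply IZR_lt.
- destruct (Z.eq_dec k 0) as [->|N].
  + rewrite Rmult_0_l, sinh_0, Rinv_0, Rabs_R0; simpl; rewrite Rmult_0_r, exp_0.
    apply Rmult_le_pos; [apply Rdiv_le_0_compat|]; lra.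
  + specialize (P (- k)%Z ltac:(lia)).
    rewrite opp_IZR, Ropp_mult_distr_l_reverse, sinh_opp in P.
    assert (0 < - sinh (IZR k * c)).
    { rewrite <- sinh_opp, <- Ropp_mult_distr_l_reverse, <- opp_IZR.
      apply sinh_pos, Rmult_lt_0_compat; auto; apply IZR_lt; lia. }
    rewrite Z.abs_neq, opp_IZR by lia.
    rewrite <- Rabs_Ropp, <- Rinv_opp, Rabs_pos_eq; [exact P|].
    now apply Rlt_le, Rinv_0_lt_compat.
Qed.

(* [coth (k c)] minus its limit, the sign of [k]; it vanishes at [k = 0] because [/ 0 = 0]. *)
Definition coth_rem (c : R) (k : Z) : R :=
  cosh (IZR k * c) / sinh (IZR k * c) - IZR (Z.sgn k).

Lemma coth_rem_opp (c : R) (k : Z) : coth_rem c (- k) = - coth_rem c k.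
Proof.
unfold coth_rem; rewrite Z.sgn_opp, !opp_IZR, Ropp_mult_distr_l_reverse, sinh_opp, cosh_opp.
unfold Rdiv; rewrite Rinv_opp; ring.
Qed.

Lemma coth_rem_subexp (c : R) : 0 < c -> subexp c (coth_rem c).
Proof.
intros Hc; apply subexp_le with (1 := csch_subexp c Hc).
assert (P : forall k, (0 < k)%Z -> Rabs (coth_rem c k) <= Rabs (/ sinh (IZR k * c))).
{ intros k Hk; unfold coth_rem; rewrite Z.sgn_pos by lia.
  assert (K : 0 < IZR k * c) by (apply Rmult_lt_0_compat; auto; now apply IZR_lt).
  pose proof (sinh_pos _ K) as S.
  replace (cosh (IZR k * c) / sinh (IZR k * c) - 1) with
    (exp (- (IZR k * c)) * / sinh (IZR k * c)).
  - rewrite Rabs_mult; apply Rle_trans with (1 * Rabs (/ sinh (IZR k * c))); [|lra].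
    apply Rmult_le_compat_r; [apply Rabs_pos|].
    rewrite Rabs_pos_eq by apply Rlt_le, exp_pos.
    rewrite <- exp_0; apply Rlt_le, exp_increasing; lra.
  - unfold cosh, sinh in *; field; lra. }
intros k; destruct (Z_lt_dec 0 k) as [K|K]; auto.
destruct (Z.eq_dec k 0) as [->|N].
- unfold coth_rem; rewrite Rmult_0_l, sinh_0; unfold Rdiv; rewrite Rinv_0; simpl.
  rewrite Rmult_0_r, Rminus_0_r; lra.
- specialize (P (- k)%Z ltac:(lia)).
  now rewrite coth_rem_opp, opp_IZR, Ropp_mult_distr_l_reverse, sinh_opp, Rinv_opp,
    !Rabs_Ropp in P.
Qed.

(** Sine coefficients of f = - (log dn)', as a family over Z that is odd in [k]. *)
Definition odd_csch (c : R) (k : Z) : R := odd_ind k * / sinh (IZR k * c).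

(* The value that makes the convolution formula [csch_convolution] hold for odd [n]. *)
Definition csch_const (c : R) : R :=
  1 / 2 - SeriesZ (fun k => parity_sign k * (IZR k * coth_rem c k)).

(** Coefficients of Y, a multiple of dn^2. In classical terms the entry at 0 is 2 K E / PI^2. *)
Definition index_csch (c : R) (k : Z) : R :=
  if Z.eq_dec k 0 then csch_const c else IZR k * / sinh (IZR k * c).

Lemma odd_csch_opp (c : R) (k : Z) : odd_csch c (- k) = - odd_csch c k.
Proof.
unfold odd_csch; rewrite odd_ind_opp, opp_IZR, Ropp_mult_distr_l_reverse, sinh_opp, Rinv_opp; ring.
Qed.

Lemma index_csch_opp (c : R) (k : Z) : index_csch c (- k) = index_csch c k.
Proof.
unfold index_csch; destruct (Z.eq_dec (- k) 0), (Z.eq_dec k 0); try lia; auto.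
rewrite opp_IZR; replace (- IZR k * c) with (- (IZR k * c)) by ring.
rewrite sinh_opp, Rinv_opp; ring.
Qed.

Lemma odd_csch_subexp (c : R) : 0 < c -> subexp c (odd_csch c).
Proof.
intros Hc; apply subexp_le with (1 := csch_subexp c Hc); intros k; unfold odd_csch, odd_ind.
destruct Z.odd; rewrite ?Rmult_1_l, ?Rmult_0_l, ?Rabs_R0; auto using Rabs_pos, Rle_refl.
Qed.

Lemma index_csch_subexp (c : R) : 0 < c -> subexp c (index_csch c).
Proof.
intros Hc d Hd; destruct (subexp_mul_index _ _ (csch_subexp c Hc) d Hd) as [M [HM0 HM]].
exists (M + Rabs (csch_const c)); pose proof (Rabs_pos (csch_const c)) as P; split; [lra|].
intros k; specialize (HM k); unfold index_csch; destruct (Z.eq_dec k 0) as [->|N].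
- simpl; rewrite Rmult_0_r, exp_0; lra.
- pose proof (exp_pos (- d * IZR (Z.abs k))); nra.
Qed.

(** There are r = (n - [odd_ind] n) / 2 odd numbers below n, and the first r odd numbers add up to
    r^2. *)
Lemma odd_index_sum (n : nat) (y : R) :
  sumZ 0 (Z.of_nat n) (fun j => odd_ind j * (y - IZR j)) =
  y * (INR n - odd_ind (Z.of_nat n)) / 2
  - ((INR n - odd_ind (Z.of_nat n)) / 2) ^ 2.
Proof.
induction n as [|n IH].
- rewrite sumZ_nil by lia; unfold odd_ind; simpl; field.
- rewrite Nat2Z.inj_succ; unfold Z.succ; rewrite sumZ_succ_r, IH by lia; rewrite S_INR.
  rewrite <- INR_IZR_INZ; unfold odd_ind; rewrite Z.odd_add.
  destruct (Z.odd (Z.of_nat n)); simpl; field.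
Qed.

(** The two signs cancel outside [0, n] and add to 2 strictly inside; at j = 0 and j = n the weight
    vanishes. What remains is 2 r (n - r) with r the number of odd j below n. *)
Lemma odd_sgn_sum (n : nat) :
  (1 <= n)%nat ->
  let u := fun j => odd_ind j * (INR n - IZR j) * (IZR (Z.sgn j) + IZR (Z.sgn (Z.of_nat n - j))) in
  abs_summableZ u /\ SeriesZ u = (INR n ^ 2 - odd_ind (Z.of_nat n)) / 2.
Proof.
intros Hn u.
assert (E : forall j, u j = if Z_lt_dec 0 j then
   if Z_lt_dec j (Z.of_nat n) then 2 * (odd_ind j * (INR n - IZR j)) else 0 else 0).
{ intros j; unfold u; destruct (Z_lt_dec 0 j); [destruct (Z_lt_dec j (Z.of_nat n))|].
  - rewrite !Z.sgn_pos by lia; simpl; ring.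
  - destruct (Z.eq_dec j (Z.of_nat n)) as [->|N].
    + rewrite INR_IZR_INZ; ring.
    + rewrite (Z.sgn_pos j), (Z.sgn_neg (Z.of_nat n - j)) by lia; simpl; ring.
  - destruct (Z.eq_dec j 0) as [->|N]; [unfold odd_ind; simpl; ring|].
    rewrite (Z.sgn_neg j), (Z.sgn_pos (Z.of_nat n - j)) by lia; simpl; ring. }
destruct (SeriesZ_finite u n Hn) as [H1 H2].
{ intros k Hk; rewrite E; destruct Z_lt_dec; [destruct Z_lt_dec|]; auto; lia. }
split; [exact H1|]; rewrite H2.
assert (S : forall m, (0 <= m)%Z -> sumZ (- m) (Z.of_nat n) u =
   2 * sumZ 0 (Z.of_nat n) (fun j => odd_ind j * (INR n - IZR j))).
{ apply (sumZ_ind (fun m => sumZ (- m) (Z.of_nat n) u = _)).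
  - rewrite <- sumZ_scal; apply sumZ_ext; intros k Hk; rewrite E; simpl in Hk.
    destruct (Z_lt_dec 0 k); [destruct (Z_lt_dec k (Z.of_nat n)); [reflexivity|lia]|].
    replace k with 0%Z by lia; unfold odd_ind; simpl; ring.
  - intros m Hm IH; replace (- (m + 1))%Z with (- m - 1)%Z by lia.
    rewrite sumZ_succ_l, IH, E by lia; destruct Z_lt_dec; [lia|ring]. }
replace (1 - Z.of_nat n)%Z with (- (Z.of_nat n - 1))%Z by lia.
rewrite S, odd_index_sum by lia; unfold odd_ind; destruct Z.odd; field.
Qed.

Lemma SeriesZ_delta (p : Z) (r : R) :
  abs_summableZ (fun k => if Z.eq_dec k p then r else 0) /\
  SeriesZ (fun k => if Z.eq_dec k p then r else 0) = r.
Proof.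
destruct (SeriesZ_finite (fun k => if Z.eq_dec k 0 then r else 0) 1) as [H1 H2].
{ lia. }
{ intros k Hk; destruct Z.eq_dec; [lia|reflexivity]. }
destruct (SeriesZ_shift _ (- p) H1) as [H3 H4].
assert (E : forall k, (if Z.eq_dec (k + - p) 0 then r else 0) = if Z.eq_dec k p then r else 0).
{ intros k; destruct (Z.eq_dec (k + - p) 0), (Z.eq_dec k p); try lia; reflexivity. }
split; [now apply abs_summableZ_ext with (1 := E)|].
rewrite <- (SeriesZ_ext _ _ E), H4, H2; unfold sumZ; simpl; ring.
Qed.

Lemma SeriesZ_reflect (f : Z -> R) (p : Z) :
  abs_summableZ f ->
  abs_summableZ (fun k => f (p - k)%Z) /\ SeriesZ (fun k => f (p - k)%Z) = SeriesZ f.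
Proof.
intros H; destruct (SeriesZ_shift f p H) as [H1 H2].
pose proof (abs_summableZ_opp _ H1) as H3; pose proof (SeriesZ_opp _ H1) as H4; cbv beta in *.
assert (E : forall k, f (- k + p)%Z = f (p - k)%Z) by (intros; f_equal; lia).
split; [now apply abs_summableZ_ext with (1 := E)|].
now rewrite <- (SeriesZ_ext _ _ E), H4, H2.
Qed.

Lemma csch_mul_csch (x y : R) :
  sinh x <> 0 -> sinh y <> 0 ->
  sinh (x + y) * (/ sinh x * / sinh y) = cosh x / sinh x + cosh y / sinh y.
Proof. intros Hx Hy; rewrite sinh_add; field; auto. Qed.

(** After multiplication by sinh (n c) each term becomes a weighted sum of two coth, which is not
    summable piece by piece. Splitting coth into its sign and [coth_rem] isolates a finitely
    supported sign part, evaluated by [odd_sgn_sum], and two exponentially small parts. *)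
Lemma csch_convolution_pos (c : R) (n : nat) :
  0 < c -> (1 <= n)%nat ->
  SeriesZ (fun j => odd_csch c j * index_csch c (Z.of_nat n - j)) =
  INR n * index_csch c (Z.of_nat n) / 2.
Proof.
intros Hc Hn; set (p := Z.of_nat n).
destruct (odd_sgn_sum n Hn) as [U1 U2]; fold p in U1, U2.
pose proof (coth_rem_subexp c Hc) as D.
pose proof (subexp_mul_index _ _ D) as D1.
set (id := fun i => IZR i * coth_rem c i) in *.
assert (B : forall b, subexp c b -> abs_summableZ (fun k => odd_ind k * b k)).
{ intros b Hb; apply (subexp_summable c); auto; apply subexp_le with (1 := Hb); intros k.
  unfold odd_ind; destruct Z.odd; rewrite ?Rmult_1_l, ?Rmult_0_l, ?Rabs_R0;
    auto using Rabs_pos, Rle_refl. }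
assert (Hid : abs_summableZ id) by (apply (subexp_summable c); auto).
(* The part of the weight proportional to n meets an odd family and sums to 0; only the part - j
   survives. *)
assert (P1 : abs_summableZ (fun j => odd_ind j * (INR n - IZR j) * coth_rem c j) /\
   SeriesZ (fun j => odd_ind j * (INR n - IZR j) * coth_rem c j) =
   - SeriesZ (fun i => odd_ind i * id i)).
{ assert (E : forall j, INR n * (odd_ind j * coth_rem c j) + -1 * (odd_ind j * id j) =
     odd_ind j * (INR n - IZR j) * coth_rem c j) by (intros; unfold id; ring).
  split.
  - apply abs_summableZ_ext with (1 := E); auto using abs_summableZ_plus, abs_summableZ_scal.
  - rewrite <- (SeriesZ_ext _ _ E), SeriesZ_plus, !SeriesZ_scal
      by auto using abs_summableZ_scal.
    rewrite (SeriesZ_odd (fun j => odd_ind j * coth_rem c j)); auto; [ring|].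
    intros k; rewrite odd_ind_opp, coth_rem_opp; ring. }
assert (Q0 : abs_summableZ (fun i => odd_ind (p - i) * id i)).
{ apply abs_summableZ_le with (fun i => Rabs (id i)); [|now apply abs_summableZ_abs].
  intros k; unfold odd_ind; destruct Z.odd; rewrite ?Rmult_1_l, ?Rmult_0_l, ?Rabs_R0;
    auto using Rabs_pos, Rle_refl. }
assert (P2 : abs_summableZ (fun j => odd_ind j * (INR n - IZR j) * coth_rem c (p - j)) /\
   SeriesZ (fun j => odd_ind j * (INR n - IZR j) * coth_rem c (p - j)) =
   SeriesZ (fun i => odd_ind (p - i) * id i)).
{ destruct (SeriesZ_reflect _ p Q0) as [Q1 Q2].
  assert (E : forall j, odd_ind (p - (p - j)) * id (p - j)%Z =
     odd_ind j * (INR n - IZR j) * coth_rem c (p - j)).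
  { intros j; unfold id; rewrite minus_IZR, INR_IZR_INZ; fold p.
    replace (p - (p - j))%Z with j by lia; ring. }
  split; [now apply abs_summableZ_ext with (1 := E)|].
  now rewrite <- (SeriesZ_ext _ _ E). }
destruct (SeriesZ_delta p (odd_ind p * csch_const c)) as [T1 T2].
assert (Hp : IZR p * c <> 0) by (apply IZR_mul_neq0; auto; lia).
(* At j = p the weight p - j kills the coth terms, while [index_csch] takes its special value at 0;
   this is the last summand. *)
assert (E : forall j, sinh (IZR p * c) * (odd_csch c j * index_csch c (p - j)) =
   odd_ind j * (INR n - IZR j) * (IZR (Z.sgn j) + IZR (Z.sgn (p - j))) +
   (odd_ind j * (INR n - IZR j) * coth_rem c j +
   (odd_ind j * (INR n - IZR j) * coth_rem c (p - j) +
   if Z.eq_dec j p then odd_ind p * csch_const c else 0))).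
{ intros j; rewrite INR_IZR_INZ; fold p.
  unfold odd_csch, index_csch; destruct (Z.eq_dec j p) as [->|N].
  - destruct Z.eq_dec; [|lia]; field; now apply sinh_neq0.
  - destruct Z.eq_dec; [lia|].
    unfold coth_rem; destruct (Z.eq_dec j 0) as [->|M].
    { unfold odd_ind; simpl; ring. }
    replace (IZR p * c) with (IZR j * c + IZR (p - j) * c) by (rewrite minus_IZR; ring).
    replace (sinh (IZR j * c + IZR (p - j) * c) *
      (odd_ind j * / sinh (IZR j * c) * (IZR (p - j) * / sinh (IZR (p - j) * c)))) with
      (odd_ind j * IZR (p - j) * (sinh (IZR j * c + IZR (p - j) * c) *
      (/ sinh (IZR j * c) * / sinh (IZR (p - j) * c)))) by ring.
    rewrite csch_mul_csch by (apply sinh_neq0, IZR_mul_neq0; auto; lia).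
    rewrite minus_IZR; ring. }
apply Rmult_eq_reg_l with (sinh (IZR p * c)); [|now apply sinh_neq0].
rewrite <- SeriesZ_scal, (SeriesZ_ext _ _ E).
destruct P1 as [P1 P1'], P2 as [P2 P2'].
rewrite !SeriesZ_plus, U2, P1', P2', T2 by auto using abs_summableZ_plus.
(* For odd p the two indicators differ by (-1)^i and for even p they agree. The total is (n^2 - o) /
   2 + o (S + C0), with o = [odd_ind p] and S the series in [csch_const], and C0 = 1/2 - S turns it
   into n^2 / 2. *)
assert (F : SeriesZ (fun i => odd_ind (p - i) * id i) - SeriesZ (fun i => odd_ind i * id i) =
   odd_ind p * SeriesZ (fun k => parity_sign k * id k)).
{ rewrite <- SeriesZ_scal.
  replace (SeriesZ (fun i => odd_ind (p - i) * id i) - SeriesZ (fun i => odd_ind i * id i)) with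
   (SeriesZ (fun i => odd_ind (p - i) * id i + -1 * (odd_ind i * id i))).
  - apply SeriesZ_ext; intros i; unfold odd_ind, parity_sign; rewrite Z.odd_sub.
    destruct (Z.odd p), (Z.odd i); simpl; ring.
  - rewrite SeriesZ_plus, SeriesZ_scal by auto using abs_summableZ_scal; ring. }
unfold csch_const.
unfold index_csch; destruct Z.eq_dec; [lia|].
replace (sinh (IZR p * c) * (INR n * (IZR p * / sinh (IZR p * c)) / 2)) with
  (INR n * IZR p / 2) by (field; now apply sinh_neq0).
rewrite INR_IZR_INZ; fold p.
assert (S : SeriesZ (fun i => odd_ind (p - i) * id i) = SeriesZ (fun i => odd_ind i * id i) +
   odd_ind p * SeriesZ (fun k => parity_sign k * id k)) by lra.
rewrite S; change (fun k => parity_sign k * (IZR k * coth_rem c k)) with (fun k => parity_sign k * id k); field.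
Qed.

Lemma csch_convolution (c : R) (n : Z) :
  0 < c -> n <> 0%Z ->
  SeriesZ (fun j => odd_csch c j * index_csch c (n - j)) = IZR n * index_csch c n / 2.
Proof.
intros Hc Hn.
assert (P : forall n, (0 < n)%Z ->
  SeriesZ (fun j => odd_csch c j * index_csch c (n - j)) = IZR n * index_csch c n / 2).
{ intros m Hm; pose proof (csch_convolution_pos c (Z.to_nat m) Hc ltac:(lia)) as E.
  now rewrite INR_IZR_INZ, Z2Nat.id in E by lia. }
destruct (Z_lt_dec 0 n); [now apply P|].
specialize (P (- n)%Z ltac:(lia)).
rewrite opp_IZR, index_csch_opp in P.
replace (IZR n * index_csch c n / 2) with (-1 * (- IZR n * index_csch c n / 2)) by field.
rewrite <- P, <- SeriesZ_scal.
rewrite <- (SeriesZ_opp (fun j => -1 * _)).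
- apply SeriesZ_ext; intros j; rewrite odd_csch_opp, <- (index_csch_opp c (n - j)).
  replace (- n - - j)%Z with (- (n - j))%Z by lia; ring.
- apply abs_summableZ_scal.
  destruct (index_csch_subexp c Hc (c / 2)) as [M [HM0 HM]]; [lra|].
  apply abs_summableZ_le with (fun j => M * Rabs (odd_csch c j)).
  + intros j; rewrite Rabs_mult, Rmult_comm; apply Rmult_le_compat_r; [apply Rabs_pos|].
    eapply Rle_trans; [apply HM|]; rewrite <- (Rmult_1_r M) at 2.
    apply Rmult_le_compat_l; auto; rewrite <- exp_0.
    assert (0 <= IZR (Z.abs (- n - j))) by (apply IZR_le; lia).
    destruct (Req_dec (IZR (Z.abs (- n - j))) 0) as [->|].
    * right; f_equal; ring.
    * left; apply exp_increasing; nra.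
  + apply abs_summableZ_scal, abs_summableZ_abs, (subexp_summable c); auto.
    now apply odd_csch_subexp.
Qed.

(* [C k] and [T k] are the even and odd parts in [k] of a character of Z. Adding the product of
   the series of [odd_csch * C] and [index_csch * T], which is zero by parity, turns the left-hand
   side into a convolution. *)
Lemma csch_product (c rho : R) (C T : Z -> R) :
  0 < c -> 0 <= rho < c ->
  (forall k, Rabs (C k) <= exp (rho * IZR (Z.abs k))) ->
  (forall k, Rabs (T k) <= exp (rho * IZR (Z.abs k))) ->
  (forall k, C (- k)%Z = C k) -> (forall k, T (- k)%Z = - T k) ->
  (forall j k, T (j + k)%Z = T j * C k + C j * T k) ->
  SeriesZ (fun j => odd_csch c j * T j) * SeriesZ (fun k => index_csch c k * C k) =
  SeriesZ (fun n => IZR n * index_csch c n * T n) / 2.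
Proof.
intros Hc Hr HC HT HCo HTo HA.
(* Coefficients decaying at rate rho + 2 e outweigh the growth rho of the characters and leave 2 e
   (|j| + |n - j|), which dominates e |j| + e |n|. This yields the product majorant required by
   [SeriesZ_swap]. *)
set (e := (c - rho) / 3); assert (He : 0 < e) by (unfold e; lra).
assert (Hd : 0 < rho + 2 * e < c) by (unfold e; lra).
destruct (odd_csch_subexp c Hc _ Hd) as [Ms [Ms0 HMs]].
destruct (index_csch_subexp c Hc _ Hd) as [Ma [Ma0 HMa]].
assert (B : forall b F M, 0 <= M ->
   (forall k, Rabs (b k) <= M * exp (- (rho + 2 * e) * IZR (Z.abs k))) ->
   (forall k, Rabs (F k) <= exp (rho * IZR (Z.abs k))) -> abs_summableZ (fun k => b k * F k)).
{ intros b F M HM Hb HF.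
  apply abs_summableZ_le with (fun k => M * exp (- (2 * e) * IZR (Z.abs k))).
  - intros k; rewrite Rabs_mult.
    replace (- (2 * e) * IZR (Z.abs k)) with (- (rho + 2 * e) * IZR (Z.abs k) + rho * IZR (Z.abs k))
      by ring.
    rewrite exp_plus, <- Rmult_assoc; apply Rmult_le_compat; auto using Rabs_pos.
  - apply abs_summableZ_scal, exp_absZ_summable; lra. }
assert (SsT := B _ _ _ Ms0 HMs HT); assert (SsC := B _ _ _ Ms0 HMs HC).
assert (SaT := B _ _ _ Ma0 HMa HT); assert (SaC := B _ _ _ Ma0 HMa HC).
assert (Z1 : SeriesZ (fun j => odd_csch c j * C j) = 0).
{ apply SeriesZ_odd; auto; intros k; rewrite HCo, odd_csch_opp; ring. }
assert (E1 : SeriesZ (fun j => odd_csch c j * T j) * SeriesZ (fun k => index_csch c k * C k) =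
  SeriesZ (fun j => SeriesZ (fun n => odd_csch c j * index_csch c (n - j) * T n))).
{ transitivity (SeriesZ (fun j =>
     SeriesZ (fun k => index_csch c k * C k) * (odd_csch c j * T j)
     + SeriesZ (fun k => index_csch c k * T k) * (odd_csch c j * C j))).
  - rewrite SeriesZ_plus, !SeriesZ_scal, Z1 by auto using abs_summableZ_scal; ring.
  - apply SeriesZ_ext; intros j.
    assert (F : forall k, odd_csch c j * T j * (index_csch c k * C k) +
       odd_csch c j * C j * (index_csch c k * T k) =
       odd_csch c j * index_csch c (k + j - j) * T (k + j)%Z).
    { intros k; replace (k + j - j)%Z with k by lia.
      rewrite Z.add_comm, HA; ring. }
    assert (S : abs_summableZ (fun n => odd_csch c j * index_csch c (n - j) * T n)).
    { assert (S : abs_summableZ (fun k => odd_csch c j * index_csch c (k + j - j) * T (k + j)%Z)).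
      { apply abs_summableZ_ext with (1 := F).
        auto using abs_summableZ_scal, abs_summableZ_plus. }
      destruct (SeriesZ_shift _ (- j) S) as [S1 _].
      apply abs_summableZ_ext with (2 := S1); intros n.
      replace (n + - j + j)%Z with n by lia; reflexivity. }
    destruct (SeriesZ_shift _ j S) as [_ <-].
    rewrite <- (SeriesZ_ext _ _ F), (SeriesZ_plus (fun k => _ * (index_csch c k * C k))),
      !SeriesZ_scal by auto using abs_summableZ_scal; ring. }
rewrite E1, (SeriesZ_swap _ (fun j => Ms * exp (- e * IZR (Z.abs j)))
   (fun n => Ma * exp (- e * IZR (Z.abs n)))).
- unfold Rdiv; rewrite Rmult_comm, <- SeriesZ_scal; apply SeriesZ_ext; intros n.
  rewrite (SeriesZ_ext _ (fun j => T n * (odd_csch c j * index_csch c (n - j))))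
    by (intros; ring).
  rewrite SeriesZ_scal; destruct (Z.eq_dec n 0) as [->|N].
  (* The convolution formula excludes n = 0, but there T vanishes by oddness. *)
  + assert (T 0%Z = 0) by (specialize (HTo 0%Z); simpl in HTo; lra); nra.
  + rewrite csch_convolution by auto; field.
- intros j n; rewrite !Rabs_mult.
  apply Rle_trans with (Ms * exp (- (rho + 2 * e) * IZR (Z.abs j)) *
    (Ma * exp (- (rho + 2 * e) * IZR (Z.abs (n - j)))) * exp (rho * IZR (Z.abs n))).
  { apply Rmult_le_compat; auto using Rabs_pos.
    - apply Rmult_le_pos; apply Rabs_pos.
    - apply Rmult_le_compat; auto using Rabs_pos. }
  replace (Ms * exp (- (rho + 2 * e) * IZR (Z.abs j)) *
    (Ma * exp (- (rho + 2 * e) * IZR (Z.abs (n - j)))) * exp (rho * IZR (Z.abs n))) with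
    (Ms * Ma * exp (- (rho + 2 * e) * IZR (Z.abs j) +
      - (rho + 2 * e) * IZR (Z.abs (n - j)) + rho * IZR (Z.abs n)))
    by (rewrite !exp_plus; ring).
  replace (Ms * exp (- e * IZR (Z.abs j)) * (Ma * exp (- e * IZR (Z.abs n)))) with
    (Ms * Ma * exp (- e * IZR (Z.abs j) + - e * IZR (Z.abs n))) by (rewrite exp_plus; ring).
  apply Rmult_le_compat_l; [now apply Rmult_le_pos|].
  assert (K : IZR (Z.abs n) <= IZR (Z.abs j) + IZR (Z.abs (n - j)))
    by (rewrite <- plus_IZR; apply IZR_le; lia).
  assert (0 <= IZR (Z.abs (n - j))) by (apply IZR_le; lia).
  assert (X : - (rho + 2 * e) * IZR (Z.abs j) + - (rho + 2 * e) * IZR (Z.abs (n - j)) +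
    rho * IZR (Z.abs n) <= - e * IZR (Z.abs j) + - e * IZR (Z.abs n)) by nra.
  destruct X as [X|X]; [left; now apply exp_increasing|right; now rewrite X].
- apply abs_summableZ_scal, exp_absZ_summable; lra.
- apply abs_summableZ_scal, exp_absZ_summable; lra.
Qed.

(** * Differential equations of the cosecant series *)

(** Mean value theorem without an order between the endpoints. It is mostly applied with [h1] = 0,
    to show that an expression with zero derivative keeps its value at 0. *)
Lemma is_derive_MVT (h h1 : R -> R) (v y : R) :
  (forall z, Rabs (z - v) <= Rabs (y - v) -> is_derive h z (h1 z)) ->
  exists z, Rabs (z - v) <= Rabs (y - v) /\ h y - h v = h1 z * (y - v).
Proof.
intros H.
assert (B : forall z, Rmin v y <= z <= Rmax v y -> Rabs (z - v) <= Rabs (y - v)).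
{ intros z; unfold Rmin, Rmax, Rabs; destruct (Rle_dec v y); destruct Rcase_abs, Rcase_abs; lra. }
destruct (MVT_gen h v y h1) as [z [Hz E]].
- intros z Hz; apply H, B; lra.
- intros z Hz; apply continuity_pt_filterlim.
  apply (ex_derive_continuous (K := R_AbsRing) (V := R_NormedModule)); eexists; now apply H, B.
- exists z; split; auto.
Qed.

Lemma is_derive_of_quadratic (f : R -> R) (v l r S : R) :
  0 < r -> (forall y, Rabs (y - v) < r -> Rabs (f y - f v - l * (y - v)) <= S * (y - v) ^ 2) ->
  is_derive f v l.
Proof.
intros Hr H; apply is_derive_Reals; intros e He.
assert (HS : 0 < Rabs S + 1) by (pose proof (Rabs_pos S); lra).
assert (Hd : 0 < Rmin r (e / (Rabs S + 1))).
{ apply Rmin_glb_lt; auto; now apply Rdiv_lt_0_compat. }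
exists (mkposreal _ Hd); intros h Hh0 Hh; simpl in Hh.
assert (H1 : Rabs h < r) by (eapply Rlt_le_trans; [exact Hh|apply Rmin_l]).
assert (H2 : Rabs h < e / (Rabs S + 1)) by (eapply Rlt_le_trans; [exact Hh|apply Rmin_r]).
specialize (H (v + h)); replace (v + h - v) with h in H by ring.
specialize (H H1).
replace ((f (v + h) - f v) / h - l) with ((f (v + h) - f v - l * h) * / h) by (field; auto).
rewrite Rabs_mult, Rabs_inv.
assert (Hp : 0 < Rabs h) by now apply Rabs_pos_lt.
apply Rle_lt_trans with (Rabs S * Rabs h ^ 2 * / Rabs h).
- apply Rmult_le_compat_r; [now apply Rlt_le, Rinv_0_lt_compat|].
  eapply Rle_trans; [exact H|]; rewrite <- pow2_abs.
  apply Rmult_le_compat_r; [apply pow2_ge_0|apply Rle_abs].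
- replace (Rabs S * Rabs h ^ 2 * / Rabs h) with (Rabs S * Rabs h) by (field; lra).
  apply (Rmult_lt_compat_r (Rabs S + 1)) in H2; auto.
  replace (e / (Rabs S + 1) * (Rabs S + 1)) with e in H2 by (field; lra).
  pose proof (Rabs_pos S); nra.
Qed.

(** A summable bound on the second derivatives makes the first-order Taylor remainder of the whole
    series quadratic, which already gives the derivative. *)
Lemma SeriesZ_derive (h h1 h2 : Z -> R -> R) (B : Z -> R) (v r : R) :
  0 < r ->
  (forall k y, is_derive (h k) y (h1 k y)) ->
  (forall k y, is_derive (h1 k) y (h2 k y)) ->
  (forall k y, Rabs (y - v) < r -> Rabs (h2 k y) <= B k) ->
  abs_summableZ B ->
  (forall y, Rabs (y - v) < r -> abs_summableZ (fun k => h k y)) ->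
  abs_summableZ (fun k => h1 k v) ->
  is_derive (fun y => SeriesZ (fun k => h k y)) v (SeriesZ (fun k => h1 k v)).
Proof.
intros Hr D1 D2 HB SB Sh Sh1.
apply is_derive_of_quadratic with r (SeriesZ B); auto; intros y Hy.
assert (Sv : abs_summableZ (fun k => h k v)).
{ apply Sh; rewrite Rminus_diag, Rabs_R0; auto. }
replace (SeriesZ (fun k => h k y) - SeriesZ (fun k => h k v) - SeriesZ (fun k => h1 k v) * (y - v))
  with (SeriesZ (fun k => h k y + (-1 * h k v + - (y - v) * h1 k v))).
2:{ rewrite !SeriesZ_plus, !SeriesZ_scal by auto using abs_summableZ_plus, abs_summableZ_scal; ring. }
eapply Rle_trans; [apply SeriesZ_Rabs|].
{ auto using abs_summableZ_plus, abs_summableZ_scal. }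
rewrite Rmult_comm, <- SeriesZ_scal; apply SeriesZ_le;
  auto 6 using abs_summableZ_abs, abs_summableZ_plus, abs_summableZ_scal.
intros k.
destruct (is_derive_MVT (h k) (h1 k) v y) as [z [Hz E]]; auto.
destruct (is_derive_MVT (h1 k) (h2 k) v z) as [w [Hw E2]]; auto.
replace (h k y + (-1 * h k v + - (y - v) * h1 k v)) with (h2 k w * ((z - v) * (y - v))).
- rewrite Rabs_mult, Rmult_comm; apply Rmult_le_compat; auto using Rabs_pos.
  + rewrite Rabs_mult, <- pow2_abs.
    pose proof (Rabs_pos (y - v)); pose proof (Rabs_pos (z - v)); nra.
  + apply HB; lra.
- transitivity ((h1 k z - h1 k v) * (y - v)); [rewrite E2; ring|].
  transitivity (h k y - h k v - h1 k v * (y - v)); [rewrite E|]; ring.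
Qed.

(* [C k] and [T k] play the roles of cosine and sine ([eps = -1]) or of cosh and sinh
   ([eps = 1]) of [k v], possibly multiplied by [(-1)^k]; [om] is the rate of growth in [|k|]. *)
Record character_family (eps : R) (om : R -> R) (C T : Z -> R -> R) : Prop := {
  cf_eps : Rabs eps = 1;
  cf_om_nonneg : forall v, 0 <= om v;
  cf_om_lip : forall v y, om y <= om v + Rabs (y - v);
  cf_om_mono : forall v y, Rabs y <= Rabs v -> om y <= om v;
  cf_C_derive : forall k y, is_derive (C k) y (eps * IZR k * T k y);
  cf_T_derive : forall k y, is_derive (T k) y (IZR k * C k y);
  cf_C_bound : forall k y, Rabs (C k y) <= exp (om y * IZR (Z.abs k));
  cf_T_bound : forall k y, Rabs (T k y) <= exp (om y * IZR (Z.abs k));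
  cf_C_even : forall k y, C (- k)%Z y = C k y;
  cf_T_odd : forall k y, T (- k)%Z y = - T k y;
  cf_T_add : forall j k y, T (j + k)%Z y = T j y * C k y + C j y * T k y
}.

Lemma subexp_mul_summable (c rho : R) (b F : Z -> R) :
  0 <= rho < c -> subexp c b ->
  (forall k, Rabs (F k) <= exp (rho * IZR (Z.abs k))) ->
  abs_summableZ (fun k => b k * F k).
Proof.
intros Hr Hb HF; destruct (Hb ((rho + c) / 2)) as [M [HM0 HM]]; [lra|].
apply abs_summableZ_le with (fun k => M * exp (- ((c - rho) / 2) * IZR (Z.abs k))).
- intros k; rewrite Rabs_mult.
  replace (- ((c - rho) / 2) * IZR (Z.abs k)) with
    (- ((rho + c) / 2) * IZR (Z.abs k) + rho * IZR (Z.abs k)) by field.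
  rewrite exp_plus, <- Rmult_assoc; apply Rmult_le_compat; auto using Rabs_pos.
- apply abs_summableZ_scal, exp_absZ_summable; lra.
Qed.

(** Stated for two families that differentiate into each other up to the signs [e1] and [e2], so
    that it serves both the series in C and the series in T. *)
Lemma SeriesZ_family_derive (c e1 e2 : R) (om : R -> R) (b : Z -> R) (F G : Z -> R -> R) (v : R) :
  (forall v y, om y <= om v + Rabs (y - v)) -> (forall y, 0 <= om y) ->
  Rabs e1 = 1 -> Rabs e2 = 1 ->
  (forall k y, is_derive (F k) y (e1 * IZR k * G k y)) ->
  (forall k y, is_derive (G k) y (e2 * IZR k * F k y)) ->
  (forall k y, Rabs (F k y) <= exp (om y * IZR (Z.abs k))) ->
  (forall k y, Rabs (G k y) <= exp (om y * IZR (Z.abs k))) ->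
  subexp c b -> om v < c ->
  is_derive (fun y => SeriesZ (fun k => b k * F k y)) v
    (e1 * SeriesZ (fun k => IZR k * b k * G k v)).
Proof.
intros Hl Hn He1 He2 DF DG BF BG Hb Hv.
pose proof (subexp_mul_index _ _ Hb) as Hb1; pose proof (subexp_mul_index _ _ Hb1) as Hb2.
(* Within distance [r] of v the growth rate is at most c - r by [cf_om_lip], which leaves a margin
   for two factors k. *)
set (r := (c - om v) / 2); assert (Hr : 0 < r) by (unfold r; lra).
rewrite <- SeriesZ_scal.
rewrite (SeriesZ_ext _ (fun k => b k * (e1 * IZR k * G k v))) by (intros; ring).
apply (SeriesZ_derive (fun k y => b k * F k y) (fun k y => b k * (e1 * IZR k * G k y))
   (fun k y => b k * (e1 * IZR k * (e2 * IZR k * F k y)))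
   (fun k => Rabs (IZR k * (IZR k * b k) * exp ((c - r) * IZR (Z.abs k)))) v r); auto.
- intros k y; apply (is_derive_scal (F k) y (b k)); auto.
- intros k y; apply (is_derive_scal (fun y => e1 * IZR k * G k y) y (b k)).
  apply (is_derive_scal (G k) y (e1 * IZR k)); auto.
- intros k y Hy.
  replace (b k * (e1 * IZR k * (e2 * IZR k * F k y))) with
    (e1 * (e2 * (IZR k * (IZR k * b k) * F k y))) by ring.
  rewrite Rabs_mult, He1, Rmult_1_l, Rabs_mult, He2, Rmult_1_l, !Rabs_mult.
  apply Rmult_le_compat_l; [repeat apply Rmult_le_pos; apply Rabs_pos|].
  rewrite (Rabs_pos_eq (exp _)) by apply Rlt_le, exp_pos.
  eapply Rle_trans; [apply BF|].
  assert (om y <= c - r) by (specialize (Hl v y); unfold r in *; lra).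
  assert (0 <= IZR (Z.abs k)) by (apply IZR_le; lia).
  assert (X : om y * IZR (Z.abs k) <= (c - r) * IZR (Z.abs k)) by nra.
  destruct X as [X|X]; [left; now apply exp_increasing|right; now rewrite X].
- apply abs_summableZ_abs, (subexp_mul_summable c (c - r)); auto.
  + specialize (Hn v); unfold r; lra.
  + intros k; rewrite Rabs_pos_eq by apply Rlt_le, exp_pos; lra.
- intros y Hy; apply (subexp_mul_summable c (om y)); auto.
  specialize (Hl v y); split; auto; unfold r in *; lra.
- apply abs_summableZ_ext with (fun k => e1 * (IZR k * b k * G k v)); [intros; ring|].
  apply abs_summableZ_scal, (subexp_mul_summable c (om v)); auto.
Qed.

Lemma character_C_derive (c eps : R) (om : R -> R) (C T : Z -> R -> R) (b : Z -> R) (v : R) :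
  character_family eps om C T -> subexp c b -> om v < c ->
  is_derive (fun y => SeriesZ (fun k => b k * C k y)) v
    (eps * SeriesZ (fun k => IZR k * b k * T k v)).
Proof.
intros [] Hb Hv; eapply SeriesZ_family_derive with (om := om) (e2 := 1); eauto using Rabs_R1.
intros k y; rewrite Rmult_1_l; auto.
Qed.

Lemma character_T_derive (c eps : R) (om : R -> R) (C T : Z -> R -> R) (b : Z -> R) (v : R) :
  character_family eps om C T -> subexp c b -> om v < c ->
  is_derive (fun y => SeriesZ (fun k => b k * T k y)) v
    (SeriesZ (fun k => IZR k * b k * C k v)).
Proof.
intros [] Hb Hv; rewrite <- (Rmult_1_l (SeriesZ _)).
eapply SeriesZ_family_derive with (om := om) (e1 := 1); eauto using Rabs_R1.
intros k y; rewrite Rmult_1_l; auto.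
Qed.

Lemma character_riccati (c eps : R) (om : R -> R) (C T : Z -> R -> R) (v : R) :
  0 < c -> character_family eps om C T -> om v < c ->
  is_derive (fun y => SeriesZ (fun k => index_csch c k * C k y)) v
    (2 * (eps * SeriesZ (fun k => odd_csch c k * T k v)) *
     SeriesZ (fun k => index_csch c k * C k v)).
Proof.
intros Hc HF Hv; pose proof (character_C_derive c eps om C T _ v HF (index_csch_subexp c Hc) Hv) as D.
replace (2 * (eps * SeriesZ (fun k => odd_csch c k * T k v)) *
     SeriesZ (fun k => index_csch c k * C k v)) with
  (eps * SeriesZ (fun k => IZR k * index_csch c k * T k v)); auto.
destruct HF; pose proof (csch_product c (om v) (fun k => C k v) (fun k => T k v) Hc) as P.
replace (SeriesZ (fun k => IZR k * index_csch c k * T k v)) with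
  (2 * (SeriesZ (fun k => IZR k * index_csch c k * T k v) / 2)) by field.
rewrite <- P; auto; ring.
Qed.

(** Y exp (- 2 G) has derivative 0 by [character_riccati]. The points between 0 and [v] stay in the
    domain om < c by [cf_om_mono]. *)
Lemma character_exp (c eps : R) (om : R -> R) (C T : Z -> R -> R) (G : R -> R) (v : R) :
  0 < c -> character_family eps om C T -> om v < c ->
  (forall y, om y < c -> is_derive G y (eps * SeriesZ (fun k => odd_csch c k * T k y))) ->
  SeriesZ (fun k => index_csch c k * C k v) =
  SeriesZ (fun k => index_csch c k * C k 0) * exp (2 * (G v - G 0)).
Proof.
intros Hc HF Hv HG.
set (Y := fun y => SeriesZ (fun k => index_csch c k * C k y)).
set (f := fun y => eps * SeriesZ (fun k => odd_csch c k * T k y)).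
destruct (is_derive_MVT (fun y => Y y * exp (- (2 * G y))) (fun _ => 0) 0 v) as [z [_ E]].
- intros z Hz; rewrite !Rminus_0_r in Hz.
  assert (Hz' : om z < c) by (eapply Rle_lt_trans; [eapply cf_om_mono; eauto|auto]).
  pose proof (character_riccati c eps om C T z Hc HF Hz') as D1; pose proof (HG z Hz') as D2.
  fold (f z) in D1, D2; fold (Y z) in D1; fold Y in D1.
  auto_derive.
  + split; [now exists (2 * f z * Y z)|split; [now exists (f z)|auto]].
  + replace (Derive (fun x : R => Y x) z) with (2 * f z * Y z)
      by (symmetry; exact (is_derive_unique Y z _ D1)).
    replace (Derive (fun x : R => G x) z) with (f z)
      by (symmetry; exact (is_derive_unique G z _ D2)).
    ring.
- rewrite Rmult_0_l in E.
  change (Y v = Y 0 * exp (2 * (G v - G 0))).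
  replace (2 * (G v - G 0)) with (2 * G v + - (2 * G 0)) by ring.
  rewrite exp_plus, (Rmult_comm (exp (2 * G v))), <- Rmult_assoc.
  replace (Y 0 * exp (- (2 * G 0))) with (Y v * exp (- (2 * G v))) by lra.
  rewrite Rmult_assoc, <- exp_plus, Rplus_opp_l, exp_0; ring.
Qed.

(** * The trigonometric, hyperbolic and twisted families *)

Lemma is_derive_sinh (y : R) : is_derive sinh y (cosh y).
Proof. unfold sinh, cosh; auto_derive; auto; field. Qed.

Lemma is_derive_cosh (y : R) : is_derive cosh y (sinh y).
Proof. unfold sinh, cosh; auto_derive; auto; field. Qed.

Lemma trigonometric_family :
  character_family (-1) (fun _ => 0) (fun k y => cos (IZR k * y)) (fun k y => sin (IZR k * y)).
Proof.
assert (E : forall k, exp (0 * IZR (Z.abs k)) = 1) by (intros; now rewrite Rmult_0_l, exp_0).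
constructor; intros; try lra.
- rewrite Rabs_left; lra.
- pose proof (Rabs_pos (y - v)); lra.
- auto_derive; auto; ring.
- auto_derive; auto; ring.
- rewrite E; apply Rabs_le; pose proof (COS_bound (IZR k * y)); lra.
- rewrite E; apply Rabs_le; pose proof (SIN_bound (IZR k * y)); lra.
- rewrite opp_IZR, Ropp_mult_distr_l_reverse; apply cos_neg.
- rewrite opp_IZR, Ropp_mult_distr_l_reverse; apply sin_neg.
- rewrite plus_IZR, Rmult_plus_distr_r; apply sin_plus.
Qed.

Lemma exp_le_compat (x y : R) : x <= y -> exp x <= exp y.
Proof. intros [H| ->]; [left; now apply exp_increasing|lra]. Qed.

Lemma hyperbolic_family :
  character_family 1 Rabs (fun k y => cosh (IZR k * y)) (fun k y => sinh (IZR k * y)).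
Proof.
assert (B : forall k y, exp (IZR k * y) <= exp (Rabs y * IZR (Z.abs k)) /\
   exp (- (IZR k * y)) <= exp (Rabs y * IZR (Z.abs k))).
{ intros k y; rewrite abs_IZR, <- Rabs_mult, (Rmult_comm y).
  pose proof (Rle_abs (IZR k * y)); pose proof (Rle_abs (- (IZR k * y))) as Ha.
  rewrite Rabs_Ropp in Ha; split; now apply exp_le_compat. }
assert (P := fun k y => exp_pos (IZR k * y)).
assert (N := fun k y => exp_pos (- (IZR k * y))).
constructor; intros; auto using Rabs_R1, Rabs_pos.
- pose proof (Rabs_triang v (y - v)); replace (v + (y - v)) with y in * by ring; lra.
- pose proof (is_derive_comp cosh (fun y => IZR k * y) y _ (IZR k) (is_derive_cosh _)) as D.
  rewrite Rmult_1_l; apply D; auto_derive; auto; ring.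
- pose proof (is_derive_comp sinh (fun y => IZR k * y) y _ (IZR k) (is_derive_sinh _)) as D.
  apply D; auto_derive; auto; ring.
- specialize (B k y); specialize (P k y); specialize (N k y).
  apply Rabs_le; unfold cosh; lra.
- specialize (B k y); specialize (P k y); specialize (N k y).
  apply Rabs_le; unfold sinh; lra.
- rewrite opp_IZR, Ropp_mult_distr_l_reverse; apply cosh_opp.
- rewrite opp_IZR, Ropp_mult_distr_l_reverse; apply sinh_opp.
- rewrite plus_IZR, Rmult_plus_distr_r; apply sinh_add.
Qed.

(** The sign (-1)^k is itself a character of Z, so the addition law survives. On the trigonometric
    family the twist is the translation by PI. *)
Lemma twisted_family (eps : R) (om : R -> R) (C T : Z -> R -> R) :
  character_family eps om C T ->
  character_family eps om (fun k y => parity_sign k * C k y) (fun k y => parity_sign k * T k y).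
Proof.
assert (A : forall k, Rabs (parity_sign k) = 1).
{ intros k; unfold parity_sign; destruct Z.odd; [rewrite Rabs_left|rewrite Rabs_pos_eq]; lra. }
intros HF; destruct HF as [? ? ? ? ? ? ? ? Ce To Ta]; constructor; auto; intros.
- replace (eps * IZR k * (parity_sign k * T k y)) with (parity_sign k * (eps * IZR k * T k y)) by ring.
  apply (is_derive_scal (C k) y (parity_sign k)); auto.
- replace (IZR k * (parity_sign k * C k y)) with (parity_sign k * (IZR k * C k y)) by ring.
  apply (is_derive_scal (T k) y (parity_sign k)); auto.
- rewrite Rabs_mult, A, Rmult_1_l; auto.
- rewrite Rabs_mult, A, Rmult_1_l; auto.
- rewrite parity_sign_opp, Ce; auto.
- rewrite parity_sign_opp, To; ring.
- rewrite parity_sign_add, Ta; ring.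
Qed.

(** * The logarithmic series and its differential equation *)

Definition log_series (c : R) (C : Z -> R -> R) (v : R) : R :=
  SeriesZ (fun k => odd_csch c k * / IZR k * (C k v - 1)).

Definition csch_total (c : R) : R := SeriesZ (index_csch c).

Definition csch_alt_total (c : R) : R := SeriesZ (fun k => parity_sign k * index_csch c k).

Lemma odd_csch_div_subexp (c : R) : 0 < c -> subexp c (fun k => odd_csch c k * / IZR k).
Proof.
intros Hc; apply subexp_le with (1 := odd_csch_subexp c Hc); intros k; rewrite Rabs_mult.
rewrite <- (Rmult_1_r (Rabs (odd_csch c k))) at 2.
apply Rmult_le_compat_l; [apply Rabs_pos|].
destruct (Z.eq_dec k 0) as [->|N]; [rewrite Rinv_0, Rabs_R0; lra|].
rewrite Rabs_inv, <- abs_IZR, <- Rinv_1; apply Rinv_le_contravar; [lra|apply IZR_le; lia].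
Qed.

Lemma odd_csch_div_mul (c : R) (k : Z) : IZR k * (odd_csch c k * / IZR k) = odd_csch c k.
Proof.
destruct (Z.eq_dec k 0) as [->|N].
- unfold odd_csch, odd_ind; simpl; ring.
- field; now apply eq_IZR_contrapositive.
Qed.

Lemma log_series_summable (c eps : R) (om : R -> R) (C T : Z -> R -> R) (v : R) :
  0 < c -> character_family eps om C T -> om v < c ->
  abs_summableZ (fun k => odd_csch c k * / IZR k * (C k v - 1)).
Proof.
intros Hc HF Hv.
apply abs_summableZ_ext with
  (fun k => odd_csch c k * / IZR k * C k v + -1 * (odd_csch c k * / IZR k)); [intros; ring|].
destruct HF; pose proof (odd_csch_div_subexp c Hc) as D.
apply abs_summableZ_plus; [apply (subexp_mul_summable c (om v)); auto|].
apply abs_summableZ_scal, (subexp_summable c); auto.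
Qed.

Lemma log_series_derive (c eps : R) (om : R -> R) (C T : Z -> R -> R) (v : R) :
  0 < c -> character_family eps om C T -> om v < c ->
  is_derive (log_series c C) v (eps * SeriesZ (fun k => odd_csch c k * T k v)).
Proof.
intros Hc HF Hv; pose proof (odd_csch_div_subexp c Hc) as D.
pose proof (character_C_derive c eps om C T _ v HF D Hv) as D1.
rewrite (SeriesZ_ext _ (fun k => odd_csch c k * T k v)) in D1
  by (intros; now rewrite odd_csch_div_mul).
set (S := SeriesZ (fun k => odd_csch c k * / IZR k)).
apply is_derive_ext_loc with (fun y => SeriesZ (fun k => odd_csch c k * / IZR k * C k y) - S).
- assert (Hr : 0 < c - om v) by lra.
  exists (mkposreal _ Hr); intros y Hy.
  assert (Hy' : om y < c).
  { change (Rabs (y - v) < c - om v) in Hy; pose proof (cf_om_lip _ _ _ _ HF v y); lra. }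
  unfold log_series.
  rewrite (SeriesZ_ext (fun k => odd_csch c k * / IZR k * (C k y - 1))
    (fun k => odd_csch c k * / IZR k * C k y + -1 * (odd_csch c k * / IZR k))) by (intros; ring).
  rewrite SeriesZ_plus, SeriesZ_scal; [match goal with |- @eq _ ?a ?b => change (@eq R a b) end; unfold S; ring| |].
  + destruct HF; apply (subexp_mul_summable c (om y)); auto.
  + apply abs_summableZ_scal, (subexp_summable c); auto.
- replace (eps * SeriesZ (fun k => odd_csch c k * T k v)) with
    (eps * SeriesZ (fun k => odd_csch c k * T k v) - 0) by ring.
  apply (is_derive_minus (K := R_AbsRing) (V := R_NormedModule)); auto.
  apply (is_derive_const (K := R_AbsRing) (V := R_NormedModule)).
Qed.

Lemma log_series_0 (c : R) (C : Z -> R -> R) :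
  (forall k, C k 0 = 1) -> log_series c C 0 = 0.
Proof.
intros H; unfold log_series; transitivity (SeriesZ (fun _ => 0)); [|apply SeriesZ_0].
apply SeriesZ_ext; intros; rewrite H; ring.
Qed.

Lemma csch_series_exp (c eps : R) (om : R -> R) (C T : Z -> R -> R) (v : R) :
  0 < c -> character_family eps om C T -> (forall k, C k 0 = 1) -> om v < c ->
  SeriesZ (fun k => index_csch c k * C k v) = csch_total c * exp (2 * log_series c C v).
Proof.
intros Hc HF H0 Hv.
rewrite (character_exp c eps om C T (log_series c C) v) by eauto using log_series_derive.
rewrite log_series_0, Rminus_0_r by auto; f_equal.
apply SeriesZ_ext; intros; rewrite H0; ring.
Qed.

(** Only odd k occur in the logarithmic derivative, so the twist by (-1)^k changes its sign, and - g
    takes the place of g in [character_exp]. *)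
Lemma csch_alt_series_exp (c eps : R) (om : R -> R) (C T : Z -> R -> R) (v : R) :
  0 < c -> character_family eps om C T -> (forall k, C k 0 = 1) -> om v < c ->
  SeriesZ (fun k => index_csch c k * (parity_sign k * C k v)) =
  csch_alt_total c * exp (- (2 * log_series c C v)).
Proof.
intros Hc HF H0 Hv.
rewrite (character_exp c eps om _ _ (fun y => -1 * log_series c C y) v Hc (twisted_family _ _ _ _ HF)
  Hv).
- rewrite log_series_0 by auto; f_equal; [|f_equal; ring].
  apply SeriesZ_ext; intros; rewrite H0; ring.
- intros y Hy.
  replace (eps * SeriesZ (fun k => odd_csch c k * (parity_sign k * T k y))) with
    (-1 * (eps * SeriesZ (fun k => odd_csch c k * T k y))).
  + apply (is_derive_scal (log_series c C) y (-1)); eapply log_series_derive; eauto.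
  + rewrite <- Rmult_assoc, (Rmult_comm (-1)), Rmult_assoc, <- SeriesZ_scal.
    apply (f_equal (Rmult eps)), SeriesZ_ext; intros k; unfold odd_csch.
    destruct (odd_ind_cases k) as [[-> ->]|[-> ->]]; ring.
Qed.

Lemma odd_csch_index (c : R) (k : Z) :
  0 < c -> IZR k * odd_csch c k = (index_csch c k - parity_sign k * index_csch c k) / 2.
Proof.
intros Hc; unfold odd_csch, index_csch; destruct (Z.eq_dec k 0) as [->|N].
- unfold parity_sign; simpl; unfold Rdiv; ring.
- destruct (odd_ind_cases k) as [[-> ->]|[-> ->]]; field; now apply sinh_neq0, IZR_mul_neq0.
Qed.

(** The odd part of k / sinh (k c) is half the difference of [index_csch] and its twist, in which C0
    cancels. Both series are exponentials of g, so the equation for g closes. *)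
Lemma csch_derivative (c eps : R) (om : R -> R) (C T : Z -> R -> R) (v : R) :
  0 < c -> character_family eps om C T -> (forall k, C k 0 = 1) -> om v < c ->
  is_derive (fun y => SeriesZ (fun k => odd_csch c k * T k y)) v
    ((csch_total c * exp (2 * log_series c C v) -
      csch_alt_total c * exp (- (2 * log_series c C v))) / 2).
Proof.
intros Hc HF H0 Hv.
pose proof (character_T_derive c eps om C T _ v HF (odd_csch_subexp c Hc) Hv) as D.
rewrite <- (csch_series_exp c eps om C T v), <- (csch_alt_series_exp c eps om C T v) by auto.
set (A := fun k => index_csch c k * C k v) in *.
set (B := fun k => index_csch c k * (parity_sign k * C k v)) in *.
assert (Hom : 0 <= om v < c) by (split; [apply (cf_om_nonneg _ _ _ _ HF)|auto]).
assert (SA : abs_summableZ A).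
{ apply (subexp_mul_summable c (om v)); auto using index_csch_subexp.
  intros k; apply (cf_C_bound _ _ _ _ HF). }
assert (SB : abs_summableZ B).
{ apply (subexp_mul_summable c (om v)); auto using index_csch_subexp.
  intros k; apply (cf_C_bound _ _ _ _ (twisted_family _ _ _ _ HF) k v). }
replace ((SeriesZ A - SeriesZ B) / 2) with (SeriesZ (fun k => IZR k * odd_csch c k * C k v)); auto.
rewrite (SeriesZ_ext _ (fun k => /2 * A k + - / 2 * B k)).
- rewrite SeriesZ_plus, !SeriesZ_scal by auto using abs_summableZ_scal; field.
- intros k; rewrite odd_csch_index by auto; unfold A, B; field.
Qed.

(** First integral of [csch_derivative]: since g' = eps f, the derivative of f^2 - (eps / 2) (A e^(2
    g) + B e^(- 2 g)) carries the factor 1 - eps^2 = 0. The constant is found at v = 0. *)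
Lemma csch_energy (c eps : R) (om : R -> R) (C T : Z -> R -> R) (v : R) :
  0 < c -> character_family eps om C T -> (forall k, C k 0 = 1) -> (forall k, T k 0 = 0) ->
  om v < c ->
  SeriesZ (fun k => odd_csch c k * T k v) ^ 2 =
  eps / 2 * (csch_total c * exp (2 * log_series c C v) +
   csch_alt_total c * exp (- (2 * log_series c C v)) - csch_total c - csch_alt_total c).
Proof.
intros Hc HF H0 T0 Hv.
set (A := csch_total c); set (B := csch_alt_total c).
set (f := fun y => SeriesZ (fun k => odd_csch c k * T k y)); set (g := log_series c C).
change (f v ^ 2 = eps / 2 * (A * exp (2 * g v) + B * exp (- (2 * g v)) - A - B)).
assert (He : eps * eps = 1).
{ pose proof (cf_eps _ _ _ _ HF) as E; unfold Rabs in E; destruct Rcase_abs; nra. }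
destruct (is_derive_MVT (fun y => f y ^ 2 - eps / 2 * (A * exp (2 * g y) + B * exp (- (2 * g y))))
  (fun _ => 0) 0 v) as [z [_ E]].
- intros z Hz; rewrite !Rminus_0_r in Hz.
  assert (Hz' : om z < c) by (eapply Rle_lt_trans; [eapply cf_om_mono; eauto|auto]).
  pose proof (log_series_derive c eps om C T z Hc HF Hz') as D1.
  pose proof (csch_derivative c eps om C T z Hc HF H0 Hz') as D2.
  fold g in D1; fold A B f g in D2; change (is_derive g z (eps * f z)) in D1.
  auto_derive.
  + split; [eexists; exact D2|repeat split; eexists; exact D1].
  + replace (Derive (fun x : R => f x) z) with ((A * exp (2 * g z) - B * exp (- (2 * g z))) / 2)
      by (symmetry; exact (is_derive_unique f z _ D2)).
    replace (Derive (fun x : R => g x) z) with (eps * f z)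
      by (symmetry; exact (is_derive_unique g z _ D1)).
    transitivity ((1 - eps * eps) * (f z * (A * exp (2 * g z) - B * exp (- (2 * g z)))));
      [simpl; field|rewrite He; ring].
- rewrite Rmult_0_l in E.
  assert (G0 : g 0 = 0) by (apply log_series_0; auto).
  assert (F0 : f 0 = 0).
  { unfold f; transitivity (SeriesZ (fun _ => 0)); [|apply SeriesZ_0].
    apply SeriesZ_ext; intros; rewrite T0; ring. }
  rewrite G0, F0, Rmult_0_r, Ropp_0, exp_0 in E; lra.
Qed.

(** * The quarter periods attached to c *)

Definition log_dn (c : R) : R -> R := log_series c (fun k y => cos (IZR k * y)).

(* [dn] at an imaginary argument is [dc] for the complementary modulus. *)
Definition log_dc (c : R) : R -> R := log_series c (fun k y => cosh (IZR k * y)).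

(** The complementary modulus k' is the minimum of dn, reached at the quarter period, which is v =
    PI in this scaling. *)
Definition comp_modulus (c : R) : R := exp (log_dn c PI).

(** This is K / PI for the modulus attached to [c], as [ellipticF_PI2_comp] shows; it converts v
    into the argument of dn. *)
Definition dn_scale (c : R) : R := sqrt (csch_total c / 2).

Lemma cos_IZR_PI (k : Z) : cos (IZR k * PI) = parity_sign k.
Proof.
assert (E : forall n, cos (IZR (Z.of_nat n) * PI) = parity_sign (Z.of_nat n)).
{ induction n as [|n IH].
  - simpl; rewrite Rmult_0_l; apply cos_0.
  - rewrite Nat2Z.inj_succ; unfold Z.succ.
    rewrite plus_IZR, Rmult_plus_distr_r, Rmult_1_l, neg_cos, IH, parity_sign_add.
    unfold parity_sign at 3; simpl; ring. }
destruct (Z_le_dec 0 k) as [H|H].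
- rewrite <- (Z2Nat.id k) by lia; apply E.
- rewrite <- (Z.opp_involutive k), parity_sign_opp, opp_IZR, Ropp_mult_distr_l_reverse, cos_neg.
  rewrite <- (Z2Nat.id (- k)) by lia; apply E.
Qed.

Lemma odd_csch_div_nonneg (c : R) (k : Z) : 0 < c -> 0 <= odd_csch c k * / IZR k.
Proof.
intros Hc; unfold odd_csch, odd_ind; destruct (Z.odd k); [|rewrite !Rmult_0_l; lra].
assert (P : forall k, (0 < k)%Z -> 0 <= / sinh (IZR k * c) * / IZR k).
{ intros m Hm; assert (0 < IZR m) by now apply IZR_lt.
  apply Rmult_le_pos; left; apply Rinv_0_lt_compat; auto.
  apply sinh_pos, Rmult_lt_0_compat; auto. }
rewrite Rmult_1_l; destruct (Z_lt_dec 0 k); [auto|].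
destruct (Z.eq_dec k 0) as [->|N]; [rewrite Rinv_0; lra|].
specialize (P (- k)%Z ltac:(lia)).
rewrite opp_IZR, Ropp_mult_distr_l_reverse, sinh_opp, !Rinv_opp in P; lra.
Qed.

Lemma odd_csch_div_1 (c : R) : 0 < c -> 0 < odd_csch c 1 * / IZR 1.
Proof.
intros Hc; unfold odd_csch, odd_ind; simpl; rewrite Rinv_1, Rmult_1_r, !Rmult_1_l.
now apply Rinv_0_lt_compat, sinh_pos.
Qed.

(** For odd k, cos (k PI) = -1, so the difference is a series of nonnegative terms in cos (k v) + 1,
    and its term k = 1 is positive. *)
Lemma log_dn_gt (c v : R) : 0 < c -> cos v <> -1 -> log_dn c PI < log_dn c v.
Proof.
intros Hc Hv.
assert (S : forall y, abs_summableZ (fun k => odd_csch c k * / IZR k * (cos (IZR k * y) - 1))).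
{ intros y; apply (log_series_summable c (-1) _ _ _ y Hc trigonometric_family Hc). }
set (d := fun k => odd_csch c k * / IZR k * (cos (IZR k * v) + 1)).
assert (E : forall k, odd_csch c k * / IZR k * (cos (IZR k * v) - 1) +
   -1 * (odd_csch c k * / IZR k * (cos (IZR k * PI) - 1)) = d k).
{ intros k; unfold d; rewrite cos_IZR_PI; unfold odd_csch.
  destruct (odd_ind_cases k) as [[-> ->]|[-> ->]]; ring. }
assert (Sd : abs_summableZ d).
{ apply abs_summableZ_ext with (1 := E); auto using abs_summableZ_plus, abs_summableZ_scal. }
assert (F : log_dn c v - log_dn c PI = SeriesZ d).
{ rewrite <- (SeriesZ_ext _ _ E), SeriesZ_plus, SeriesZ_scal by auto using abs_summableZ_scal.
  unfold log_dn, log_series; ring. }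
assert (P : d 1%Z <= SeriesZ d).
{ apply SeriesZ_ge_term; auto; intros k; apply Rmult_le_pos.
  - now apply odd_csch_div_nonneg.
  - pose proof (COS_bound (IZR k * v)); lra. }
assert (0 < d 1%Z); [|lra].
apply Rmult_lt_0_compat; [now apply odd_csch_div_1|].
rewrite Rmult_1_l; pose proof (COS_bound v); lra.
Qed.

Lemma log_dn_0 (c : R) : log_dn c 0 = 0.
Proof. apply log_series_0; intros; now rewrite Rmult_0_r, cos_0. Qed.

Lemma comp_modulus_bounds (c : R) : 0 < c -> 0 < comp_modulus c < 1.
Proof.
intros Hc; split; [apply exp_pos|].
rewrite <- exp_0, <- (log_dn_0 c); apply exp_increasing, log_dn_gt; auto.
rewrite cos_0; lra.
Qed.

(** At v = PI the cosines become (-1)^k, so the twisted total is the value of Y there. *)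
Lemma csch_alt_total_eq (c : R) : 0 < c -> csch_alt_total c = csch_total c * comp_modulus c ^ 2.
Proof.
intros Hc.
pose proof (csch_series_exp c (-1) _ _ _ PI Hc trigonometric_family) as E; cbv beta in E.
replace (comp_modulus c ^ 2) with (exp (2 * log_dn c PI)).
- unfold log_dn; rewrite <- E; auto.
  + apply SeriesZ_ext; intros k; rewrite cos_IZR_PI; ring.
  + intros; now rewrite Rmult_0_r, cos_0.
- unfold comp_modulus; simpl; rewrite Rmult_1_r, <- exp_plus; f_equal; ring.
Qed.

(** C0 has no visible sign. Instead f'(0) is computed twice: termwise it is a positive series, and
    by [csch_derivative] it equals the total times (1 - k'^2) / 2. *)
Lemma csch_total_pos (c : R) : 0 < c -> 0 < csch_total c.
Proof.
intros Hc.
pose proof (csch_derivative c (-1) _ _ _ 0 Hc trigonometric_family) as D1.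
pose proof (character_T_derive c (-1) _ _ _ _ 0 trigonometric_family (odd_csch_subexp c Hc) Hc) as D2.
cbv beta in D1; specialize (D1 ltac:(intros; now rewrite Rmult_0_r, cos_0) Hc).
apply is_derive_unique in D1, D2; rewrite D1 in D2; clear D1.
change (log_series c _ 0) with (log_dn c 0) in D2.
rewrite log_dn_0, csch_alt_total_eq, Rmult_0_r, Ropp_0, exp_0 in D2 by auto.
pose proof (comp_modulus_bounds c Hc) as K.
set (S := SeriesZ _) in D2.
assert (P : 0 < S).
{ set (d := fun k => IZR k * odd_csch c k * cos (IZR k * 0)) in S.
  assert (E : forall k, d k = IZR k ^ 2 * (odd_csch c k * / IZR k)).
  { intros k; unfold d; rewrite Rmult_0_r, cos_0, <- odd_csch_div_mul at 1; ring. }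
  apply Rlt_le_trans with (d 1%Z).
  - rewrite E; apply Rmult_lt_0_compat; [simpl; lra|now apply odd_csch_div_1].
  - apply SeriesZ_ge_term.
    + intros k; rewrite E; apply Rmult_le_pos; [apply pow2_ge_0|now apply odd_csch_div_nonneg].
    + apply (subexp_mul_summable c 0); [lra|apply subexp_mul_index, odd_csch_subexp; auto|].
      intros k; apply (cf_C_bound _ _ _ _ trigonometric_family k 0). }
assert (csch_total c * (1 - comp_modulus c ^ 2) > 0) by lra.
assert (0 < 1 - comp_modulus c ^ 2) by nra.
apply Rmult_lt_reg_r with (1 - comp_modulus c ^ 2); lra.
Qed.

Lemma dn_scale_sqr (c : R) : 0 < c -> dn_scale c ^ 2 = csch_total c / 2.
Proof.
intros Hc; pose proof (csch_total_pos c Hc); unfold dn_scale; rewrite pow2_sqrt; lra.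
Qed.

Lemma dn_scale_pos (c : R) : 0 < c -> 0 < dn_scale c.
Proof. intros Hc; pose proof (csch_total_pos c Hc); apply sqrt_lt_R0; lra. Qed.

(** Integrates d am / du = dn along u = [dn_scale c] * v; agreement with the inverse of [ellipticF]
    is proved, not built in. *)
Definition amplitude (c v : R) : R := RInt (fun y => dn_scale c * exp (log_dn c y)) 0 v.

Lemma log_dn_derive (c v : R) :
  0 < c -> is_derive (log_dn c) v (- SeriesZ (fun k => odd_csch c k * sin (IZR k * v))).
Proof.
intros Hc; pose proof (log_series_derive c (-1) _ _ _ v Hc trigonometric_family Hc) as D.
cbv beta in D; replace (- SeriesZ _) with
  (-1 * SeriesZ (fun k => odd_csch c k * sin (IZR k * v))) by ring; exact D.
Qed.

Lemma amplitude_derive (c v : R) :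
  0 < c -> is_derive (amplitude c) v (dn_scale c * exp (log_dn c v)).
Proof.
intros Hc.
assert (C : forall y, continuous (fun y => dn_scale c * exp (log_dn c y)) y).
{ intros y; apply (ex_derive_continuous (K := R_AbsRing) (V := R_NormedModule)).
  auto_derive; eexists; now apply log_dn_derive. }
apply (is_derive_RInt (V := R_NormedModule) (fun y => dn_scale c * exp (log_dn c y))
  (amplitude c) 0 v); auto.
apply filter_forall; intros y.
apply (RInt_correct (V := R_CompleteNormedModule)).
apply (ex_RInt_continuous (V := R_CompleteNormedModule)); auto.
Qed.

(* As a function of the amplitude [t], [p = dn^2] solves [p'' + 4 p = 2 (1 + k'^2)], so that
   [p = 1 - alpha sin^2 t]; uniqueness follows from conservation of [4 x^2 + x'^2]. *)
Lemma dn_amplitude (c v : R) :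
  0 < c ->
  exp (log_dn c v) ^ 2 = 1 - (1 - comp_modulus c ^ 2) * sin (amplitude c v) ^ 2.
Proof.
intros Hc.
set (m := dn_scale c); set (q := comp_modulus c ^ 2); set (g := log_dn c); set (th := amplitude c).
set (f := fun y => SeriesZ (fun k => odd_csch c k * sin (IZR k * y))).
assert (Hm : 0 < m) by now apply dn_scale_pos.
assert (A : csch_total c = 2 * m ^ 2) by (unfold m; rewrite dn_scale_sqr by auto; field).
assert (B : csch_alt_total c = 2 * m ^ 2 * q) by (rewrite csch_alt_total_eq, A by auto; reflexivity).
assert (C1 : forall k, cos (IZR k * 0) = 1) by (intros; now rewrite Rmult_0_r, cos_0).
assert (S0 : forall k, sin (IZR k * 0) = 0) by (intros; now rewrite Rmult_0_r, sin_0).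
assert (Dg : forall y, is_derive g y (- f y)) by (intros; now apply log_dn_derive).
assert (Dth : forall y, is_derive th y (m * exp (g y))) by (intros; now apply amplitude_derive).
assert (Df : forall y, is_derive f y (m ^ 2 * exp (2 * g y) - m ^ 2 * q * exp (- (2 * g y)))).
{ intros y; pose proof (csch_derivative c (-1) _ _ _ y Hc trigonometric_family C1 Hc) as D.
  change (log_series c _ y) with (g y) in D; rewrite A, B in D.
  replace (m ^ 2 * exp (2 * g y) - m ^ 2 * q * exp (- (2 * g y))) with
    ((2 * m ^ 2 * exp (2 * g y) - 2 * m ^ 2 * q * exp (- (2 * g y))) / 2) by field; exact D. }
assert (Ef : forall y, f y ^ 2 = m ^ 2 * (1 + q) - m ^ 2 * exp (2 * g y) - m ^ 2 * q * exp (- (2 * g y))).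
{ intros y; pose proof (csch_energy c (-1) _ _ _ y Hc trigonometric_family C1 S0 Hc) as D.
  change (log_series c _ y) with (g y) in D; rewrite A, B in D; cbv beta in D.
  unfold f; rewrite D; field. }
(* [X] is the defect of the claim and [W] its derivative with respect to the amplitude: X' = m e^g W
   and W' = - 4 m e^g X. *)
set (X := fun y => exp (2 * g y) - 1 + (1 - q) * sin (th y) ^ 2).
set (W := fun y => - 2 * f y * exp (g y) / m + 2 * (1 - q) * sin (th y) * cos (th y)).
assert (g0 : g 0 = 0) by apply log_dn_0.
assert (th0 : th 0 = 0) by apply (RInt_point (V := R_CompleteNormedModule)).
assert (f0 : f 0 = 0).
{ unfold f; transitivity (SeriesZ (fun _ => 0)); [|apply SeriesZ_0].
  apply SeriesZ_ext; intros k; rewrite S0; ring. }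
assert (E2 : forall y, exp (2 * g y) = exp (g y) ^ 2).
{ intros y; simpl; rewrite Rmult_1_r, <- exp_plus; f_equal; ring. }
destruct (is_derive_MVT (fun y => 4 * X y ^ 2 + W y ^ 2) (fun _ => 0) 0 v) as [z [_ E]].
- intros z _.
  assert (DX : is_derive X z (m * exp (g z) * W z)).
  { unfold X; auto_derive.
    - repeat split; eexists; eauto.
    - replace (Derive (fun x : R => g x) z) with (- f z)
        by (symmetry; exact (is_derive_unique g z _ (Dg z))).
      replace (Derive (fun x : R => th x) z) with (m * exp (g z))
        by (symmetry; exact (is_derive_unique th z _ (Dth z))).
      rewrite E2; unfold W; simpl; field; lra. }
  assert (DW : is_derive W z (- (4 * m * exp (g z) * X z))).
  { unfold W; auto_derive.
    - repeat split; eexists; eauto.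
    - replace (Derive (fun x : R => g x) z) with (- f z)
        by (symmetry; exact (is_derive_unique g z _ (Dg z))).
      replace (Derive (fun x : R => th x) z) with (m * exp (g z))
        by (symmetry; exact (is_derive_unique th z _ (Dth z))).
      replace (Derive (fun x : R => f x) z) with
        (m ^ 2 * exp (2 * g z) - m ^ 2 * q * exp (- (2 * g z)))
        by (symmetry; exact (is_derive_unique f z _ (Df z))).
      pose proof (sin2_cos2 (th z)) as SC; unfold Rsqr in SC.
      transitivity (- 2 * exp (g z) / m * (m ^ 2 * exp (2 * g z) - m ^ 2 * q * exp (- (2 * g z))
         - f z ^ 2) + 2 * (1 - q) * (cos (th z) * cos (th z) - sin (th z) * sin (th z))
         * (m * exp (g z))); [field; lra|].
      rewrite Ef; replace (cos (th z) * cos (th z)) with (1 - sin (th z) * sin (th z)) by lra.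
      unfold X; field; lra. }
  auto_derive.
  + repeat split; eexists; eauto.
  + replace (Derive (fun x : R => X x) z) with (m * exp (g z) * W z)
      by (symmetry; exact (is_derive_unique X z _ DX)).
    replace (Derive (fun x : R => W x) z) with (- (4 * m * exp (g z) * X z))
      by (symmetry; exact (is_derive_unique W z _ DW)).
    ring.
- rewrite Rmult_0_l in E.
  assert (X0 : X 0 = 0) by (unfold X; rewrite g0, th0, Rmult_0_r, exp_0, sin_0; ring).
  assert (W0 : W 0 = 0) by (unfold W; rewrite f0, th0, sin_0; field; lra).
  rewrite X0, W0 in E.
  assert (X v = 0) by nra.
  unfold X in H; rewrite E2 in H; lra.
Qed.

Lemma sqr_unit_interval (k : R) : 0 < k < 1 -> 0 < k ^ 2 < 1.
Proof. intros H; split; nra. Qed.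

Lemma ellipticF_0 (alpha : R) : ellipticF alpha 0 = 0.
Proof. apply (RInt_point (V := R_CompleteNormedModule)). Qed.

(** By [dn_amplitude] the elliptic integrand at the amplitude is 1 / dn, which cancels the factor dn
    in the speed of the amplitude. *)
Lemma ellipticF_amplitude (c v : R) :
  0 < c -> ellipticF (1 - comp_modulus c ^ 2) (amplitude c v) = dn_scale c * v.
Proof.
intros Hc; set (b := 1 - comp_modulus c ^ 2).
assert (Hb : 0 <= b < 1).
{ pose proof (sqr_unit_interval _ (comp_modulus_bounds c Hc)); unfold b; lra. }
destruct (is_derive_MVT (fun y => ellipticF b (amplitude c y) - dn_scale c * y) (fun _ => 0) 0 v)
  as [z [_ E]].
- intros z _.
  pose proof (is_derive_comp (ellipticF b) (amplitude c) z _ _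
    (Defs.ellipticF_derive b (amplitude c z) Hb) (amplitude_derive c z Hc)) as D.
  unfold Defs.g, b in D; rewrite <- dn_amplitude in D by auto; fold b in D.
  rewrite sqrt_pow2 in D by apply Rlt_le, exp_pos.
  replace 0 with (scal (dn_scale c * exp (log_dn c z)) (/ exp (log_dn c z)) - dn_scale c).
  + apply (is_derive_minus (K := R_AbsRing) (V := R_NormedModule)); auto.
    auto_derive; auto; ring.
  + unfold scal; simpl; unfold mult; simpl; field; apply Rgt_not_eq, exp_pos.
- rewrite Rmult_0_l in E.
  assert (E0 : amplitude c 0 = 0) by apply (RInt_point (V := R_CompleteNormedModule)).
  rewrite E0, ellipticF_0 in E; lra.
Qed.

Lemma jacobi_dn_log_dn (c v : R) :
  0 < c -> jacobi_dn (1 - comp_modulus c ^ 2) (dn_scale c * v) = exp (log_dn c v).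
Proof.
intros Hc; set (b := 1 - comp_modulus c ^ 2).
assert (Hb : 0 <= b < 1).
{ pose proof (sqr_unit_interval _ (comp_modulus_bounds c Hc)); unfold b; lra. }
assert (A : jacobi_am b (dn_scale c * v) = amplitude c v).
{ destruct (ellipticF_bijective b (dn_scale c * v) Hb) as [p [_ U]].
  rewrite <- (U (amplitude c v)) by now apply ellipticF_amplitude.
  symmetry; apply U; now apply ellipticF_am. }
unfold jacobi_dn; rewrite A; unfold b; rewrite <- dn_amplitude by auto.
apply sqrt_pow2, Rlt_le, exp_pos.
Qed.

Lemma sin_sqr_eq_1 (y : R) : 0 <= y <= PI / 2 -> sin y ^ 2 = 1 -> y = PI / 2.
Proof.
intros Hy H; destruct (Req_dec y (PI / 2)) as [E|N]; auto.
pose proof PI_RGT_0.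
assert (0 <= sin y) by (apply sin_ge_0; lra).
assert (sin y < 1) by (rewrite <- sin_PI2; apply sin_increasing_1; lra).
nra.
Qed.

(** The value k' of dn at PI forces sin^2 = 1 there. Were the amplitude beyond PI / 2, it would
    cross PI / 2 at some v < PI, where dn would also equal k', against the strict minimum of
    [log_dn_gt]. *)
Lemma amplitude_PI (c : R) : 0 < c -> amplitude c PI = PI / 2.
Proof.
intros Hc; pose proof PI_RGT_0 as Hpi.
pose proof (comp_modulus_bounds c Hc) as K; pose proof (sqr_unit_interval _ K) as K2.
assert (E0 : amplitude c 0 = 0) by apply (RInt_point (V := R_CompleteNormedModule)).
assert (Hd := fun z => amplitude_derive c z Hc).
assert (Hp : 0 <= amplitude c PI).
{ destruct (is_derive_MVT (amplitude c) (fun v => dn_scale c * exp (log_dn c v)) 0 PI)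
    as [z [_ E]]; [auto|].
  rewrite E0 in E.
  pose proof (Rmult_lt_0_compat _ _ (dn_scale_pos c Hc) (exp_pos (log_dn c z))); nra. }
assert (S : sin (amplitude c PI) ^ 2 = 1).
{ pose proof (dn_amplitude c PI Hc) as E; fold (comp_modulus c) in E.
  apply Rmult_eq_reg_l with (1 - comp_modulus c ^ 2); lra. }
apply sin_sqr_eq_1; auto; split; auto.
destruct (Rle_dec (amplitude c PI) (PI / 2)) as [|N]; auto; exfalso.
destruct (IVT_gen (amplitude c) 0 PI (PI / 2)) as [v [Hv E]].
- intros y; apply continuity_pt_filterlim.
  apply (ex_derive_continuous (K := R_AbsRing) (V := R_NormedModule)); eexists; apply Hd.
- rewrite Rmin_left, Rmax_right; lra.
- rewrite Rmin_left, Rmax_right in Hv by lra.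
  pose proof (dn_amplitude c v Hc) as D; rewrite E, sin_PI2 in D.
  assert (Hv' : v < PI) by (destruct (proj2 Hv) as [|V]; [auto|rewrite V in E; lra]).
  assert (L : log_dn c PI < log_dn c v).
  { apply log_dn_gt; auto; rewrite <- cos_PI; intros C.
    apply (Rlt_irrefl (cos PI)); rewrite <- C at 2; apply cos_decreasing_1; lra. }
  apply exp_increasing in L; fold (comp_modulus c) in L; nra.
Qed.

Lemma ellipticF_PI2_comp (c : R) :
  0 < c -> ellipticF (1 - comp_modulus c ^ 2) (PI / 2) = dn_scale c * PI.
Proof. intros Hc; rewrite <- (amplitude_PI c), ellipticF_amplitude; auto. Qed.

(** * The imaginary axis and the complementary quarter period *)

Lemma log_dc_derive (c w : R) :
  0 < c -> Rabs w < c ->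
  is_derive (log_dc c) w (SeriesZ (fun k => odd_csch c k * sinh (IZR k * w))).
Proof.
intros Hc Hw; pose proof (log_series_derive c 1 _ _ _ w Hc hyperbolic_family Hw) as D.
cbv beta in D; rewrite Rmult_1_l in D; exact D.
Qed.

Lemma cosh_0 : cosh 0 = 1.
Proof. unfold cosh; rewrite Ropp_0, exp_0; field. Qed.

(** With h = exp (- [log_dc]), the left-hand side is h'^2, and the identity is the differential
    equation of sn for the modulus k'. *)
Lemma log_dc_energy (c w : R) :
  0 < c -> Rabs w < c ->
  (SeriesZ (fun k => odd_csch c k * sinh (IZR k * w)) * exp (- log_dc c w)) ^ 2 =
  dn_scale c ^ 2 * (1 - exp (- log_dc c w) ^ 2) *
  (1 - comp_modulus c ^ 2 * exp (- log_dc c w) ^ 2).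
Proof.
intros Hc Hw.
pose proof (csch_energy c 1 _ _ _ w Hc hyperbolic_family) as E; cbv beta in E.
rewrite Rpow_mult_distr, E; auto.
- change (log_series c _ w) with (log_dc c w).
  rewrite dn_scale_sqr, csch_alt_total_eq by auto.
  replace (- (2 * log_dc c w)) with (- log_dc c w + - log_dc c w) by ring.
  replace (2 * log_dc c w) with (log_dc c w + log_dc c w) by ring.
  rewrite !exp_plus, !exp_Ropp; field; apply Rgt_not_eq, exp_pos.
- intros; now rewrite Rmult_0_r, cosh_0.
- intros; now rewrite Rmult_0_r, sinh_0.
Qed.

Lemma sinh_term_nonneg (c w : R) (k : Z) :
  0 < c -> 0 < w -> 0 <= odd_csch c k * sinh (IZR k * w).
Proof.
intros Hc Hw.
assert (P : forall k, (0 < k)%Z -> 0 <= odd_csch c k * sinh (IZR k * w)).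
{ intros m Hm; assert (0 < IZR m) by now apply IZR_lt.
  unfold odd_csch, odd_ind; destruct Z.odd; [|lra].
  rewrite Rmult_1_l; apply Rmult_le_pos; left.
  - apply Rinv_0_lt_compat, sinh_pos, Rmult_lt_0_compat; auto.
  - apply sinh_pos, Rmult_lt_0_compat; auto. }
destruct (Z_lt_dec 0 k); [auto|].
destruct (Z.eq_dec k 0) as [->|N]; [unfold odd_csch, odd_ind; simpl; lra|].
specialize (P (- k)%Z ltac:(lia)).
rewrite odd_csch_opp, opp_IZR in P; replace (- IZR k * w) with (- (IZR k * w)) in P by ring.
rewrite sinh_opp, Rmult_opp_opp in P; auto.
Qed.

Lemma sinh_series_pos (c w : R) :
  0 < w < c -> 0 < SeriesZ (fun k => odd_csch c k * sinh (IZR k * w)).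
Proof.
intros Hw; assert (Hc : 0 < c) by lra.
apply Rlt_le_trans with (odd_csch c 1 * sinh (IZR 1 * w)).
- unfold odd_csch, odd_ind; simpl; rewrite !Rmult_1_l.
  apply Rmult_lt_0_compat; [apply Rinv_0_lt_compat|]; apply sinh_pos; lra.
- apply (SeriesZ_ge_term (fun k => odd_csch c k * sinh (IZR k * w)) 1).
  + intros k; apply sinh_term_nonneg; lra.
  + apply (subexp_mul_summable c (Rabs w)).
    * rewrite Rabs_pos_eq; lra.
    * now apply odd_csch_subexp.
    * intros k; apply (cf_T_bound _ _ _ _ hyperbolic_family k w).
Qed.

Lemma log_dc_0 (c : R) : log_dc c 0 = 0.
Proof. apply log_series_0; intros; now rewrite Rmult_0_r, cosh_0. Qed.

Lemma cosh_ge_1 (y : R) : 1 <= cosh y.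
Proof.
unfold cosh; rewrite exp_Ropp; pose proof (exp_pos y) as P.
apply Rmult_le_reg_r with (exp y); auto.
replace ((exp y + / exp y) / 2 * exp y) with ((exp y * exp y + 1) / 2) by (field; lra).
pose proof (Rle_0_sqr (exp y - 1)); unfold Rsqr in *; lra.
Qed.

Lemma cosh_gt_1 (y : R) : 0 < y -> 1 < cosh y.
Proof.
intros Hy; unfold cosh; rewrite exp_Ropp.
assert (P : 1 < exp y) by (rewrite <- exp_0; now apply exp_increasing).
apply Rmult_lt_reg_r with (exp y); [lra|].
replace ((exp y + / exp y) / 2 * exp y) with ((exp y * exp y + 1) / 2) by (field; lra).
nra.
Qed.

Lemma log_dc_summable (c w : R) :
  0 < w < c -> abs_summableZ (fun k => odd_csch c k * / IZR k * (cosh (IZR k * w) - 1)).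
Proof.
intros Hw; apply (log_series_summable c 1 Rabs _ _ w ltac:(lra) hyperbolic_family).
rewrite Rabs_pos_eq; lra.
Qed.

Lemma log_dc_pos (c w : R) : 0 < w < c -> 0 < log_dc c w.
Proof.
intros Hw.
apply Rlt_le_trans with (odd_csch c 1 * / IZR 1 * (cosh (IZR 1 * w) - 1)).
- apply Rmult_lt_0_compat; [apply odd_csch_div_1; lra|].
  pose proof (cosh_gt_1 (IZR 1 * w)); lra.
- apply (SeriesZ_ge_term (fun k => odd_csch c k * / IZR k * (cosh (IZR k * w) - 1)) 1).
  + intros k; apply Rmult_le_pos; [apply odd_csch_div_nonneg; lra|].
    pose proof (cosh_ge_1 (IZR k * w)); lra.
  + now apply log_dc_summable.
Qed.

Lemma sumZ_continuous (lo hi : Z) (f : Z -> R -> R) (x : R) :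
  (forall k, continuous (f k) x) -> continuous (fun y => sumZ lo hi (fun k => f k y)) x.
Proof.
intros H; unfold sumZ; induction (seq 0 (Z.to_nat (hi - lo))) as [|i l IH]; simpl.
- apply continuous_const.
- apply (continuous_plus (V := R_NormedModule)); auto.
Qed.

Lemma odd_ind_symsum (n : nat) : symsum odd_ind (S n) = INR n + odd_ind (Z.of_nat n).
Proof.
induction n as [|n IH].
- unfold sumZ, odd_ind; simpl; ring.
- rewrite symsum_S, IH, odd_ind_opp, S_INR by lia.
  rewrite Nat2Z.inj_succ; unfold odd_ind; rewrite Z.odd_succ, <- Z.negb_odd.
  destruct (Z.odd (Z.of_nat n)); simpl; ring.
Qed.

(** At w = c each odd term equals 1, so partial sums there are as large as desired. By continuity
    one of them stays large slightly before c, and it bounds the series from below because all terms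
    are nonnegative. *)
Lemma sinh_series_unbounded (c M : R) :
  0 < c -> exists w, 0 < w < c /\ M < SeriesZ (fun k => odd_csch c k * sinh (IZR k * w)).
Proof.
intros Hc; destruct (nfloor_ex (Rabs M)) as [n [_ Hn]]; [apply Rabs_pos|].
pose proof (Rle_abs M) as HM.
(* The terms with |k| <= n + 2 add up at c to at least n + 2 > |M| + 1; the continuity estimate
   costs 1. *)
set (P := fun w => symsum (fun k => odd_csch c k * sinh (IZR k * w)) (S (S (S n)))).
assert (E : P c = symsum odd_ind (S (S (S n)))).
{ apply sumZ_ext; intros k _; unfold odd_csch; destruct (Z.eq_dec k 0) as [->|N].
  - unfold odd_ind; simpl; ring.
  - field; now apply sinh_neq0, IZR_mul_neq0. }
rewrite odd_ind_symsum, !S_INR in E.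
assert (0 <= odd_ind (Z.of_nat (S (S n)))) by (unfold odd_ind; destruct Z.odd; lra).
assert (C : continuous P c).
{ apply sumZ_continuous; intros k.
  apply (ex_derive_continuous (K := R_AbsRing) (V := R_NormedModule)); eexists.
  apply (is_derive_scal (fun w => sinh (IZR k * w)) c (odd_csch c k)).
  apply (cf_T_derive _ _ _ _ hyperbolic_family). }
destruct (C (fun y => Rabs (y - P c) < 1)) as [d Hd].
{ exists (mkposreal 1 Rlt_0_1); intros y Hy; exact Hy. }
set (w := c - Rmin (d / 2) (c / 2)); pose proof (cond_pos d) as Hd0.
assert (0 < Rmin (d / 2) (c / 2)) by (apply Rmin_glb_lt; lra).
pose proof (Rmin_l (d / 2) (c / 2)); pose proof (Rmin_r (d / 2) (c / 2)).
assert (Hw : 0 < w < c) by (unfold w; lra).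
exists w; split; auto.
specialize (Hd w); cbv beta in Hd.
assert (Hb : Rabs (P w - P c) < 1).
{ apply Hd; change (Rabs (w - c) < d); unfold w; rewrite Rabs_left; lra. }
apply Rabs_def2 in Hb.
apply Rlt_le_trans with (P w); [lra|].
apply SeriesZ_ge_symsum.
- intros k; apply sinh_term_nonneg; lra.
- apply (subexp_mul_summable c (Rabs w)).
  + rewrite Rabs_pos_eq; lra.
  + now apply odd_csch_subexp.
  + intros k; apply (cf_T_bound _ _ _ _ hyperbolic_family k w).
Qed.

(** The energy identity gives f h <= m for h = exp (- [log_dc]), while f is unbounded. A single [w]
    is enough later, since it is inserted into a quantity that does not depend on w. *)
Lemma exp_log_dc_small (c e : R) :
  0 < c -> 0 < e -> exists w, 0 < w < c /\ exp (- log_dc c w) < e.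
Proof.
intros Hc He; pose proof (dn_scale_pos c Hc) as Hm.
destruct (sinh_series_unbounded c (dn_scale c / e) Hc) as [w [Hw H]]; exists w; split; auto.
pose proof (log_dc_energy c w Hc ltac:(rewrite Rabs_pos_eq; lra)) as E.
set (h := exp (- log_dc c w)) in *; set (f := SeriesZ _) in *; set (m := dn_scale c) in *.
pose proof (sqr_unit_interval _ (comp_modulus_bounds c Hc)) as K; set (q := comp_modulus c ^ 2) in *.
assert (Hh : 0 < h < 1).
{ split; [apply exp_pos|]; unfold h; rewrite <- exp_0; apply exp_increasing.
  pose proof (log_dc_pos c w Hw); lra. }
assert (0 < h ^ 2 < 1) by nra.
assert (U : (1 - h ^ 2) * (1 - q * h ^ 2) <= 1).
{ assert (0 < q * h ^ 2) by nra; assert (q * h ^ 2 < 1) by nra; nra. }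
assert (B : (f * h) ^ 2 <= m ^ 2) by (rewrite E, Rmult_assoc; pose proof (pow2_ge_0 m); nra).
assert (F : m < f * e).
{ apply (Rmult_lt_compat_r e) in H; auto.
  replace (m / e * e) with m in H by (field; lra); auto. }
destruct (Rlt_dec h e) as [|N]; auto; exfalso.
assert (0 < f) by (apply Rmult_lt_reg_r with e; lra).
assert (m < f * h) by nra; nra.
Qed.

Lemma is_derive_asin (x : R) : -1 < x < 1 -> is_derive asin x (/ sqrt (1 - x ^ 2)).
Proof.
intros Hx; apply is_derive_Reals.
pose proof (derivable_pt_asin x Hx) as D.
rewrite <- Rsqr_pow2, <- Rdiv_1_l, <- (derive_pt_asin x Hx).
apply derive_pt_eq_1 with (derivable_pt_asin x Hx); reflexivity.
Qed.

(** The factors from asin and from the elliptic integrand are the two square roots in the energy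
    identity; f h > 0 selects the positive root, and everything cancels but - m. *)
Lemma log_dc_ellipticF_derive (c w : R) :
  0 < w < c ->
  is_derive (fun w => ellipticF (comp_modulus c ^ 2) (asin (exp (- log_dc c w)))) w (- dn_scale c).
Proof.
intros Hw; assert (Hc : 0 < c) by lra.
pose proof (log_dc_energy c w Hc ltac:(rewrite Rabs_pos_eq; lra)) as E.
pose proof (sinh_series_pos c w Hw) as Hf.
pose proof (log_dc_derive c w Hc ltac:(rewrite Rabs_pos_eq; lra)) as D.
pose proof (dn_scale_pos c Hc) as Hm.
set (q := comp_modulus c ^ 2) in *; set (m := dn_scale c) in *; set (f := SeriesZ _) in *.
assert (Hq : 0 < q < 1) by (apply sqr_unit_interval, comp_modulus_bounds; auto).
set (h := exp (- log_dc c w)) in *.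
assert (Hh : 0 < h < 1).
{ split; [apply exp_pos|]; unfold h; rewrite <- exp_0; apply exp_increasing.
  pose proof (log_dc_pos c w Hw); lra. }
assert (H2 : 0 < h ^ 2 < 1) by nra.
assert (Dh : is_derive (fun w => exp (- log_dc c w)) w (- (f * h))).
{ auto_derive; [eexists; exact D|].
  replace (Derive (fun x : R => log_dc c x) w) with f
    by (symmetry; exact (is_derive_unique _ _ _ D)).
  fold h; ring. }
pose proof (is_derive_comp asin (fun w => exp (- log_dc c w)) w _ _ (is_derive_asin h ltac:(lra)) Dh) as Da.
pose proof (is_derive_comp (ellipticF q) (fun w => asin (exp (- log_dc c w))) w _ _
  (Defs.ellipticF_derive q (asin h) ltac:(lra)) Da) as DF.
replace (- m) with (scal (scal (- (f * h)) (/ sqrt (1 - h ^ 2))) (Defs.g q (asin h))); auto.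
unfold Defs.g; rewrite sin_asin by lra.
assert (F : f * h = m * (sqrt (1 - h ^ 2) * sqrt (1 - q * h ^ 2))).
{ assert (0 < f * h) by nra.
  assert (A1 : 0 <= 1 - h ^ 2) by lra.
  assert (A2 : 0 <= 1 - q * h ^ 2) by nra.
  rewrite <- (sqrt_pow2 (f * h)) by lra.
  rewrite E, Rmult_assoc, !sqrt_mult, sqrt_pow2; auto using pow2_ge_0, Rmult_le_pos; lra. }
rewrite F; unfold scal; simpl; unfold mult; simpl.
assert (0 < sqrt (1 - h ^ 2)) by (apply sqrt_lt_R0; lra).
assert (0 < sqrt (1 - q * h ^ 2)) by (apply sqrt_lt_R0; nra).
simpl in *; field; lra.
Qed.

Lemma ellipticF_mono (alpha p q : R) :
  0 <= alpha < 1 -> p < q -> ellipticF alpha p < ellipticF alpha q.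
Proof. intros Ha H; pose proof (Defs.ellipticF_expand alpha p q Ha); lra. Qed.

Lemma continuity_le_limit (f : R -> R) (x l : R) :
  continuity f -> (forall d, 0 < d -> exists t, 0 < Rabs (t - x) < d /\ f t <= l) -> f x <= l.
Proof.
intros Hf H; destruct (Rle_dec (f x) l) as [|N]; auto; exfalso.
destruct (Hf x (f x - l)) as [e [He Hx]]; [lra|].
destruct (H e He) as [t [[Ht1 Ht2] Ht]].
assert (X : Rabs (f t - f x) < f x - l).
{ apply Hx; split; [split; [exact I|]|exact Ht2].
  intros ->; rewrite Rminus_diag, Rabs_R0 in Ht1; lra. }
apply Rabs_def2 in X; lra.
Qed.

(** V(w) + m w is constant on (0, c). As w tends to 0, h tends to 1 and V to the complete integral;
    towards c, V tends to 0. The derivative of asin breaks down at the first end and the series at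
    the second, so each end is handled by a pair of inequalities for the constant [L]. *)
Lemma ellipticF_PI2 (c : R) :
  0 < c -> ellipticF (comp_modulus c ^ 2) (PI / 2) = dn_scale c * c.
Proof.
intros Hc; pose proof (dn_scale_pos c Hc) as Hm; pose proof PI_RGT_0 as Hpi.
set (q := comp_modulus c ^ 2); set (m := dn_scale c) in *.
assert (Hq : 0 < q < 1) by (apply sqr_unit_interval, comp_modulus_bounds; auto).
set (h := fun w => exp (- log_dc c w)); set (V := fun w => ellipticF q (asin (h w))).
assert (Hh : forall w, 0 < w < c -> 0 < h w < 1).
{ intros w Hw; split; [apply exp_pos|]; unfold h; rewrite <- exp_0; apply exp_increasing.
  pose proof (log_dc_pos c w Hw); lra. }
assert (HV : forall w1 w2, 0 < w1 < c -> 0 < w2 < c -> V w1 + m * w1 = V w2 + m * w2).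
{ intros w1 w2 H1 H2.
  assert (D : forall z, 0 < z < c -> is_derive (fun w => V w + m * w) z 0).
  { intros z Hz; replace 0 with (- m + m) by ring.
    apply (is_derive_plus (K := R_AbsRing) (V := R_NormedModule)).
    - now apply log_dc_ellipticF_derive.
    - auto_derive; auto; ring. }
  assert (B : forall z, Rmin w1 w2 <= z <= Rmax w1 w2 -> 0 < z < c).
  { intros z; unfold Rmin, Rmax; destruct Rle_dec; lra. }
  destruct (MVT_gen (fun w => V w + m * w) w1 w2 (fun _ => 0)) as [z [_ E]].
  - intros z Hz; apply D, B; lra.
  - intros z Hz; apply continuity_pt_filterlim.
    apply (ex_derive_continuous (K := R_AbsRing) (V := R_NormedModule) (fun w => V w + m * w) z).
    eexists; now apply D, B.
  - lra. }
assert (Ha : forall w, 0 < w < c -> 0 < asin (h w) < PI / 2).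
{ intros w Hw; specialize (Hh w Hw); pose proof (asin_bound_lt (h w) ltac:(lra)); split; [|lra].
  destruct (Rlt_dec 0 (asin (h w))) as [|N]; auto; exfalso.
  pose proof (sin_asin (h w) ltac:(lra)) as S.
  assert (0 <= sin (- asin (h w))) by (apply sin_ge_0; lra).
  rewrite sin_neg in *; lra. }
assert (Hc2 : 0 < c / 2 < c) by lra.
set (L := V (c / 2) + m * (c / 2)).
(* For any t > 0 some w has asin (h w) < t, hence L - m c <= F(t); then t tends to 0. *)
assert (L1 : L <= m * c).
{ assert (X : forall t, 0 < t < PI / 2 -> L - m * c <= ellipticF q t).
  { intros t Ht; destruct (exp_log_dc_small c (sin t) Hc) as [w [Hw S]].
    { apply sin_gt_0; lra. }
    fold (h w) in S; unfold L; rewrite (HV _ w Hc2 Hw).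
    pose proof (Ha w Hw) as Haw.
    assert (asin (h w) < t).
    { apply sin_increasing_0; try lra; rewrite sin_asin; auto; specialize (Hh w Hw); lra. }
    pose proof (ellipticF_mono q (asin (h w)) t ltac:(lra) ltac:(auto)).
    change (V w + m * w - m * c <= ellipticF q t); unfold V; nra. }
  enough (- ellipticF q 0 <= m * c - L) by (rewrite ellipticF_0 in *; lra).
  apply (continuity_le_limit (fun t => - ellipticF q t)).
  - apply (continuity_opp (ellipticF q)), Defs.ellipticF_continuity; lra.
  - intros d Hd; exists (Rmin (d / 2) (PI / 4)).
    assert (0 < Rmin (d / 2) (PI / 4)) by (apply Rmin_glb_lt; lra).
    pose proof (Rmin_l (d / 2) (PI / 4)); pose proof (Rmin_r (d / 2) (PI / 4)).
    rewrite Rminus_0_r, Rabs_pos_eq by lra; split; [lra|].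
    specialize (X (Rmin (d / 2) (PI / 4))); lra. }
(* Any t < PI / 2 lies below asin (h w) for w small enough, since h is continuous with h 0 = 1. *)
assert (L2 : ellipticF q (PI / 2) <= L).
{ apply continuity_le_limit; [apply Defs.ellipticF_continuity; lra|].
  intros d Hd; set (t := PI / 2 - Rmin (d / 2) (PI / 4)); exists t.
  assert (0 < Rmin (d / 2) (PI / 4)) by (apply Rmin_glb_lt; lra).
  pose proof (Rmin_l (d / 2) (PI / 4)); pose proof (Rmin_r (d / 2) (PI / 4)).
  assert (Ht : PI / 4 <= t < PI / 2) by (unfold t; lra).
  split; [unfold t; rewrite Rabs_left; lra|].
  assert (St : sin t < 1) by (rewrite <- sin_PI2; apply sin_increasing_1; lra).
  assert (Ch : continuous h 0).
  { apply (ex_derive_continuous (K := R_AbsRing) (V := R_NormedModule)).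
    unfold h; auto_derive; eexists; apply log_dc_derive; auto; rewrite Rabs_R0; auto. }
  destruct (Ch (fun y => Rabs (y - h 0) < 1 - sin t)) as [e He].
  { assert (P : 0 < 1 - sin t) by lra; exists (mkposreal _ P); intros y Hy; exact Hy. }
  pose proof (cond_pos e) as He0; set (w := Rmin (e / 2) (c / 2)).
  assert (0 < w) by (apply Rmin_glb_lt; lra).
  pose proof (Rmin_l (e / 2) (c / 2)); pose proof (Rmin_r (e / 2) (c / 2)).
  assert (Hw : 0 < w < c) by (unfold w in *; lra).
  assert (X : Rabs (h w - h 0) < 1 - sin t).
  { apply He; change (Rabs (w - 0) < e); rewrite Rminus_0_r, Rabs_pos_eq; unfold w in *; lra. }
  assert (h0 : h 0 = 1) by (unfold h; rewrite log_dc_0, Ropp_0, exp_0; auto).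
  rewrite h0 in X; apply Rabs_def2 in X.
  pose proof (Ha w Hw) as Haw.
  assert (Hlt : t < asin (h w)).
  { apply sin_increasing_0; try lra; rewrite sin_asin; [lra|specialize (Hh w Hw); lra]. }
  pose proof (ellipticF_mono q t (asin (h w)) ltac:(lra) Hlt).
  unfold L; rewrite (HV _ w Hc2 Hw); unfold V; nra. }
assert (L3 : L <= ellipticF q (PI / 2)).
{ apply le_epsilon; intros e He; set (w := Rmin (e / m) (c / 2)).
  assert (0 < e / m) by now apply Rdiv_lt_0_compat.
  assert (0 < w) by (apply Rmin_glb_lt; lra).
  pose proof (Rmin_l (e / m) (c / 2)) as B; pose proof (Rmin_r (e / m) (c / 2)) as B2; fold w in B, B2.
  assert (Hw : 0 < w < c) by lra.
  pose proof (ellipticF_mono q (asin (h w)) (PI / 2) ltac:(lra) (proj2 (Ha w Hw))).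
  apply (Rmult_le_compat_l m) in B; [|lra].
  replace (m * (e / m)) with e in B by (field; lra).
  unfold L; rewrite (HV _ w Hc2 Hw); unfold V; lra. }
assert (L4 : m * c <= L).
{ apply le_epsilon; intros e He; set (u := Rmin (e / m) (c / 2)).
  assert (0 < e / m) by now apply Rdiv_lt_0_compat.
  assert (0 < u) by (apply Rmin_glb_lt; lra).
  pose proof (Rmin_l (e / m) (c / 2)) as B; pose proof (Rmin_r (e / m) (c / 2)) as B2; fold u in B, B2.
  assert (Hw : 0 < c - u < c) by lra.
  pose proof (ellipticF_mono q 0 (asin (h (c - u))) ltac:(lra) (proj1 (Ha _ Hw))) as M.
  rewrite ellipticF_0 in M.
  apply (Rmult_le_compat_l m) in B; [|lra].
  replace (m * (e / m)) with e in B by (field; lra).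
  unfold L; rewrite (HV _ (c - u) Hc2 Hw); unfold V; lra. }
lra.
Qed.

(** * The complete integral as a hypergeometric series *)

(** The central binomial coefficient divided by 4^n: both the Taylor coefficients of 1 / sqrt (1 -
    z) and the Wallis ratios. *)
Definition binom_half (n : nat) : R := pochhammer (1 / 2) n / INR (fact n).

Lemma binom_half_S (n : nat) : (INR n + 1) * binom_half (S n) = (INR n + 1 / 2) * binom_half n.
Proof.
unfold binom_half; rewrite fact_simpl, mult_INR, S_INR; simpl.
pose proof (pos_INR n); pose proof (INR_fact_neq_0 n); field; lra.
Qed.

Lemma binom_half_bounds (n : nat) : 0 < binom_half n <= 1.
Proof.
induction n as [|n IH]; [unfold binom_half; simpl; lra|].
pose proof (binom_half_S n) as E; pose proof (pos_INR n); split.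
- apply Rmult_lt_reg_l with (INR n + 1); [lra|]; nra.
- apply Rmult_le_reg_l with (INR n + 1); [lra|]; nra.
Qed.

Lemma pochhammer_1 (n : nat) : pochhammer 1 n = INR (fact n).
Proof.
induction n as [|n IH]; [reflexivity|].
rewrite fact_simpl, mult_INR, S_INR, <- IH; simpl; ring.
Qed.

Lemma hyp2F1_half (z : R) : hyp2F1 (1 / 2) (1 / 2) 1 z = PSeries (fun n => binom_half n ^ 2) z.
Proof.
apply PSeries_ext; intros n; rewrite pochhammer_1; unfold binom_half.
pose proof (INR_fact_neq_0 n); field; auto.
Qed.

Lemma CV_radius_ge_1 (a : nat -> R) : (forall n, Rabs (a n) <= 1) -> Rbar_le 1 (CV_radius a).
Proof.
intros H; apply (proj1 (CV_radius_bounded a)); exists 1; intros n.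
rewrite pow1, Rmult_1_r; auto.
Qed.

Lemma binom_half_CV (z : R) : Rabs z < 1 -> Rbar_lt (Rabs z) (CV_radius binom_half).
Proof.
intros H; eapply Rbar_lt_le_trans with 1; [exact H|].
apply CV_radius_ge_1; intros n; pose proof (binom_half_bounds n); rewrite Rabs_pos_eq; lra.
Qed.

Lemma binom_half_derive (z : R) :
  Rabs z < 1 ->
  (1 - z) * PSeries (PS_derive binom_half) z = PSeries binom_half z / 2.
Proof.
intros Hz; pose proof (binom_half_CV z Hz) as C.
pose proof C as C'; rewrite <- CV_radius_derive in C'.
apply CV_radius_inside in C, C'.
assert (E : PSeries (PS_derive binom_half) z =
  PSeries (PS_plus (PS_incr_1 (PS_derive binom_half)) (PS_scal (/ 2) binom_half)) z).
{ apply PSeries_ext; intros [|n].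
  - unfold PS_plus, PS_scal, PS_derive, PS_incr_1, plus, scal, zero; simpl; unfold mult; simpl.
    unfold binom_half; simpl; field.
  - unfold PS_plus, PS_scal, PS_derive, PS_incr_1, plus, scal; cbn -[INR]; unfold mult; cbn -[INR].
    rewrite (S_INR (S n)), binom_half_S; field. }
rewrite PSeries_plus, PSeries_incr_1, PSeries_scal in E.
- lra.
- now apply ex_pseries_incr_1.
- apply ex_pseries_scal; auto; apply Rmult_comm.
Qed.

(** The recurrence gives (1 - z) h' = h / 2, so (1 - z) h^2 is constant. The terms are nonnegative
    for z >= 0, which fixes the sign of the root. *)
Lemma binomial_series (z : R) : 0 <= z < 1 -> PSeries binom_half z = / sqrt (1 - z).
Proof.
intros Hz; set (h := PSeries binom_half).
assert (E : (1 - z) * h z ^ 2 = 1).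
{ destruct (is_derive_MVT (fun y => (1 - y) * h y ^ 2) (fun _ => 0) 0 z) as [y [_ E]].
  - intros y Hy; rewrite !Rminus_0_r, (Rabs_pos_eq z) in Hy by lra.
    assert (Hy' : Rabs y < 1) by lra.
    pose proof (is_derive_PSeries binom_half y (binom_half_CV y Hy')) as D; fold h in D.
    auto_derive; [eexists; exact D|].
    replace (Derive (fun x : R => h x) y) with (PSeries (PS_derive binom_half) y)
      by (symmetry; exact (is_derive_unique h y _ D)).
    pose proof (binom_half_derive y Hy') as B; fold h in B; simpl; nra.
  - assert (h0 : h 0 = 1) by (unfold h; rewrite PSeries_0; unfold binom_half; simpl; field).
    rewrite h0 in E; lra. }
assert (P : 0 <= h z).
{ assert (Z0 : Series (fun _ => 0 * 0) = 0) by (rewrite Series_scal_l; ring).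
  unfold h, PSeries; rewrite <- Z0; apply Series_le.
  - intros n; split; [lra|]; rewrite Rmult_0_l; apply Rmult_le_pos; [apply Rlt_le, binom_half_bounds|].
    apply pow_le; lra.
  - assert (Hz' : Rabs z < 1) by (rewrite Rabs_pos_eq; lra).
    pose proof (CV_radius_inside _ _ (binom_half_CV z Hz')) as X.
    eapply ex_series_ext with (2 := X); intros n; cbv beta.
    rewrite pow_n_pow; unfold scal; simpl; unfold mult; simpl; ring. }
pose proof (sqrt_lt_R0 (1 - z) ltac:(lra)) as S.
assert (S2 : sqrt (1 - z) ^ 2 = 1 - z) by (apply pow2_sqrt; lra).
apply Rmult_eq_reg_l with (sqrt (1 - z)); [|lra].
rewrite Rinv_r by lra.
apply Rsqr_inj; [apply Rmult_le_pos; lra|lra|].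
unfold Rsqr; nra.
Qed.

(** The recursion comes from integrating the derivative of sin^(2n+1) cos / (2n+2), which vanishes
    at both ends. *)
Lemma wallis (n : nat) :
  is_RInt (fun t => sin t ^ (2 * n)) 0 (PI / 2) (PI / 2 * binom_half n).
Proof.
induction n as [|n IH].
- replace (PI / 2 * binom_half 0) with (scal (PI / 2 - 0) 1)
    by (unfold scal, binom_half; simpl; unfold mult; simpl; field).
  apply (is_RInt_const (V := R_NormedModule)).
- set (N := INR n); assert (HN : 0 <= N) by apply pos_INR.
  assert (D : is_RInt (fun t => (2 * N + 1) / (2 * N + 2) * sin t ^ (2 * n) - sin t ^ (2 * S n))
     0 (PI / 2) (sin (PI / 2) ^ (2 * n + 1) * cos (PI / 2) / (2 * N + 2)
      - sin 0 ^ (2 * n + 1) * cos 0 / (2 * N + 2))).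
  { apply (is_RInt_derive (fun t => sin t ^ (2 * n + 1) * cos t / (2 * N + 2))).
    - intros t _; auto_derive; [auto|].
      replace (Init.Nat.pred (n + (n + 0) + 1)) with (2 * n)%nat by lia.
      replace (n + (n + 0) + 1)%nat with (S (2 * n)) by lia.
      replace (2 * S n)%nat with (S (S (2 * n))) by lia.
      rewrite !S_INR, mult_INR; fold N; simpl pow.
      replace (INR 2) with 2 by (simpl; lra).
      pose proof (sin2_cos2 t) as SC; unfold Rsqr in SC.
      set (u := sin t ^ (n + (n + 0))).
      replace ((2 * N + 1) / (2 * N + 2) * u) with
        ((2 * N + 1) / (2 * N + 2) * u * (sin t * sin t + cos t * cos t)) by (rewrite SC; ring).
      field; lra.
    - intros t _; apply (ex_derive_continuous (K := R_AbsRing) (V := R_NormedModule)).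
      auto_derive; auto. }
  rewrite cos_PI2, sin_0, (pow_i (2 * n + 1)) in D by lia.
  apply (is_RInt_scal (V := R_NormedModule) _ 0 (PI / 2) ((2 * N + 1) / (2 * N + 2))) in IH.
  pose proof (is_RInt_minus (V := R_NormedModule) _ _ _ _ _ _ IH D) as M.
  pose proof (binom_half_S n) as B; fold N in B.
  replace (PI / 2 * binom_half (S n)) with
   (minus (scal ((2 * N + 1) / (2 * N + 2)) (PI / 2 * binom_half n))
     (sin (PI / 2) ^ (2 * n + 1) * 0 / (2 * N + 2) - 0 * cos 0 / (2 * N + 2))).
  + eapply is_RInt_ext with (2 := M); intros t _.
    unfold minus, scal, plus, opp; simpl; unfold mult; simpl; ring.
  + replace (binom_half (S n)) with ((N + 1 / 2) * binom_half n / (N + 1))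
      by (rewrite <- B; field; lra).
    unfold minus, scal, plus, opp; simpl; unfold mult; simpl; field; lra.
Qed.

Lemma sum_n_le_Series (u : nat -> R) (n : nat) :
  (forall n, 0 <= u n) -> ex_series u -> sum_n u n <= Series u.
Proof.
intros Hu Hs; apply Series_correct in Hs.
apply (is_lim_seq_incr_compare (sum_n u)); [exact Hs|].
intros m; rewrite sum_Sn; specialize (Hu (S m)); unfold plus; simpl; lra.
Qed.

Lemma ellipticK_ellipticF (alpha : R) :
  0 <= alpha < 1 -> ellipticK alpha = ellipticF alpha (PI / 2).
Proof.
intros Ha.
set (a := fun n => binom_half n * alpha ^ n).
assert (Sa : forall s, 0 <= s <= 1 -> is_series (fun n => a n * s ^ n) (/ sqrt (1 - alpha * s))).
{ intros s Hs; assert (Hz : 0 <= alpha * s < 1) by nra.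
  rewrite <- binomial_series by auto.
  assert (Hz' : Rabs (alpha * s) < 1) by (rewrite Rabs_pos_eq; lra).
  pose proof (PSeries_correct _ _ (CV_radius_inside _ _ (binom_half_CV _ Hz'))) as X.
  eapply is_series_ext with (2 := X); intros n; unfold a.
  rewrite pow_n_pow, Rpow_mult_distr; unfold scal; simpl; unfold mult; simpl; ring. }
assert (Pa : forall n, 0 <= a n).
{ intros n; apply Rmult_le_pos; [apply Rlt_le, binom_half_bounds|apply pow_le; lra]. }
assert (S1 : is_series a (/ sqrt (1 - alpha))).
{ pose proof (Sa 1 ltac:(lra)) as X; rewrite Rmult_1_r in X.
  eapply is_series_ext with (2 := X); intros n; cbv beta; rewrite pow1; apply Rmult_1_r. }
(* All coefficients are nonnegative, so the remainder at s is at most the one at s = 1, finite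
   because alpha < 1. The convergence is thus uniform in t, and integration termwise is allowed. *)
assert (T : forall s N, 0 <= s <= 1 ->
  Rabs (sum_n (fun n => a n * s ^ n) N - / sqrt (1 - alpha * s)) <=
  / sqrt (1 - alpha) - sum_n a N).
{ intros s N Hs; specialize (Sa s Hs).
  assert (Q : forall n, 0 <= s ^ n <= 1).
  { intros n; split; [apply pow_le; lra|]; rewrite <- (pow1 n); apply pow_incr; lra. }
  assert (Y3 : forall M, sum_n (fun n => minus (a n) (a n * s ^ n)) M =
    sum_n a M - sum_n (fun n => a n * s ^ n) M).
  { intros M; induction M as [|M IH]; [rewrite !sum_O; reflexivity|].
    rewrite !sum_Sn, IH; unfold minus, plus, opp; simpl; ring. }
  pose proof (sum_n_le_Series (fun n => a n * s ^ n) N) as X1.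
  rewrite (is_series_unique _ _ Sa) in X1.
  pose proof (is_series_minus _ _ _ _ S1 Sa) as Sd.
  pose proof (sum_n_le_Series (fun n => minus (a n) (a n * s ^ n)) N) as X2.
  replace (Series (fun n => minus (a n) (a n * s ^ n))) with
    (minus (/ sqrt (1 - alpha)) (/ sqrt (1 - alpha * s))) in X2
    by (symmetry; exact (is_series_unique _ _ Sd)).
  assert (Y1 : sum_n (fun n => a n * s ^ n) N <= / sqrt (1 - alpha * s)).
  { apply X1; [|eexists; exact Sa]; intros n; apply Rmult_le_pos; auto; apply Q. }
  assert (Y2 : sum_n (fun n => minus (a n) (a n * s ^ n)) N <=
    minus (/ sqrt (1 - alpha)) (/ sqrt (1 - alpha * s))).
  { apply X2; [|eexists; exact Sd]; intros n; unfold minus, plus, opp; simpl.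
    specialize (Pa n); specialize (Q n); nra. }
  rewrite Y3 in Y2; unfold minus, plus, opp in Y2; simpl in Y2.
  rewrite Rabs_left1; lra. }
assert (Hs : forall t, 0 <= sin t ^ 2 <= 1).
{ intros t; split; [apply pow2_ge_0|]; pose proof (SIN_bound t); nra. }
set (P := fun N t => sum_n (fun n => a n * (sin t ^ 2) ^ n) N).
set (I := fun N => sum_n (fun n => a n * (PI / 2 * binom_half n)) N).
assert (HI : forall N, is_RInt (P N) 0 (PI / 2) (I N)).
{ assert (H1 : forall n, is_RInt (fun t => a n * (sin t ^ 2) ^ n) 0 (PI / 2)
     (a n * (PI / 2 * binom_half n))).
  { intros n; pose proof (is_RInt_scal (V := R_NormedModule) _ 0 (PI / 2) (a n) _ (wallis n)) as X.
    eapply is_RInt_ext with (2 := X); intros t _; rewrite <- pow_mult; reflexivity. }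
  induction N as [|N IH].
  - unfold I; rewrite sum_O; eapply is_RInt_ext with (2 := H1 0%nat); intros t _.
    unfold P; now rewrite sum_O.
  - unfold I; rewrite sum_Sn.
    eapply is_RInt_ext with (2 := is_RInt_plus (V := R_NormedModule) _ _ _ _ _ _ IH (H1 (S N))).
    intros t _; unfold P; now rewrite sum_Sn. }
destruct (filterlim_RInt P 0 (PI / 2) eventually _ (fun t => / sqrt (1 - alpha * sin t ^ 2)) I HI)
  as [L [L1 L2]].
- intros U [e He].
  pose proof (S1 (fun y => Rabs (y - / sqrt (1 - alpha)) < e)) as E.
  destruct E as [N HN].
  { exists e; intros y Hy; exact Hy. }
  exists N; intros n Hn; apply He; intros t.
  change (Rabs (P n t - / sqrt (1 - alpha * sin t ^ 2)) < e).
  eapply Rle_lt_trans; [apply T; auto|].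
  specialize (HN n Hn); rewrite Rabs_minus_sym in HN.
  eapply Rle_lt_trans; [apply Rle_abs|exact HN].
- apply (is_RInt_unique (V := R_CompleteNormedModule)) in L2.
  unfold ellipticF; rewrite L2; unfold ellipticK.
  rewrite hyp2F1_half; unfold PSeries; rewrite <- Series_scal_l.
  apply is_series_unique.
  eapply is_series_ext with (a := fun n => a n * (PI / 2 * binom_half n)); [|exact L1].
  intros n; unfold a; simpl; ring.
Qed.

Lemma hyp2F1_half_ge_1 (z : R) : 0 <= z < 1 -> 1 <= hyp2F1 (1 / 2) (1 / 2) 1 z.
Proof.
intros Hz; pose proof (ellipticK_ellipticF z Hz) as E; unfold ellipticK in E.
pose proof PI_RGT_0; pose proof (Defs.ellipticF_expand z 0 (PI / 2) Hz ltac:(lra)) as X.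
rewrite ellipticF_0 in X; nra.
Qed.

(** The integrands agree at t = 0, so strictness relies on a mean value point in the open interval,
    where sin t > 0. *)
Lemma ellipticF_mono_parameter (alpha beta : R) :
  0 <= alpha < beta -> beta < 1 -> ellipticF alpha (PI / 2) < ellipticF beta (PI / 2).
Proof.
intros Ha Hb; pose proof PI_RGT_0.
set (D := fun t => ellipticF beta t - ellipticF alpha t).
assert (HD : forall t, is_derive D t (Defs.g beta t - Defs.g alpha t)).
{ intros t; apply (is_derive_minus (K := R_AbsRing) (V := R_NormedModule));
    apply Defs.ellipticF_derive; lra. }
assert (Pos : forall t, 0 < t < PI / 2 -> 0 < Defs.g beta t - Defs.g alpha t).
{ intros t Ht; assert (S : 0 < sin t) by (apply sin_gt_0; lra).
  destruct (Defs.radicand_bounds beta t ltac:(lra)) as [R1 _].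
  unfold Defs.g.
  enough (/ sqrt (1 - alpha * sin t ^ 2) < / sqrt (1 - beta * sin t ^ 2)) by lra.
  apply Rinv_lt_contravar.
  - apply Rmult_lt_0_compat; apply sqrt_lt_R0; auto.
    apply Defs.radicand_bounds; lra.
  - assert (0 < sin t ^ 2) by (apply pow_lt; auto).
    apply sqrt_lt_1_alt; split; [lra|nra]. }
destruct (MVT_cor2 D (fun t => Defs.g beta t - Defs.g alpha t) 0 (PI / 2)) as [t [E Ht]].
- lra.
- intros t _; apply is_derive_Reals, HD.
- specialize (Pos t Ht); unfold D in E at 2; rewrite !ellipticF_0 in E; unfold D in E; nra.
Qed.

Lemma hyp2F1_half_increasing (alpha beta : R) :
  0 <= alpha < beta -> beta < 1 ->
  hyp2F1 (1 / 2) (1 / 2) 1 alpha < hyp2F1 (1 / 2) (1 / 2) 1 beta.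
Proof.
intros Ha Hb; pose proof (ellipticF_mono_parameter alpha beta Ha Hb) as H.
rewrite <- !ellipticK_ellipticF in H by lra; unfold ellipticK in H.
pose proof PI_RGT_0; apply Rmult_lt_reg_l with (PI / 2); lra.
Qed.

(** * Partial fractions of the hyperbolic cosecant *)

Lemma telescoping_series : is_series (fun n => / ((INR n + 1) * (INR n + 2))) 1.
Proof.
assert (E : forall n, sum_n (fun n => / ((INR n + 1) * (INR n + 2))) n = 1 - / (INR n + 2)).
{ induction n as [|n IH].
  - rewrite sum_O; simpl; field.
  - rewrite sum_Sn, IH, S_INR; unfold plus; simpl; pose proof (pos_INR n); field; lra. }
apply (is_lim_seq_ext (fun n => 1 - / (INR n + 2)) _ 1); [intros; symmetry; apply E|].
rewrite <- (Rminus_0_r 1) at 1.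
apply is_lim_seq_minus'; [apply is_lim_seq_const|].
apply (is_lim_seq_inv (fun n => INR n + 2) p_infty); [|discriminate].
apply is_lim_seq_plus with p_infty 2; [apply is_lim_seq_INR|apply is_lim_seq_const|reflexivity].
Qed.

Lemma inv_sqr_summable (t : R) : t <> 0 -> abs_summableZ (fun m => / (IZR m ^ 2 + t ^ 2)).
Proof.
intros Ht; assert (T : 0 < t ^ 2) by (rewrite <- Rsqr_pow2; now apply Rsqr_pos_lt).
(* (n + 1) (n + 2) <= 6 n^2 covers n >= 1, and 2 / t^2 covers n = 0. *)
set (C := 6 + 2 / t ^ 2).
assert (HC : 6 < C) by (unfold C; pose proof (Rdiv_lt_0_compat 2 (t ^ 2)); lra).
assert (B : forall n, / (INR n ^ 2 + t ^ 2) <= C * / ((INR n + 1) * (INR n + 2))).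
{ intros n; pose proof (pos_INR n) as P.
  apply Rmult_le_reg_r with ((INR n ^ 2 + t ^ 2) * ((INR n + 1) * (INR n + 2))); [nra|].
  replace (/ (INR n ^ 2 + t ^ 2) * ((INR n ^ 2 + t ^ 2) * ((INR n + 1) * (INR n + 2)))) with
    ((INR n + 1) * (INR n + 2)) by (field; nra).
  replace (C * / ((INR n + 1) * (INR n + 2)) * ((INR n ^ 2 + t ^ 2) * ((INR n + 1) * (INR n + 2))))
    with (C * INR n ^ 2 + C * t ^ 2) by (field; nra).
  assert (C * t ^ 2 = 6 * t ^ 2 + 2) by (unfold C; field; lra).
  destruct n as [|n]; [simpl; lra|].
  rewrite S_INR in *; pose proof (pos_INR n); nra. }
assert (SC : ex_series (fun n => C * / ((INR n + 1) * (INR n + 2)))).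
{ apply (ex_series_scal_l C (fun n => / ((INR n + 1) * (INR n + 2)))).
  eexists; apply telescoping_series. }
assert (E : ex_series (fun n => / (INR n ^ 2 + t ^ 2))).
{ apply (@ex_series_le R_AbsRing R_CompleteNormedModule) with (2 := SC).
  intros n; unfold norm; simpl; unfold abs; simpl; rewrite Rabs_pos_eq; [apply B|].
  left; apply Rinv_0_lt_compat; pose proof (pow2_ge_0 (INR n)); simpl in *; lra. }
split.
- eapply ex_series_ext with (2 := E); intros n; cbv beta; rewrite INR_IZR_INZ.
  rewrite Rabs_pos_eq; auto; left; apply Rinv_0_lt_compat.
  pose proof (pow2_ge_0 (IZR (Z.of_nat n))); lra.
- apply (@ex_series_incr_1 R_AbsRing R_NormedModule) in E.
  eapply ex_series_ext with (2 := E); intros n; cbv beta; rewrite INR_IZR_INZ, opp_IZR.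
  replace ((- IZR (Z.of_nat (S n))) ^ 2) with (IZR (Z.of_nat (S n)) ^ 2) by ring.
  rewrite Rabs_pos_eq; auto; left; apply Rinv_0_lt_compat.
  pose proof (pow2_ge_0 (IZR (Z.of_nat (S n)))); lra.
Qed.

Lemma is_RInt_sumZ (lo hi : Z) (f : Z -> R -> R) (l : Z -> R) (a b : R) :
  (forall k, is_RInt (f k) a b (l k)) ->
  is_RInt (fun y => sumZ lo hi (fun k => f k y)) a b (sumZ lo hi l).
Proof.
intros H; unfold sumZ; induction (seq 0 (Z.to_nat (hi - lo))) as [|i s IH]; simpl.
- pose proof (is_RInt_const (V := R_NormedModule) a b 0) as X.
  change (is_RInt (fun _ => 0) a b ((b - a) * 0)) in X; rewrite Rmult_0_r in X; exact X.
- apply (is_RInt_plus (V := R_NormedModule)); auto.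
Qed.

Lemma sin_IZR_PI (m : Z) : sin (IZR m * PI) = 0.
Proof.
pose proof (sin2_cos2 (IZR m * PI)) as E; rewrite cos_IZR_PI in E; unfold Rsqr, parity_sign in E.
destruct Z.odd; nra.
Qed.

Lemma is_RInt_cosh_cos (t : R) (m : Z) :
  t <> 0 ->
  is_RInt (fun y => cosh (t * y) * cos (IZR m * y)) 0 PI
    (t * sinh (PI * t) * (parity_sign m * / (IZR m ^ 2 + t ^ 2))).
Proof.
intros Ht; assert (T : 0 < t ^ 2) by (rewrite <- Rsqr_pow2; now apply Rsqr_pos_lt).
pose proof (pow2_ge_0 (IZR m)) as M.
set (P := fun y => (t * sinh (t * y) * cos (IZR m * y) + IZR m * cosh (t * y) * sin (IZR m * y))
  / (IZR m ^ 2 + t ^ 2)).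
assert (D : forall y, is_derive P y (cosh (t * y) * cos (IZR m * y))).
{ intros y; unfold P, cosh, sinh; auto_derive; auto; field; lra. }
replace (t * sinh (PI * t) * (parity_sign m * / (IZR m ^ 2 + t ^ 2))) with (minus (P PI) (P 0)).
- apply (is_RInt_derive P); [auto|]; intros y _.
  apply (ex_derive_continuous (K := R_AbsRing) (V := R_NormedModule)).
  unfold cosh; auto_derive; auto.
- unfold minus, plus, opp, P; simpl; rewrite cos_IZR_PI, sin_IZR_PI, !Rmult_0_r, sin_0, sinh_0.
  rewrite (Rmult_comm PI); simpl in *; field; lra.
Qed.

Lemma is_RInt_cos (m : Z) :
  is_RInt (fun y => cos (IZR m * y)) 0 PI (if Z.eq_dec m 0 then PI else 0).
Proof.
destruct Z.eq_dec as [->|N].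
- apply is_RInt_ext with (fun _ => 1); [intros; now rewrite Rmult_0_l, cos_0|].
  replace PI with (scal (PI - 0) 1) at 2 by (unfold scal; simpl; unfold mult; simpl; ring).
  apply (is_RInt_const (V := R_NormedModule)).
- apply eq_IZR_contrapositive in N.
  replace 0 with (minus (sin (IZR m * PI) / IZR m) (sin (IZR m * 0) / IZR m)) at 2.
  + apply (is_RInt_derive (fun y => sin (IZR m * y) / IZR m)); intros y _.
    * auto_derive; auto; field; auto.
    * apply (ex_derive_continuous (K := R_AbsRing) (V := R_NormedModule)); auto_derive; auto.
  + rewrite sin_IZR_PI, Rmult_0_r, sin_0; unfold minus, plus, opp; simpl; field; auto.
Qed.

(** Multiplied through by 1 - cos y, which avoids the division at y = 0 and makes the sum of these
    kernels in [fejer_kernel] telescope. *)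
Lemma dirichlet_kernel (y : R) (n : nat) :
  (1 - cos y) * symsum (fun m => cos (IZR m * y)) (S n) = cos (INR n * y) - cos (INR (S n) * y).
Proof.
induction n as [|n IH].
- unfold sumZ; simpl; rewrite !Rmult_0_l, cos_0, Rmult_1_l; ring.
- rewrite symsum_S, opp_IZR, <- INR_IZR_INZ, Ropp_mult_distr_l_reverse, cos_neg by lia.
  rewrite !Rmult_plus_distr_l, IH, !S_INR.
  replace ((INR n + 1 + 1) * y) with ((INR n + 1) * y + y) by ring.
  replace (INR n * y) with ((INR n + 1) * y - y) by ring.
  rewrite cos_plus, cos_minus; ring.
Qed.

Lemma fejer_kernel (y : R) (n : nat) :
  (1 - cos y) * sum_f_R0 (fun n => symsum (fun m => cos (IZR m * y)) (S n)) n =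
  1 - cos (INR (S n) * y).
Proof.
induction n as [|n IH].
- cbn [sum_f_R0]; rewrite dirichlet_kernel; simpl; now rewrite Rmult_0_l, cos_0.
- cbn [sum_f_R0]; rewrite Rmult_plus_distr_l, IH, dirichlet_kernel; ring.
Qed.

(** Since cos >= 1/2 on [0, PI / 4], sin (y / 4) >= y / 8, and doubling the angle gives sin (y / 2)
    >= y / 8. Then 1 - cos y = 2 sin^2 (y / 2) yields the constant 32. *)
Lemma one_minus_cos_ge (y : R) : 0 <= y <= PI -> y ^ 2 / 32 <= 1 - cos y.
Proof.
intros Hy; pose proof PI_RGT_0 as Hpi.
assert (S2 : 1 / 2 < cos (PI / 4)).
{ pose proof (cos_PI3); rewrite <- H; apply cos_decreasing_1; lra. }
assert (C : forall z, 0 <= z <= PI / 4 -> 1 / 2 <= cos z).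
{ intros z Hz; apply Rle_trans with (cos (PI / 4)); [lra|]; apply cos_decr_1; lra. }
assert (S4 : y / 8 <= sin (y / 4)).
{ destruct (is_derive_MVT sin cos 0 (y / 4)) as [z [Hz E]].
  { intros z _; auto_derive; auto; ring. }
  rewrite sin_0, !Rminus_0_r in E; rewrite !Rminus_0_r in Hz.
  assert (1 / 2 <= cos z).
  { destruct (Rle_dec 0 z).
    - apply C; rewrite !Rabs_pos_eq in Hz; lra.
    - rewrite <- cos_neg; apply C; rewrite Rabs_left, Rabs_pos_eq in Hz; lra. }
  nra. }
assert (S' : y / 8 <= sin (y / 2)).
{ replace (y / 2) with (2 * (y / 4)) by field; rewrite sin_2a.
  specialize (C (y / 4) ltac:(lra)); nra. }
replace (cos y) with (cos (2 * (y / 2))) by (f_equal; field).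
rewrite cos_2a_sin; nra.
Qed.

Lemma cosh_minus_1_le (x M : R) : Rabs x <= M -> 0 <= cosh x - 1 <= x ^ 2 * exp M.
Proof.
intros Hx; split; [pose proof (cosh_ge_1 x); lra|].
destruct (is_derive_MVT cosh sinh 0 x) as [z [Hz E]]; [intros; apply is_derive_cosh|].
destruct (is_derive_MVT sinh cosh 0 z) as [w [Hw E']]; [intros; apply is_derive_sinh|].
rewrite cosh_0, sinh_0, !Rminus_0_r in *; rewrite E, E'.
assert (C : cosh w <= exp M).
{ unfold cosh; pose proof (Rle_abs w); pose proof (Rle_abs (- w)) as A; rewrite Rabs_Ropp in A.
  pose proof (exp_le_compat w M ltac:(lra)); pose proof (exp_le_compat (- w) M ltac:(lra)); lra. }
pose proof (cosh_ge_1 w) as C1.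
replace (cosh w * z * x) with (cosh w * (z * x)) by ring.
assert (Z : z * x <= x ^ 2).
{ eapply Rle_trans; [apply Rle_abs|]; rewrite Rabs_mult, <- pow2_abs.
  pose proof (Rabs_pos x); nra. }
pose proof (pow2_ge_0 x); nra.
Qed.

(* [t sinh(PI t) (-1)^m / (m^2 + t^2)] are the Fourier coefficients of [cosh (t y)]. The partial
   sums at [0] for [cosh (t y) - 1] converge, so it suffices that their Cesaro means vanish,
   which holds since [cosh (t y) - 1] is dominated by [1 - cos y] and the Fejer kernel is
   [(1 - cos (n y)) / (1 - cos y)]. *)
Lemma csch_partial_fractions (t : R) :
  t <> 0 ->
  SeriesZ (fun m => parity_sign m * / (IZR m ^ 2 + t ^ 2)) = PI / (t * sinh (PI * t)).
Proof.
intros Ht; pose proof PI_RGT_0 as Hpi.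
assert (Hs : t * sinh (PI * t) <> 0).
{ apply Rmult_integral_contrapositive; split; auto; apply sinh_neq0.
  apply Rmult_integral_contrapositive; split; lra. }
set (u := fun m => parity_sign m * / (IZR m ^ 2 + t ^ 2)).
assert (Su : abs_summableZ u).
{ apply abs_summableZ_le with (fun m => Rabs (/ (IZR m ^ 2 + t ^ 2))).
  - intros k; unfold u; rewrite Rabs_mult; unfold parity_sign; destruct Z.odd.
    + rewrite (Rabs_left (-1)) by lra; lra.
    + rewrite Rabs_R1; lra.
  - now apply abs_summableZ_abs, inv_sqr_summable. }
(* Cosine integrals of cosh (t y) - 1; the claim is that they sum to 0. *)
set (b := fun m => t * sinh (PI * t) * u m + -1 * (if Z.eq_dec m 0 then PI else 0)).
destruct (SeriesZ_delta 0 PI) as [D1 D2].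
assert (Sb : abs_summableZ b) by (unfold b; auto using abs_summableZ_plus, abs_summableZ_scal).
assert (Eb : SeriesZ b = t * sinh (PI * t) * SeriesZ u - PI).
{ unfold b; rewrite SeriesZ_plus, !SeriesZ_scal, D2 by auto using abs_summableZ_scal; ring. }
set (H := fun y => cosh (t * y) - 1).
assert (Ib : forall m, is_RInt (fun y => H y * cos (IZR m * y)) 0 PI (b m)).
{ intros m.
  pose proof (is_RInt_minus (V := R_NormedModule) _ _ _ _ _ _ (is_RInt_cosh_cos t m Ht)
    (is_RInt_cos m)) as X.
  replace (b m) with (minus (t * sinh (PI * t) * (parity_sign m * / (IZR m ^ 2 + t ^ 2)))
    (if Z.eq_dec m 0 then PI else 0))
    by (unfold b, u, minus, plus, opp; simpl; destruct Z.eq_dec; ring).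
  eapply is_RInt_ext with (2 := X); intros y _; unfold H, minus, plus, opp; simpl; ring. }
set (K := fun n y => sum_f_R0 (fun n => symsum (fun m => cos (IZR m * y)) (S n)) n).
assert (IK : forall n, is_RInt (fun y => H y * K n y) 0 PI (sum_f_R0 (fun n => symsum b (S n)) n)).
{ assert (I1 : forall n, is_RInt (fun y => H y * symsum (fun m => cos (IZR m * y)) n) 0 PI
    (symsum b n)).
  { intros n; eapply is_RInt_ext with (2 := is_RInt_sumZ _ _ _ _ _ _ Ib).
    intros y _; cbv beta; apply sumZ_scal. }
  induction n as [|n IH]; [apply (I1 1%nat)|].
  eapply is_RInt_ext with (2 := is_RInt_plus (V := R_NormedModule) _ _ _ _ _ _ IH (I1 (S (S n)))).
  intros y _; unfold K; cbn [sum_f_R0]; unfold plus; cbn -[sumZ]; ring. }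
set (C := 32 * (t ^ 2 * exp (Rabs t * PI))).
assert (HC : forall n y, 0 <= y <= PI -> Rabs (H y * K n y) <= 2 * C).
{ intros n y Hy.
  assert (B : 0 <= H y <= C * (1 - cos y)).
  { assert (A : Rabs (t * y) <= Rabs t * PI).
    { rewrite Rabs_mult, (Rabs_pos_eq y) by lra; pose proof (Rabs_pos t); nra. }
    destruct (cosh_minus_1_le (t * y) _ A) as [B1 B2]; split; auto.
    eapply Rle_trans; [exact B2|]; unfold C.
    pose proof (one_minus_cos_ge y Hy); pose proof (exp_pos (Rabs t * PI)).
    rewrite Rpow_mult_distr.
    assert (0 <= t ^ 2 * exp (Rabs t * PI)) by (apply Rmult_le_pos; [apply pow2_ge_0|lra]).
    nra. }
  pose proof (fejer_kernel y n) as F; fold (K n y) in F.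
  pose proof (COS_bound (INR (S n) * y)); pose proof (COS_bound y).
  assert (C0 : 0 <= C).
  { unfold C; apply Rmult_le_pos; [lra|]; apply Rmult_le_pos; [apply pow2_ge_0|].
    apply Rlt_le, exp_pos. }
  (* Where 1 - cos y = 0 the Fejer identity says nothing about the kernel, but there H vanishes. *)
  destruct (Req_dec (1 - cos y) 0) as [Z|Z].
  - assert (Z' : H y = 0) by nra; rewrite Z', Rmult_0_l, Rabs_R0; lra.
  - assert (0 <= K n y) by nra.
    rewrite Rabs_pos_eq by (apply Rmult_le_pos; lra).
    apply Rle_trans with (C * ((1 - cos y) * K n y)); [nra|rewrite F; nra]. }
assert (Bd : forall n, Rabs (sum_f_R0 (fun n => symsum b (S n)) n) <= 2 * C * PI).
{ intros n; replace (2 * C * PI) with ((PI - 0) * (2 * C)) by ring.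
  apply (norm_RInt_le_const (V := R_NormedModule) (fun y => H y * K n y) 0 PI _ (2 * C));
    [lra| |apply IK].
  intros y Hy; now apply HC. }
assert (L : is_lim_seq (fun n => symsum b (S n)) (SeriesZ b)).
{ apply (is_lim_seq_incr_1 (fun n => symsum b n)); now apply symsum_lim. }
apply is_lim_seq_Reals, Cesaro_1, is_lim_seq_Reals in L.
assert (L0 : is_lim_seq (fun n => sum_f_R0 (fun n => symsum b (S n)) (pred n) / INR n) 0).
{ apply is_lim_seq_abs_0.
  apply is_lim_seq_le_le_loc with (fun _ => 0) (fun n => 2 * C * PI * / INR n).
  - exists 1%nat; intros n Hn; assert (0 < INR n) by (apply lt_0_INR; lia).
    split; [apply Rabs_pos|]; unfold Rdiv; rewrite Rabs_mult, Rabs_inv, (Rabs_pos_eq (INR n)) by lra.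
    apply Rmult_le_compat_r; auto; now apply Rlt_le, Rinv_0_lt_compat.
  - apply is_lim_seq_const.
  - replace (Finite 0) with (Rbar_mult (2 * C * PI) 0) by (simpl; f_equal; ring).
    apply is_lim_seq_scal_l.
    apply (is_lim_seq_inv INR p_infty); [apply is_lim_seq_INR|discriminate]. }
apply is_lim_seq_unique in L, L0; rewrite L in L0; injection L0 as E.
apply Rmult_eq_reg_l with (t * sinh (PI * t)); auto.
replace (t * sinh (PI * t) * (PI / (t * sinh (PI * t)))) with PI; [lra|].
field; split; auto; intros Z; apply Hs; rewrite Z; ring.
Qed.

(** * The finite Fourier transform *)

Definition csch_rate (alpha : R) : R :=
  PI * hyp2F1 (1 / 2) (1 / 2) 1 (1 - alpha) / hyp2F1 (1 / 2) (1 / 2) 1 alpha.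

Lemma csch_rate_pos (alpha : R) : 0 < alpha < 1 -> 0 < csch_rate alpha.
Proof.
intros Ha; pose proof (hyp2F1_half_ge_1 alpha ltac:(lra)).
pose proof (hyp2F1_half_ge_1 (1 - alpha) ltac:(lra)); pose proof PI_RGT_0.
apply Rdiv_lt_0_compat; [apply Rmult_lt_0_compat|]; lra.
Qed.

(* [c / PI] is the ratio [K'/K] both for [alpha] and for the parameter [beta] attached to [c];
   this ratio is strictly decreasing. *)
Lemma comp_modulus_csch_rate (alpha : R) :
  0 < alpha < 1 -> 1 - comp_modulus (csch_rate alpha) ^ 2 = alpha.
Proof.
intros Ha; pose proof (csch_rate_pos alpha Ha) as Hc; set (c := csch_rate alpha) in *.
set (h := hyp2F1 (1 / 2) (1 / 2) 1); set (q := comp_modulus c ^ 2).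
assert (Hq : 0 < q < 1) by (apply sqr_unit_interval, comp_modulus_bounds; auto).
pose proof (ellipticF_PI2_comp c Hc) as E1; pose proof (ellipticF_PI2 c Hc) as E2; fold q in E1, E2.
rewrite <- ellipticK_ellipticF in E1, E2 by lra; unfold ellipticK in E1, E2.
fold h in E1, E2.
pose proof PI_RGT_0 as Hpi; pose proof (dn_scale_pos c Hc) as Hm.
assert (P : forall y, 0 < y < 1 -> 1 <= h y) by (intros y Hy; apply hyp2F1_half_ge_1; lra).
assert (M : forall y z, 0 < y < z -> z < 1 -> h y < h z)
  by (intros; apply hyp2F1_half_increasing; lra).
assert (E : h q * h alpha = h (1 - alpha) * h (1 - q)).
{ assert (Ec : c * h alpha = PI * h (1 - alpha)).
  { unfold c, csch_rate; fold h; field; specialize (P alpha Ha); lra. }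
  apply Rmult_eq_reg_l with (PI / 2 * PI); [|nra].
  transitivity (PI * (PI / 2 * h q) * h alpha); [ring|].
  transitivity (PI / 2 * h (1 - q) * (PI * h (1 - alpha))); [|ring].
  rewrite E1, E2, <- Ec; ring. }
pose proof (P alpha Ha); pose proof (P q Hq).
pose proof (P (1 - alpha) ltac:(lra)); pose proof (P (1 - q) ltac:(lra)).
destruct (Rtotal_order (1 - q) alpha) as [L|[L|L]]; auto; exfalso.
- pose proof (M (1 - q) alpha ltac:(lra) ltac:(lra)).
  pose proof (M (1 - alpha) q ltac:(lra) ltac:(lra)); nra.
- pose proof (M alpha (1 - q) ltac:(lra) ltac:(lra)).
  pose proof (M q (1 - alpha) ltac:(lra) ltac:(lra)); nra.
Qed.

Lemma ln_jacobi_dn (alpha v : R) :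
  0 < alpha < 1 ->
  ln (jacobi_dn alpha (v * ellipticK alpha / PI)) = log_dn (csch_rate alpha) v.
Proof.
intros Ha; pose proof (csch_rate_pos alpha Ha) as Hc; set (c := csch_rate alpha) in *.
pose proof (comp_modulus_csch_rate alpha Ha) as E; fold c in E.
pose proof (ellipticF_PI2_comp c Hc) as E1; rewrite E, <- ellipticK_ellipticF in E1 by lra.
rewrite E1, <- E; pose proof PI_RGT_0.
replace (v * (dn_scale c * PI) / PI) with (dn_scale c * v) by (field; lra).
rewrite jacobi_dn_log_dn, ln_exp; auto.
Qed.

(** * Cosine sums over odd multiples of PI / a, and the final comparison *)

Lemma powerRZ_parity (k : Z) : powerRZ (-1) k = parity_sign k.
Proof.
assert (E : forall n, (-1) ^ n = parity_sign (Z.of_nat n)).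
{ induction n as [|n IH]; [reflexivity|].
  rewrite Nat2Z.inj_succ; unfold Z.succ; rewrite parity_sign_add, <- IH.
  unfold parity_sign; simpl; ring. }
destruct (Z_le_dec 0 k) as [H|H].
- rewrite <- (Z2Nat.id k), <- pow_powerRZ by lia; apply E.
- rewrite <- (Z.opp_involutive k), parity_sign_opp, powerRZ_neg' .
  rewrite <- (Z2Nat.id (- k)), <- pow_powerRZ, E by lia.
  unfold parity_sign; destruct Z.odd; field.
Qed.

Definition odd_cos_sum (a n : Z) : R :=
  sumZ 0 a (fun j => cos (IZR n * ((2 * IZR j + 1) * PI / IZR a))).

Lemma odd_cos_sum_opp (a n : Z) : odd_cos_sum a (- n) = odd_cos_sum a n.
Proof.
apply sumZ_ext; intros j _; rewrite opp_IZR, Ropp_mult_distr_l_reverse; apply cos_neg.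
Qed.

Lemma odd_cos_sum_multiple (a n : Z) :
  (0 < a)%Z -> odd_cos_sum a (a * n) = IZR a * parity_sign n.
Proof.
intros Ha; assert (0 < IZR a) by now apply IZR_lt.
unfold odd_cos_sum; rewrite (sumZ_ext _ _ _ (fun _ => parity_sign n)).
- assert (G : forall hi, (0 <= hi)%Z -> sumZ 0 hi (fun _ => parity_sign n) = IZR hi * parity_sign n).
  { apply sumZ_ind.
    - rewrite sumZ_nil by lia; ring.
    - intros hi Hhi IH; rewrite sumZ_succ_r, IH, plus_IZR by lia; ring. }
  apply G; lia.
- intros j _; replace (IZR (a * n) * ((2 * IZR j + 1) * PI / IZR a)) with
    (IZR (n + 2 * (n * j)) * PI).
  + rewrite cos_IZR_PI, parity_sign_add; unfold parity_sign at 2.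
    rewrite Z.odd_mul; simpl; ring.
  + rewrite plus_IZR, !mult_IZR; field; lra.
Qed.

(** With th = n PI / a, multiplication by 2 sin th makes the sum telescope to sin (2 n PI) = 0, and
    sin th = 0 would mean that a divides n. *)
Lemma odd_cos_sum_0 (a n : Z) : (0 < a)%Z -> ~ (a | n)%Z -> odd_cos_sum a n = 0.
Proof.
intros Ha Hn; assert (A : 0 < IZR a) by now apply IZR_lt.
set (th := IZR n * PI / IZR a).
assert (G : forall hi, (0 <= hi)%Z ->
  2 * sin th * sumZ 0 hi (fun j => cos (IZR n * ((2 * IZR j + 1) * PI / IZR a))) =
  sin (2 * IZR hi * th)).
{ apply sumZ_ind.
  - rewrite sumZ_nil by lia; rewrite !Rmult_0_r, Rmult_0_l, sin_0; ring.
  - intros hi Hhi IH; rewrite sumZ_succ_r, Rmult_plus_distr_l, IH, plus_IZR by lia.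
    replace (IZR n * ((2 * IZR hi + 1) * PI / IZR a)) with (2 * IZR hi * th + th)
      by (unfold th; field; lra).
    replace (2 * (IZR hi + 1) * th) with ((2 * IZR hi * th + th) + th) by ring.
    replace (2 * IZR hi * th) with ((2 * IZR hi * th + th) - th) at 1 by ring.
    rewrite sin_minus, (sin_plus (2 * IZR hi * th + th) th); ring. }
specialize (G a ltac:(lia)).
replace (2 * IZR a * th) with (IZR (2 * n) * PI) in G
  by (rewrite mult_IZR; unfold th; field; lra).
rewrite sin_IZR_PI in G.
destruct (Req_dec (sin th) 0) as [S|S].
- exfalso; apply Hn; destruct (sin_eq_0_0 _ S) as [m Hm]; exists m; apply eq_IZR.
  rewrite mult_IZR; unfold th in Hm; pose proof PI_RGT_0.
  apply Rmult_eq_reg_r with (PI / IZR a).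
  + transitivity (IZR n * PI / IZR a); [field; lra|]; rewrite Hm; field; lra.
  + apply Rgt_not_eq, Rdiv_lt_0_compat; lra.
- apply Rmult_integral in G; destruct G as [G|G]; [lra|exact G].
Qed.

Lemma odd_cos_sum_bound (a n : Z) : (0 <= a)%Z -> Rabs (odd_cos_sum a n) <= IZR a.
Proof.
intros Ha; eapply Rle_trans; [apply sumZ_Rabs|].
eapply Rle_trans; [apply sumZ_le with (h := fun _ => 1)|].
- intros k; apply Rabs_le, COS_bound.
- revert a Ha; apply sumZ_ind.
  + rewrite sumZ_nil by lia; lra.
  + intros hi Hhi IH; rewrite sumZ_succ_r, plus_IZR by lia; lra.
Qed.

Lemma symsum_multiples (f : Z -> R) (a N : nat) :
  (1 <= a)%nat -> (1 <= N)%nat -> (forall k, ~ (Z.of_nat a | k)%Z -> f k = 0) ->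
  symsum f (a * N) = symsum (fun n => f (Z.of_nat a * n)%Z) N.
Proof.
intros Ha HN H0.
assert (G : forall n k, (Z.of_nat (a * n) < Z.abs k < Z.of_nat (a * n + a))%Z -> f k = 0).
{ intros n k Hk; apply H0; intros [p ->]; rewrite Z.abs_mul, !Nat2Z.inj_add, Nat2Z.inj_mul in Hk.
  rewrite (Z.abs_eq (Z.of_nat a)) in Hk by lia.
  assert (Z.of_nat n < Z.abs p < Z.of_nat n + 1)%Z by nia; lia. }
induction HN as [|N HN IH].
- rewrite (symsum_finite f 1 (a * 1)) by (try (intros; apply (G O)); lia).
  unfold sumZ; simpl; do 2 f_equal; lia.
- rewrite (symsum_S (fun n => f (Z.of_nat a * n)%Z)), <- IH by auto.
  replace (a * S N)%nat with (a * N + a)%nat by lia.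
  assert (1 <= S (a * N) <= a * N + a)%nat by lia.
  assert (forall k, (Z.of_nat (S (a * N)) <= Z.abs k < Z.of_nat (a * N + a))%Z -> f k = 0).
  { intros k Hk; apply (G N); rewrite Nat2Z.inj_succ in Hk; lia. }
  rewrite (symsum_finite f (S (a * N)) (a * N + a)) by auto.
  rewrite symsum_S by nia; do 2 f_equal; [f_equal|]; f_equal; lia.
Qed.

(** The sum over |n| < N of the terms at a n is the symmetric partial sum of f over |k| < a N, so it
    runs through a subsequence. *)
Lemma SeriesZ_multiples_lim (f : Z -> R) (a : Z) :
  (0 < a)%Z -> (forall k, ~ (a | k)%Z -> f k = 0) -> abs_summableZ f ->
  is_lim_seq (fun N => symsum (fun n => f (a * n)%Z) N) (SeriesZ f).
Proof.
intros Ha H0 Hf.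
assert (L : is_lim_seq (fun N => symsum f (Z.to_nat a * N)) (SeriesZ f)).
{ apply (is_lim_seq_subseq (fun N => symsum f N) (SeriesZ f) (fun N => (Z.to_nat a * N)%nat)).
  - apply eventually_subseq; intros n; nia.
  - now apply symsum_lim. }
apply is_lim_seq_ext_loc with (2 := L); exists 1%nat; intros N HN.
rewrite symsum_multiples; rewrite ?Z2Nat.id; auto; lia.
Qed.

(* The discrete Fourier transform over the odd multiples of [PI / a] picks from the cosine series
   of [log dn] the frequencies congruent to [b] or [- b] modulo [a]. *)
Lemma log_dn_odd_sum (c : R) (a b : Z) :
  0 < c -> (0 < a)%Z -> ~ (a | b)%Z ->
  let t := fun k => odd_csch c k * / IZR k in
  abs_summableZ (fun k => t (k + b)%Z * odd_cos_sum a k) /\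
  sumZ 0 a (fun j => cos (IZR b * ((2 * IZR j + 1) * PI / IZR a)) *
    log_dn c ((2 * IZR j + 1) * PI / IZR a)) =
  SeriesZ (fun k => t (k + b)%Z * odd_cos_sum a k).
Proof.
intros Hc Ha Hb t.
set (v := fun j => (2 * IZR j + 1) * PI / IZR a).
assert (St : abs_summableZ t) by (apply (subexp_summable c); auto; now apply odd_csch_div_subexp).
assert (SO : forall g, abs_summableZ (fun k => t k * odd_cos_sum a (g k))).
{ intros g; apply abs_summableZ_le with (fun k => IZR a * Rabs (t k)).
  - intros k; rewrite Rabs_mult, Rmult_comm; apply Rmult_le_compat_r; [apply Rabs_pos|].
    apply odd_cos_sum_bound; lia.
  - now apply abs_summableZ_scal, abs_summableZ_abs. }
assert (teven : forall k, t (- k)%Z = t k).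
{ intros k; unfold t; rewrite odd_csch_opp, opp_IZR, Rinv_opp; ring. }
destruct (SeriesZ_shift _ b (SO (fun k => (k - b)%Z))) as [H1 H2].
assert (E : forall k, t (k + b)%Z * odd_cos_sum a (k + b - b) = t (k + b)%Z * odd_cos_sum a k).
{ intros k; do 2 f_equal; lia. }
split; [now apply abs_summableZ_ext with (1 := E)|].
rewrite <- (SeriesZ_ext _ _ E), H2.
set (u := fun j k => cos (IZR b * v j) * (t k * (cos (IZR k * v j) - 1))).
assert (Su : forall j, abs_summableZ (u j)).
{ intros j; apply abs_summableZ_scal.
  apply (log_series_summable c (-1) _ _ _ (v j) Hc trigonometric_family Hc). }
destruct (SeriesZ_sumZ 0 a u Su) as [_ U].
transitivity (SeriesZ (fun k => sumZ 0 a (fun j => u j k))).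
{ rewrite U; apply sumZ_ext; intros j _; unfold u; rewrite SeriesZ_scal; reflexivity. }
(* The product of cosines splits into frequencies b + k and b - k, which contribute equally since t
   is even. The term - 1 in the logarithmic series contributes [odd_cos_sum a b], which is 0 as a
   does not divide b. *)
rewrite (SeriesZ_ext _ (fun k => / 2 * (t k * odd_cos_sum a (b + k)) +
   / 2 * (t k * odd_cos_sum a (b - k)))).
- rewrite SeriesZ_plus, !SeriesZ_scal by auto using abs_summableZ_scal.
  assert (R1 : SeriesZ (fun k => t k * odd_cos_sum a (b + k)) =
    SeriesZ (fun k => t k * odd_cos_sum a (k - b))).
  { rewrite <- SeriesZ_opp by auto; apply SeriesZ_ext; intros k.
    rewrite teven, <- odd_cos_sum_opp; do 2 f_equal; lia. }
  assert (R2 : SeriesZ (fun k => t k * odd_cos_sum a (b - k)) =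
    SeriesZ (fun k => t k * odd_cos_sum a (k - b))).
  { apply SeriesZ_ext; intros k; rewrite <- odd_cos_sum_opp; do 2 f_equal; lia. }
  rewrite R1, R2; field.
- intros k.
  transitivity (t k * (/ 2 * odd_cos_sum a (b + k) + (/ 2 * odd_cos_sum a (b - k) +
    -1 * odd_cos_sum a b))).
  + unfold odd_cos_sum; rewrite <- !sumZ_scal, <- !sumZ_plus, <- sumZ_scal.
    apply sumZ_ext; intros j _; unfold u; fold (v j).
    rewrite plus_IZR, minus_IZR, Rmult_plus_distr_r, Rmult_minus_distr_r, cos_plus, cos_minus; field.
  + rewrite (odd_cos_sum_0 a b Ha Hb); ring.
Qed.

Lemma F_term_eq (a b n m : Z) (x : R) :
  0 < x -> (a * n + b <> 0)%Z ->
  F_term a b x n m =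
  parity_sign n / x ^ 2 * (parity_sign m * / (IZR m ^ 2 + (IZR (a * n + b) / x) ^ 2)).
Proof.
intros Hx Hk; unfold F_term; rewrite powerRZ_parity, parity_sign_add.
apply eq_IZR_contrapositive in Hk; set (k := IZR (a * n + b)) in *.
assert (0 < k ^ 2) by (rewrite <- Rsqr_pow2; now apply Rsqr_pos_lt).
pose proof (pow2_ge_0 (IZR m)); pose proof (pow2_ge_0 (x * IZR m)).
field; repeat split; try lra; rewrite <- ?Rpow_mult_distr; nra.
Qed.

Lemma F_term_summable (a b n : Z) (x : R) :
  0 < x -> (a * n + b <> 0)%Z -> abs_summableZ (F_term a b x n).
Proof.
intros Hx Hk.
eapply abs_summableZ_ext; [intros m; symmetry; now apply F_term_eq|].
apply abs_summableZ_scal.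
apply abs_summableZ_le with (fun m => Rabs (/ (IZR m ^ 2 + (IZR (a * n + b) / x) ^ 2))).
- intros m; rewrite Rabs_mult; unfold parity_sign; destruct Z.odd.
  + rewrite (Rabs_left (-1)) by lra; lra.
  + rewrite Rabs_R1; lra.
- apply abs_summableZ_abs, inv_sqr_summable.
  apply eq_IZR_contrapositive in Hk.
  apply Rmult_integral_contrapositive; split; auto; apply Rinv_neq_0_compat; lra.
Qed.

Lemma F_term_SeriesZ (a b n : Z) (x : R) :
  0 < x -> (a * n + b <> 0)%Z ->
  SeriesZ (F_term a b x n) =
  PI / x * (parity_sign n * (/ sinh (IZR (a * n + b) * (PI / x)) * / IZR (a * n + b))).
Proof.
intros Hx Hk; rewrite (SeriesZ_ext _ _ (fun m => F_term_eq a b n m x Hx Hk)).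
pose proof PI_RGT_0 as Hpi.
pose proof (IZR_mul_neq0 _ (PI / x) ltac:(now apply Rdiv_lt_0_compat) Hk) as S.
apply sinh_neq0 in S; apply eq_IZR_contrapositive in Hk.
rewrite SeriesZ_scal, csch_partial_fractions.
- replace (PI * (IZR (a * n + b) / x)) with (IZR (a * n + b) * (PI / x)) by (field; lra).
  field; repeat split; auto; lra.
- apply Rmult_integral_contrapositive; split; auto; apply Rinv_neq_0_compat; lra.
Qed.

Theorem theorem4p1 (alpha x : R) (a b : Z) :
  0 < alpha < 1 ->
  x = hyp2F1 (1/2) (1/2) 1 alpha / hyp2F1 (1/2) (1/2) 1 (1 - alpha) ->
  (2 <= a)%Z -> Z.Even a -> Z.gcd a b = 1%Z ->
  F_converges a b x /\
  F a b x =
    PI / (IZR a * x) *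
    sumZ 0 a (fun j =>
      cos (PI * (2 * IZR j + 1) * IZR b / IZR a) *
      ln (jacobi_dn alpha ((2 * IZR j + 1) * ellipticK alpha / IZR a))).
Proof.
intros Halpha Hx Ha Heven Hgcd.
pose proof PI_RGT_0 as Hpi; assert (HaR : 0 < IZR a) by (apply IZR_lt; lia).
pose proof (hyp2F1_half_ge_1 alpha ltac:(lra)) as H1.
pose proof (hyp2F1_half_ge_1 (1 - alpha) ltac:(lra)) as H2.
assert (Hx0 : 0 < x) by (rewrite Hx; apply Rdiv_lt_0_compat; lra).
assert (Hc : csch_rate alpha = PI / x) by (unfold csch_rate; rewrite Hx; field; lra).
assert (Hc0 : 0 < PI / x) by now apply Rdiv_lt_0_compat.
assert (Hab : ~ (a | b)%Z).
{ intros D; assert (D' : (a | 1)%Z) by (rewrite <- Hgcd; now apply Z.gcd_greatest; [exists 1%Z; lia|]).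
  apply Z.divide_1_r in D'; lia. }
(* Oddness of a n + b keeps the denominators of F away from 0 and makes [odd_ind] equal to 1 at
   every frequency that F meets. *)
assert (Hodd : forall n, Z.odd (a * n + b) = true).
{ destruct Heven as [p Hp]; intros n.
  assert (Hb : Z.odd b = true).
  { destruct (Z.odd b) eqn:O; auto; exfalso.
    rewrite <- Z.negb_even in O; apply Bool.negb_false_iff, Z.even_spec in O.
    destruct O as [r Hr].
    assert (D : (2 | 1)%Z) by (rewrite <- Hgcd; apply Z.gcd_greatest; [exists p|exists r]; lia).
    apply Z.divide_1_r in D; lia. }
  rewrite Z.odd_add, Z.odd_mul, Hb, Hp, Z.odd_mul; reflexivity. }
assert (Hnz : forall n, (a * n + b <> 0)%Z).
{ intros n E; specialize (Hodd n); now rewrite E in Hodd. }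
destruct (log_dn_odd_sum (PI / x) a b Hc0 ltac:(lia) Hab) as [S1 S2].
set (h := fun k => odd_csch (PI / x) (k + b) * / IZR (k + b) * odd_cos_sum a k) in *.
(* [h] vanishes off the multiples of a. At a n the factor [odd_cos_sum] is a (-1)^n, which supplies
   the sign of the inner sum and the a in the prefactor. *)
assert (L : is_lim_seq (F_partial a b x) (PI / (IZR a * x) * SeriesZ h)).
{ apply is_lim_seq_ext with (fun N => PI / (IZR a * x) * symsum (fun n => h (a * n)%Z) N).
  - intros N; unfold F_partial; rewrite <- sumZ_scal; apply sumZ_ext; intros n _.
    rewrite F_term_SeriesZ by auto; unfold h.
    rewrite odd_cos_sum_multiple by lia; unfold odd_csch, odd_ind; rewrite Hodd.
    pose proof (IZR_mul_neq0 _ (PI / x) Hc0 (Hnz n)) as S; apply sinh_neq0 in S.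
    specialize (Hnz n); apply eq_IZR_contrapositive in Hnz; field; repeat split; auto; lra.
  - apply (is_lim_seq_scal_l _ _ (SeriesZ h)); apply SeriesZ_multiples_lim; auto; [lia|].
    intros k Hk; unfold h; rewrite odd_cos_sum_0 by (auto; lia); ring. }
split; [split|].
- intros n; apply F_term_summable; auto.
- eexists; exact L.
- unfold F; rewrite (is_lim_seq_unique _ _ L); simpl real; f_equal.
  rewrite <- S2; apply sumZ_ext; intros j _.
  rewrite <- Hc, <- ln_jacobi_dn by auto; f_equal; [f_equal; field; lra|].
  do 2 f_equal; field; lra.
Qed.
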